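(* Assume the setting of the time-inhomogeneous theorem: $G$ is a generator matrix on the discrete space $\mathcal X$ with no zero rows; $\theta>0$ and $M\in\mathbb N$ exceed $\inf\{r>0:I+r^{-1}G\text{ non-negative}\}$; $Q=I+G/\theta$; $\pi$ is a probability vector and $\mu$ a stationary distribution of $Q$ with $\pi^tQ^n\to\mu^t$ entrywise; $\mathbf T$ is the inhomogeneous Markov chain with initial law $\pi$ and kernels $K_n=I+\frac Gn\mathbb 1(n>M)$ (from time $n$ to $n+1$); $G'_{i,j}=\frac{\mu_j}{\mu_i}G_{j,i}\mathbb 1(\mu_i\ne0)$; $(\mathbf P',\mathbf Y')$ has MCcGEM$(G')$ distribution with respect to $\mu$. Then $\mu$ is a stationary distribution of $Q'=I+G'/\theta$. Let $\mathbf T'$ be the stationary homogeneous Markov chain with kernel $Q'$ and initial distribution $\mu$, and $\mathbf P^+$ a GEM$(\theta)$ sequence independent of $\mathbf T'$. Then, as $n\to\infty$, $\nu_n=\langle\frac1n\sum_{j=1}^n\delta_{T_j}(l):l\in\mathcal X\rangle$ converges in distribution to a random probability vector $\nu$ with $$\nu\overset d=\Big\langle\sum_{j=1}^\infty P'_j\delta_{Y'_j}(l):l\in\mathcal X\Big\rangle\overset d=\Big\langle\sum_{j=1}^\infty P^+_j\delta_{T'_j}(l):l\in\mathcal X\Big\rangle.$$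
   Context: Generator matrix: $G_{i,j}\ge0$ for $i\ne j$, $G_{i,i}=-\sum_{j\ne i}G_{i,j}$, $\sup_i|G_{i,i}|<\infty$. $K_G(w,z)=G_{w,z}/(-G_{w,w})$ if $w\ne z$ and $G_{w,w}\ne0$; $=1$ if $w=z$, $G_{w,w}=0$; $=0$ otherwise. GEM$(\theta)$: $P_j=X_j\prod_{i<j}(1-X_i)$, $X_j$ i.i.d. Beta$(1,\theta)$. MCcGEM$(G)$ with respect to $\mu$: law of $(\mathbf P,\mathbf Y)$ where $\mathbf Y$ is a Markov chain with kernel $K_G$ and initial law $\mu$, and given $\mathbf Y=\mathbf y$, $P_j=X_j\prod_{i<j}(1-X_i)$ with independent $X_j\sim$ Beta$(1,-G_{y_j,y_j})$ (Beta$(1,0)\equiv1$). Convergence in distribution of $\nu_n$ is for random elements of the space of probability vectors on $\mathcal X$ with the product (coordinatewise) topology. *)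

(* Defs.v *)
From HB Require Import structures.
From mathcomp Require Import all_boot all_order all_algebra.
From mathcomp Require Import all_classical all_reals all_analysis.
Set Implicit Arguments. Unset Strict Implicit. Unset Printing Implicit Defensive.
Import Order.TTheory GRing.Theory Num.Theory.
Import numFieldNormedType.Exports.
Local Open Scope classical_set_scope.
Local Open Scope ring_scope.

Section defs.
Context {R : realType} {X : countType}.

Definition generator (G : X -> X -> R) : Prop :=
  (forall i j, i != j -> 0 <= G i j) /\
  (forall i, ((- G i i)%:E = \esum_(j in [set j | j != i]) (G i j)%:E)%E) /\
  (exists C : R, forall i, `|G i i| <= C).

Definition no_zero_rows (G : X -> X -> R) : Prop :=
  forall i, exists j, G i j != 0.

Definition unif_rate (G : X -> X -> R) : R :=
  inf [set r : R | 0 < r /\ forall i j, 0 <= (i == j)%:R + G i j / r].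

Definition Qmat (G : X -> X -> R) (theta : R) : X -> X -> R :=
  fun i j => (i == j)%:R + G i j / theta.

Definition prob_vector (p : X -> R) : Prop :=
  (forall i, 0 <= p i) /\ (\esum_(i in [set: X]) (p i)%:E = 1)%E.

(* row vector times matrix (entries nonnegative in all uses) *)
Definition vecmat (v : X -> R) (Q : X -> X -> R) : X -> R :=
  fun j => fine (\esum_(i in [set: X]) (v i * Q i j)%:E).

Fixpoint vecmatn (v : X -> R) (Q : X -> X -> R) (n : nat) : X -> R :=
  if n is n'.+1 then vecmat (vecmatn v Q n') Q else v.

Definition stationary (mu : X -> R) (Q : X -> X -> R) : Prop :=
  prob_vector mu /\
  forall j, (\esum_(i in [set: X]) (mu i * Q i j)%:E = (mu j)%:E)%E.

Definition KG (G : X -> X -> R) (w z : X) : R :=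
  if w == z then (if G w w == 0 then 1 else 0)
  else if G w w == 0 then 0 else G w z / (- G w w).

Definition Grev (G : X -> X -> R) (mu : X -> R) (i j : X) : R :=
  if mu i == 0 then 0 else mu j / mu i * G j i.

(* kernel of the inhomogeneous chain from time n to n+1 : I + (G/n) 1(n > M) *)
Definition Kinh (G : X -> X -> R) (M n : nat) (i j : X) : R :=
  (i == j)%:R + G i j / n%:R * (M < n)%:R.

Definition beta1 (c : R) (B : set R) : \bar R :=
  if c == 0 then \d_(1 : R) B
  else (\int[@lebesgue_measure R]_(x in B `&` `[0%R, 1%R])
          (c * powR (1 - x) (c - 1))%:E)%E.

Definition stick (Xs : nat -> R) (j : nat) : R :=
  Xs j * \prod_(i < j) (1 - Xs i).

Definition weighted_vector (Xs : nat -> R) (Ys : nat -> X) : X -> R :=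
  fun l => fine (\sum_(0 <= j <oo) (stick Xs j * (Ys j == l)%:R)%:E)%E.

(* empirical vector < (1/n) sum_{j=1}^n delta_{T_j}(l) : l > ; Ts k = T_{k+1} *)
Definition empirical (Ts : nat -> X) (n : nat) : X -> R :=
  fun l => n%:R^-1 * \sum_(k < n) (Ts k == l)%:R.

End defs.

Section prob_defs.
Context {R : realType} {X : countType}.

Definition markov_chain {d} {Omega : measurableType d}
  (P : probability Omega R) (Y : nat -> Omega -> X) (init : X -> R)
  (K : nat -> X -> X -> R) : Prop :=
  (forall k x, measurable (Y k @^-1` [set x])) /\
  forall (n : nat) (y : nat -> X),
    P [set w | forall k, (k <= n)%N -> Y k w = y k] =
    (init (y 0%N) * \prod_(k < n) K k (y k) (y k.+1))%:E.

(* (Y_k) is a homogeneous Markov chain with initial law init and kernel K and,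
   conditionally on Y = y, the Xs_k are independent with Xs_k ~ Beta(1, c (y_k)).
   (Joint law of every finite-dimensional cylinder.) *)
Definition mc_with_cond_beta {d} {Omega : measurableType d}
  (P : probability Omega R) (Y : nat -> Omega -> X) (Xs : nat -> Omega -> R)
  (init : X -> R) (K : X -> X -> R) (c : X -> R) : Prop :=
  (forall k x, measurable (Y k @^-1` [set x])) /\
  (forall k, measurable_fun [set: Omega] (Xs k)) /\
  forall (n : nat) (y : nat -> X) (B : nat -> set R),
    (forall k, measurable (B k)) ->
    P [set w | forall k, (k <= n)%N -> Y k w = y k /\ B k (Xs k w)] =
    ((init (y 0%N) * \prod_(k < n) K (y k) (y k.+1))%:E *
      \prod_(k < n.+1) beta1 (c (y k)) (B k))%E.

Definition bc_test (f : {ptws X -> R} -> R) : Prop :=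
  {within [set p : {ptws X -> R} | prob_vector p], continuous f} /\
  exists C : R, forall p : {ptws X -> R}, prob_vector p -> `|f p| <= C.

Definition cvg_in_law {d d0} {Omega : measurableType d} {Omega0 : measurableType d0}
  (P : probability Omega R) (nus : nat -> Omega -> {ptws X -> R})
  (P0 : probability Omega0 R) (nu : Omega0 -> {ptws X -> R}) : Prop :=
  forall f, bc_test f ->
    (fun n => \int[P]_w (f (nus n w))%:E)%E @ \oo -->
      (\int[P0]_w (f (nu w))%:E)%E.

Definition eq_in_law {d1 d2} {O1 : measurableType d1} {O2 : measurableType d2}
  (P1 : probability O1 R) (nu1 : O1 -> {ptws X -> R})
  (P2 : probability O2 R) (nu2 : O2 -> {ptws X -> R}) : Prop :=
  forall f, bc_test f ->
    (\int[P1]_w (f (nu1 w))%:E = \int[P2]_w (f (nu2 w))%:E)%E.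

End prob_defs.

(* Main.v *)
Require Import Defs.
From HB Require Import structures.
From mathcomp Require Import all_boot all_order all_algebra.
From mathcomp Require Import finmap.
From mathcomp Require Import all_classical all_reals all_analysis.
From mathcomp Require Import measurable_realfun.
From mathcomp Require Import ring lra.
Import Order.TTheory GRing.Theory Num.Theory.
Import numFieldNormedType.Exports.
Local Open Scope classical_set_scope.
Local Open Scope ring_scope.
Import HBNNSimple.

Set Implicit Arguments.
Unset Strict Implicit.
Unset Printing Implicit Defensive.

(** Method of moments.  For a finite list L of states and phi x the number of
   occurrences of x in L, the moments
   E[(sum_(j <= n) phi(T_j) / n)^k ; T_n = y] satisfy a recursion in n which is
   a contraction towards the unique solution w_k of w_0 = mu and
   (k + theta) w_k(y) = theta (w_k Q)(y) + k phi(y) w_(k-1)(y).  If (Y, X) is a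
   stationary chain with Beta(1, c) sticks and nu its weighted occupation
   vector, peeling off the first stick shows that E[(phi . nu)^k ; Y_0 = y]
   solves the same equations, both for the jump kernel of G' and for Q', by time
   reversal with respect to mu.  Convergence of these moments gives convergence
   of E[exp(sum_(x in L) p_x)], hence of every function in the uniform closure
   of the algebra so generated; a nonnegative continuous function on the simplex
   is an increasing limit of such functions, which gives convergence in law to
   any realization.  One realization is built on ([0,1], Lebesgue): the even and
   the odd binary digits of a uniform number are independent uniform numbers. *)

(** The moments are taken jointly with the current state because only then does one step of the
    chain give a closed linear recursion. The contraction does not come from [Q], which merely does
    not expand L1 distances: replacing the normalisation [N ^ k] by [(N+1) ^ k] damps the error by
    about [1 - k / N], and the harmonic series diverges. Order 0 has no such factor; there the
    convergence of [pi Q^n] enters. The limit equations see the stick process only through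
    [c K + (theta - c) I = theta Q'], which holds for the jump kernel with rates [- G' x x] and,
    trivially, for [Q'] with rate [theta]; hence the two representations agree. The simplex over an
    infinite [X] is not compact for coordinatewise convergence, so a test function need not be a
    uniform limit of the algebra. Approximation from below is enough: it bounds lower limits for
    [C + f] and [C - f]. Exponentials of sums over lists are multiplied by concatenation, so moments
    of single sums suffice and mixed moments never appear. The equalities in law follow from
    uniqueness of limits. *)

(** * Sums of nonnegative families, stochastic kernels and L1 distance *)

Section real_sums.
Context {R : realType} {X : countType}.
Implicit Types (f g v : X -> R) (K : X -> X -> R).

Definition summ f := (\esum_(x in [set: X]) (f x)%:E < +oo)%E.
Definition rsum f : R := fine (\esum_(x in [set: X]) (f x)%:E)%E.
(** The two conditions under which [fine] in [rsum] loses nothing, so that sums can be handled as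
    real numbers. *)
Definition nnsumm f := (forall x, 0 <= f x) /\ summ f.

Lemma esum_rsum f : nnsumm f -> (\esum_(x in [set: X]) (f x)%:E = (rsum f)%:E)%E.
Proof.
move=> [f0 sf]; rewrite /rsum fineK// ge0_fin_numE//.
by apply: esum_ge0 => x _; rewrite lee_fin.
Qed.

Lemma nnsumm_of_esum f (s : R) : (forall x, 0 <= f x) ->
  (\esum_(x in [set: X]) (f x)%:E = s%:E)%E -> nnsumm f /\ rsum f = s.
Proof. by move=> f0 fs; rewrite /nnsumm /summ /rsum fs ltry. Qed.

Lemma esumZl (c : R) (a : X -> \bar R) : 0 <= c -> (forall x, 0 <= a x)%E ->
  (\esum_(x in [set: X]) (c%:E * a x) = c%:E * \esum_(x in [set: X]) a x)%E.
Proof.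
(* One inequality for all factors suffices: for nonzero [c] the converse is the same inequality with
   factor [c^-1]. *)
have key (k : R) (b : X -> \bar R) : 0 <= k -> (forall x, 0 <= b x)%E ->
  (\esum_(x in [set: X]) (k%:E * b x) <= k%:E * \esum_(x in [set: X]) b x)%E.
  move=> k0 b0; apply: ge_ereal_sup => _ [A [finA _] <-].
  rewrite -ge0_mule_fsumr//; apply: lee_wpmul2l; rewrite ?lee_fin//.
  by apply: ereal_sup_ubound; exists A.
move=> c0 a0; apply/eqP; rewrite eq_le key//=.
have [->|cn0] := eqVneq c 0.
  by rewrite mul0e; apply: esum_ge0 => x _; rewrite mul0e.
have cp : 0 < c by rewrite lt_neqAle eq_sym cn0.
have ca0 x : (0 <= c%:E * a x)%E by apply: mule_ge0; rewrite ?lee_fin.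
have := @key c^-1 _ _ ca0; rewrite invr_ge0 => /(_ c0).
under eq_esum do rewrite muleA -EFinM mulVf// mul1e.
by move=> h; rewrite -lee_pdivlMl.
Qed.

Lemma esum_swap (Y : countType) (a : X -> Y -> \bar R) :
  (forall x y, 0 <= a x y)%E ->
  (\esum_(x in [set: X]) \esum_(y in [set: Y]) a x y =
   \esum_(y in [set: Y]) \esum_(x in [set: X]) a x y)%E.
Proof.
move=> a0; rewrite !esum_esum//.
rewrite (reindex_esum ([set: Y] `*` [set: X]) _ (fun p => (p.2, p.1)))//.
by split=> [[]//|[b1 b2] [c d] _ _ [-> ->]//|[b1 b2] _]; exists (b2, b1).
Qed.

Lemma rsum_ge0 f : (forall x, 0 <= f x) -> 0 <= rsum f.
Proof. by move=> f0; apply/fine_ge0/esum_ge0 => x _; rewrite lee_fin. Qed.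

Lemma eq_rsum f g : f =1 g -> rsum f = rsum g.
Proof. by move=> fg; rewrite /rsum; congr fine; apply: eq_esum => x _; rewrite fg. Qed.

Lemma nnsumm_ext f g : f =1 g -> nnsumm f -> nnsumm g.
Proof. by move=> /funext ->. Qed.

Lemma nnsumm_le f g : (forall x, 0 <= f x <= g x) -> nnsumm g -> nnsumm f.
Proof.
move=> fg [g0 sg]; split=> [x|]; first by case/andP: (fg x).
apply: le_lt_trans sg; apply: le_esum => x _; rewrite lee_fin.
by case/andP: (fg x).
Qed.

Lemma le_rsum f g : (forall x, 0 <= f x <= g x) -> nnsumm g -> rsum f <= rsum g.
Proof.
move=> fg sg; rewrite -lee_fin -!esum_rsum//; last exact: nnsumm_le sg.
by apply: le_esum => x _; rewrite lee_fin; case/andP: (fg x).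
Qed.

Lemma nnsummD f g : nnsumm f -> nnsumm g -> nnsumm (fun x => f x + g x).
Proof.
move=> [f0 sf] [g0 sg]; split=> [x|]; first exact: addr_ge0.
rewrite /summ; under eq_esum do rewrite EFinD.
by rewrite esumD// ?lte_add_pinfty// => x _; rewrite lee_fin.
Qed.

Lemma rsumD f g : nnsumm f -> nnsumm g ->
  rsum (fun x => f x + g x) = rsum f + rsum g.
Proof.
move=> sf sg; apply: EFin_inj; rewrite EFinD -!esum_rsum//; last exact: nnsummD.
under eq_esum do rewrite EFinD.
by case: sf sg => f0 _ [g0 _]; rewrite esumD// => x _; rewrite lee_fin.
Qed.

Lemma nnsummZ (c : R) f : 0 <= c -> nnsumm f -> nnsumm (fun x => c * f x).
Proof.
move=> c0 sf; have f0 := sf.1; split=> [x|]; first exact: mulr_ge0.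
rewrite /summ; under eq_esum do rewrite EFinM.
by rewrite esumZl// esum_rsum// ltry.
Qed.

Lemma rsumZ (c : R) f : 0 <= c -> nnsumm f -> rsum (fun x => c * f x) = c * rsum f.
Proof.
move=> c0 sf; apply: EFin_inj; rewrite EFinM -!esum_rsum//; last exact: nnsummZ.
under eq_esum do rewrite EFinM.
by case: sf => f0 _; rewrite esumZl// => x; rewrite lee_fin.
Qed.

Lemma nnsumm0 : nnsumm (fun _ => 0).
Proof. by split=> //; rewrite /summ esum1// ltry. Qed.

Lemma rsum0 : rsum (fun _ => 0) = 0.
Proof. by rewrite /rsum esum1. Qed.

Lemma nnsumm_sum (I : Type) (r : seq I) (F : I -> X -> R) :
  (forall i, nnsumm (F i)) -> nnsumm (fun x => \sum_(i <- r) F i x).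
Proof.
move=> sF; elim: r => [|i r ih].
  by apply: nnsumm_ext nnsumm0 => x; rewrite big_nil.
by apply: nnsumm_ext (nnsummD (sF i) ih) => x; rewrite big_cons.
Qed.

Lemma rsum_sum (I : Type) (r : seq I) (F : I -> X -> R) :
  (forall i, nnsumm (F i)) ->
  rsum (fun x => \sum_(i <- r) F i x) = \sum_(i <- r) rsum (F i).
Proof.
move=> sF; elim: r => [|i r ih].
  by rewrite big_nil -[RHS]rsum0; apply: eq_rsum => x; rewrite big_nil.
rewrite big_cons -ih -rsumD//; last exact: nnsumm_sum.
by apply: eq_rsum => x; rewrite big_cons.
Qed.

Lemma ler_term_rsum f x : nnsumm f -> f x <= rsum f.
Proof.
move=> sf; rewrite -lee_fin -esum_rsum//.
case: sf => f0 _.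
rewrite (esumID [set x])//; last by move=> y _; rewrite lee_fin.
rewrite setTI esum_set1 ?lee_fin// leeDl//; apply: esum_ge0 => y _.
by rewrite lee_fin.
Qed.

Lemma rsum_eq0 f : nnsumm f -> rsum f = 0 -> forall x, f x = 0.
Proof.
move=> sf f0 x; apply/eqP; rewrite eq_le sf.1 andbT -f0.
exact: ler_term_rsum.
Qed.

Lemma nnsumm_dist f g : nnsumm f -> nnsumm g -> nnsumm (fun x => `|f x - g x|).
Proof.
move=> sf sg; apply: nnsumm_le (nnsummD sf sg) => x; rewrite normr_ge0/=.
by rewrite (le_trans (ler_normB _ _))// !ger0_norm ?sf.1 ?sg.1.
Qed.

Lemma rsum_dist f g : nnsumm f -> nnsumm g ->
  `|rsum f - rsum g| <= rsum (fun x => `|f x - g x|).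
Proof.
move=> sf sg; have sd := nnsumm_dist sf sg.
have sd' : nnsumm (fun x => `|g x - f x|) by exact: nnsumm_dist.
have h a b : nnsumm a -> nnsumm b -> rsum a <= rsum b + rsum (fun x => `|a x - b x|).
  move=> sa sb; rewrite -rsumD//; last exact: nnsumm_dist.
  apply: le_rsum; last by apply: nnsummD => //; exact: nnsumm_dist.
  by move=> x; rewrite sa.1/= -lerBlDl ler_norm.
have := h f g sf sg; have := h g f sg sf.
rewrite (eq_rsum (f := fun x => `|g x - f x|) (g := fun x => `|f x - g x|)).
  by move=> *; rewrite ler_norml; apply/andP; split; lra.
by move=> x; rewrite distrC.
Qed.

Definition stochastic K := (forall x y, 0 <= K x y) /\ forall x, nnsumm (K x) /\ rsum (K x) = 1.

Lemma stochastic_le1 K x y : stochastic K -> K x y <= 1.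
Proof. by move=> [K0 /(_ x)[sK <-]]; exact: ler_term_rsum. Qed.

Lemma esum_vecmat v K : nnsumm v -> stochastic K ->
  (\esum_(y in [set: X]) \esum_(x in [set: X]) (v x * K x y)%:E = (rsum v)%:E)%E.
Proof.
move=> sv [K0 K1]; rewrite esum_swap; last first.
  by move=> *; rewrite lee_fin mulr_ge0// sv.1.
rewrite -esum_rsum//; apply: eq_esum => x _.
under eq_esum do rewrite EFinM.
rewrite esumZl//; [|exact: sv.1|by move=> *; rewrite lee_fin].
by rewrite esum_rsum ?(K1 x).2 ?mule1//; exact: (K1 x).1.
Qed.

Lemma nnsumm_vecmat_col v K y : nnsumm v -> stochastic K ->
  nnsumm (fun x => v x * K x y).
Proof.
move=> sv sK; apply: nnsumm_le (sv) => x.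
apply/andP; split; first by apply: mulr_ge0; [exact: sv.1|exact: sK.1].
by apply: ler_piMr; [exact: sv.1|exact: stochastic_le1].
Qed.

Lemma vecmatE v K y : vecmat v K y = rsum (fun x => v x * K x y).
Proof. by []. Qed.

Lemma vecmat_sum v K : nnsumm v -> stochastic K ->
  nnsumm (vecmat v K) /\ rsum (vecmat v K) = rsum v.
Proof.
move=> sv sK; apply: nnsumm_of_esum => [y|].
  by apply: rsum_ge0 => x; rewrite mulr_ge0 ?sv.1 ?sK.1.
rewrite -(esum_vecmat sv sK); apply: eq_esum => y _.
by rewrite vecmatE esum_rsum//; exact: nnsumm_vecmat_col.
Qed.

(** Triangle inequality in each column, then conservation of mass for [|v - w|]. The error estimates
    below rest on this property of stochastic kernels. *)
Lemma vecmat_dist v w K : nnsumm v -> nnsumm w -> stochastic K ->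
  rsum (fun y => `|vecmat v K y - vecmat w K y|) <= rsum (fun x => `|v x - w x|).
Proof.
move=> sv sw sK.
have sd := nnsumm_dist sv sw.
rewrite -(vecmat_sum sd sK).2; apply: le_rsum; last exact: (vecmat_sum sd sK).1.
move=> y; rewrite normr_ge0/= !vecmatE.
apply: le_trans (rsum_dist _ _) _; try exact: nnsumm_vecmat_col.
apply: le_rsum; last exact: nnsumm_vecmat_col.
by move=> x; rewrite normr_ge0/= -mulrBl normrM (ger0_norm (sK.1 _ _)).
Qed.

Lemma vecmatD (a b : R) v w K : 0 <= a -> 0 <= b -> nnsumm v -> nnsumm w -> stochastic K ->
  vecmat (fun x => a * v x + b * w x) K =1 fun y => a * vecmat v K y + b * vecmat w K y.
Proof.
move=> a0 b0 sv sw sK y; rewrite !vecmatE.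
rewrite -!rsumZ//; try exact: nnsumm_vecmat_col.
rewrite -rsumD; try by apply: nnsummZ => //; exact: nnsumm_vecmat_col.
by apply: eq_rsum => x; rewrite mulrDl !mulrA.
Qed.

Lemma prob_vectorP f : prob_vector f <-> nnsumm f /\ rsum f = 1.
Proof.
split=> [[f0 f1]|[sf f1]]; first exact: nnsumm_of_esum.
by split; [exact: sf.1|rewrite esum_rsum// f1].
Qed.

(* Scheffe's lemma. *)
Lemma prob_vector_cvg_rsum (p : nat -> X -> R) f :
  (forall n, prob_vector (p n)) -> prob_vector f ->
  (forall x, (fun n => p n x) @ \oo --> f x) ->
  (fun n => rsum (fun x => `|p n x - f x|)) @ \oo --> 0.
Proof.
move=> /(_ _)/prob_vectorP hp /prob_vectorP[sf f1] cvgp.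
apply/cvgrPdist_le => e e0.
(* [A] carries all but [e / 4] of the mass of [f]. Once the distance on [A] is at most [e / 4], the
   vector [p n] leaves at most [e / 2] outside [A], and the three contributions add up to [e]. *)
have [A uA hA] : exists2 A : seq X, uniq A & 1 - e / 4 <= \sum_(x <- A) f x.
  have : (\esum_(x in [set: X]) (f x)%:E > (1 - e / 4)%:E)%E.
    by rewrite esum_rsum// f1 lte_fin; lra.
  move=> /ereal_sup_gt[_ [A [finA _] <-]].
  rewrite fsbig_finite// => /ltW h; exists (finmap.enum_fset (fset_set A)); first exact: finmap.fset_uniq.
  by move: h; rewrite sumEFin lee_fin.
have split_sum g : nnsumm g -> rsum g = \sum_(x <- A) g x +
    rsum (fun x => g x * (x \notin A)%:R).
  move=> sg.
  have -> : \sum_(x <- A) g x = rsum (fun x => g x * (x \in A)%:R).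
    transitivity (rsum (fun x => \sum_(i <- A) g i * (x == i)%:R)).
      rewrite rsum_sum; last first.
        move=> i; apply: nnsumm_le (sg) => x; have g0 := sg.1 x.
        have [->|] := eqVneq x i; rewrite ?mulr1 ?mulr0 ?lexx ?sg.1//.
      apply: eq_bigr => i _; rewrite /rsum.
      rewrite (esumID [set i]); last first.
        by move=> x _; rewrite lee_fin mulr_ge0 ?sg.1.
      rewrite setTI esum_set1 ?eqxx ?mulr1 ?lee_fin ?sg.1//.
      by rewrite esum1 ?adde0// => x [_ /= /eqP/negbTE ->]; rewrite mulr0.
    apply: eq_rsum => x; have [xA|xA] := boolP (x \in A).
      rewrite (bigD1_seq x)//= eqxx big1 ?addr0// => i ix.
      by rewrite eq_sym (negbTE ix) mulr0.
    rewrite mulr0 big_seq big1// => i iA; have [xi|] := eqVneq x i; rewrite ?mulr0//.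
    by rewrite xi iA in xA.
  rewrite -rsumD; last 2 first.
  - by apply: nnsumm_le (sg) => x; have := sg.1 x; case: (x \in A); rewrite ?mulr1 ?mulr0; lra.
  - by apply: nnsumm_le (sg) => x; have := sg.1 x; case: (x \in A); rewrite ?mulr1 ?mulr0; lra.
  by apply: eq_rsum => x; case: (x \in A) => /=; rewrite ?mulr1 ?mulr0 ?addr0 ?add0r.
have cvgA : (fun n => \sum_(x <- A) `|p n x - f x|) @ \oo --> 0.
  elim: {uA hA split_sum} A => [|x A ih]; first by under eq_fun do rewrite big_nil; exact: cvg_cst.
  have c : (fun n => `|p n x - f x|) @ \oo --> (0 : R).
    by rewrite -[X in _ --> X](normr0 R); apply: cvg_norm; apply/subr_cvg0.
  under eq_fun do rewrite big_cons.
  suff : (fun n => `|p n x - f x| + \sum_(j <- A) `|p n j - f j|) @ \oo --> (0 + 0 : R).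
    by rewrite addr0.
  exact: cvgD c ih.
have e4 : 0 < e / 4 by lra.
move/cvgrPdist_le : cvgA => /(_ _ e4); apply: filterS => n.
rewrite !sub0r !normrN (ger0_norm (sumr_ge0 _ _))// => hn.
rewrite ger0_norm; last exact: rsum_ge0.
have [spn pn1] := hp n.
rewrite split_sum; last exact: nnsumm_dist.
have h1 : rsum (fun x => `|p n x - f x| * (x \notin A)%:R) <=
    rsum (fun x => p n x * (x \notin A)%:R) + rsum (fun x => f x * (x \notin A)%:R).
  rewrite -rsumD; last 2 first.
  - by apply: nnsumm_le (spn) => x; have := spn.1 x; case: (x \in A); rewrite ?mulr1 ?mulr0; lra.
  - by apply: nnsumm_le (sf) => x; have := sf.1 x; case: (x \in A); rewrite ?mulr1 ?mulr0; lra.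
  apply: le_rsum.
    move=> x; rewrite mulr_ge0//= -mulrDl ler_wpM2r//.
    by rewrite (le_trans (ler_normB _ _))// !ger0_norm ?sf.1 ?spn.1.
  apply: nnsumm_le (nnsummD spn sf) => x; have := spn.1 x; have := sf.1 x.
  by case: (x \in A); rewrite ?mulr1 ?mulr0; lra.
have := split_sum _ spn; have := split_sum _ sf; rewrite f1 pn1.
have h2 : \sum_(x <- A) f x <= \sum_(x <- A) p n x + \sum_(x <- A) `|p n x - f x|.
  rewrite -big_split/=; apply: ler_sum => x _.
  by rewrite -lerBlDl distrC ler_norm.
lra.
Qed.

End real_sums.

(** * Scalar recursions with steps of harmonic size *)

Section scalar_recursion.
Context {R : realType}.

Lemma harmonic_sum_ge (m : nat) (B : R) :
  exists n1, forall n, (n1 <= n)%N -> B <= \sum_(m <= i < n) i.+1%:R^-1.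
Proof.
have ndh : nondecreasing_seq (series (@harmonic R)).
  by apply: nondecreasing_series => i _ _; exact: harmonic_ge0.
have := nondecreasing_dvgn_lt ndh (@dvg_harmonic R).
move=> /cvgryPge/(_ (B + \sum_(0 <= i < m) i.+1%:R^-1))[n1 _ h].
exists (maxn n1 m) => n; rewrite geq_max => /andP[n1n mn].
have := h n n1n; rewrite /series/= (big_cat_nat (leq0n m) mn)/=; lra.
Qed.

(** The weights are at least [c / n.+1], so the divergence of the harmonic series makes the initial
    excess over [y] vanish. *)
Lemma averaging_recursion (x a : nat -> R) (c y d : R) (n0 : nat) : 0 < c -> 0 < d ->
  (forall n, (n0 <= n)%N -> 0 <= a n <= 1 /\ c / n.+1%:R <= a n) ->
  (forall n, (n0 <= n)%N -> x n.+1 <= (1 - a n) * x n + a n * y) ->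
  exists n1, forall n, (n1 <= n)%N -> x n <= y + d.
Proof.
move=> c0 d0 ha hx.
pose Z := Num.max (x n0 - y) 0.
have Z0 : 0 <= Z by rewrite le_max lexx orbT.
(* The excess times a growing harmonic factor stays bounded, since
   [(1 - a) (1 + c S + e) <= 1 + c S] for [0 <= e <= a]. This replaces an estimate of the product of
   the [1 - a n]. *)
have key n : (n0 <= n)%N ->
    (x n - y) * (1 + c * \sum_(n0 <= i < n) i.+1%:R^-1) <= Z.
  elim: n => [|n ih].
    rewrite leqn0 => /eqP n00; rewrite -{1}n00 big_geq ?n00//= mulr0 addr0 mulr1.
    by rewrite /Z n00 le_max lexx.
  rewrite leq_eqVlt => /orP[/eqP <-|].
    by rewrite big_geq// mulr0 addr0 mulr1 /Z le_max lexx.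
  rewrite ltnS => nn; rewrite big_nat_recr//=.
  have [/andP[an0 an1] can] := ha _ nn; have := ih nn; have := hx _ nn.
  set S := \sum_(_ <= _ < _) _ => hxn hS.
  have S0 : 0 <= c * S by apply: mulr_ge0; [exact: ltW|exact: sumr_ge0].
  rewrite (mulrDr c); set e := c / _ in can *.
  have e0 : 0 <= e by rewrite divr_ge0// ltW.
  have h1 : x n.+1 - y <= (1 - a n) * (x n - y) by lra.
  have [neg|pos] := leP (x n - y) 0.
    apply: le_trans _ Z0.
    have h0 : x n.+1 - y <= 0 by apply: le_trans h1 _; apply: mulr_ge0_le0 => //; lra.
    by apply: mulr_le0_ge0 => //; lra.
  apply: le_trans _ hS.
  have h2 : (x n.+1 - y) * (1 + (c * S + e)) <= (1 - a n) * (x n - y) * (1 + (c * S + e)).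
    by apply: ler_wpM2r => //; lra.
  apply: le_trans h2 _; rewrite mulrAC [leRHS]mulrC; apply: ler_wpM2r; first exact: ltW.
  by nra.
have [n1 hn1] := harmonic_sum_ge n0 (Z / d / c).
exists (maxn n0 n1) => n; rewrite geq_max => /andP[/key h /hn1].
set S := \sum_(_ <= _ < _) _ in h * => hS.
have [neg|pos] := leP (x n - y) 0; first lra.
rewrite -lerBlDl.
rewrite leNgt; apply/negP => dx.
have : Z <= d * (c * S) by rewrite mulrC -ler_pdivrMr// [c * S]mulrC -ler_pdivrMr.
move=> ZS; have cS0 : 0 <= c * S.
  by rewrite -(pmulr_rge0 _ d0); exact: le_trans _ ZS.
by nra.
Qed.

Lemma cvg0P (u : nat -> R) : (forall n, 0 <= u n) ->
  (u @ \oo --> 0) <-> (forall e, 0 < e -> exists n1, forall n, (n1 <= n)%N -> u n <= e).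
Proof.
move=> u0; split=> [/cvgrPdist_le h e e0|h].
  have [n1 _ hn1] := h _ e0; exists n1 => n /hn1.
  by rewrite sub0r normrN ger0_norm.
apply/cvgrPdist_le => e e0; have [n1 hn1] := h _ e0.
by exists n1 => // n /hn1; rewrite sub0r normrN ger0_norm.
Qed.

(** Used at [x = 1 / N], for the ratio [((N+1) / N) ^ k] of successive normalisations. *)
Lemma pow1D_bounds (k : nat) : exists2 B : R, 0 <= B &
  forall x, 0 <= x <= 1 -> 1 + k%:R * x <= (1 + x) ^+ k <= 1 + k%:R * x + B * x ^+ 2.
Proof.
elim: k => [|k [B B0 ih]].
  by exists 0 => // x _; rewrite expr0 !mul0r !addr0 lexx.
exists (k%:R + 2 * B); first by rewrite addr_ge0// mulr_ge0.
move=> x x01; have /andP[h1 h2] := ih _ x01; case/andP: x01 => x0 x1.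
rewrite exprS -natr1.
have k0 : 0 <= k%:R :> R by [].
apply/andP; split.
  have : (1 + x) * (1 + k%:R * x) <= (1 + x) * (1 + x) ^+ k.
    by rewrite ler_wpM2l//; lra.
  by apply: le_trans; nra.
have : (1 + x) * (1 + x) ^+ k <= (1 + x) * (1 + k%:R * x + B * x ^+ 2).
  by rewrite ler_wpM2l//; lra.
move=> /le_trans; apply.
have -> : (1 + x) * (1 + k%:R * x + B * x ^+ 2) =
  1 + (k%:R + 1) * x + (k%:R + B) * x ^+ 2 + B * x ^+ 2 * x by ring.
have : B * x ^+ 2 * x <= B * x ^+ 2 by rewrite ler_piMr// mulr_ge0// sqr_ge0.
lra.
Qed.

End scalar_recursion.

(** * Abstract moment recursion and convergence to its fixed point *)

Section moment_recursion.
Context {R : realType} {X : countType}.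
Variables (theta C : R) (M : nat) (Q : X -> X -> R) (mu phi : X -> R).
Variables (V KV : nat -> nat -> X -> R) (w : nat -> X -> R).
Hypotheses (theta0 : 0 < theta) (C0 : 0 <= C) (sQ : stochastic Q).
Hypotheses (smu : nnsumm mu) (muQ : vecmat mu Q =1 mu).
Hypothesis phiC : forall x, 0 <= phi x <= C.
Hypothesis sV : forall k N, (0 < N)%N -> nnsumm (V k N).
Hypothesis V_le : forall k N, (0 < N)%N -> rsum (V k N) <= (C * N%:R) ^+ k.
Hypothesis sKV : forall k N, (0 < N)%N -> nnsumm (KV k N).
Hypothesis KV_sum : forall k N, (0 < N)%N -> rsum (KV k N) = rsum (V k N).
Hypothesis KV_id : forall k N, (0 < N)%N -> (N <= M)%N -> KV k N =1 V k N.
Hypothesis KV_step : forall k N, (0 < N)%N -> (M < N)%N -> forall y,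
  KV k N y + theta / N%:R * V k N y = V k N y + theta / N%:R * vecmat (V k N) Q y.
Hypothesis V_rec : forall k N, (0 < N)%N -> forall y,
  V k N.+1 y = \sum_(r < k.+1) 'C(k, r)%:R * phi y ^+ (k - r) * KV r N y.
Hypothesis sw : forall k, nnsumm (w k).
Hypothesis w0 : w 0 =1 mu.
Hypothesis w_rec : forall k y,
  (k.+1%:R + theta) * w k.+1 y = theta * vecmat (w k.+1) Q y + k.+1%:R * phi y * w k y.
Hypothesis V1 : (fun r => rsum (fun x => `|vecmatn (V 0 1) Q r x - mu x|)) @ \oo --> 0.

Local Notation dist v u := (rsum (fun x => `|v x - u x|)).

Lemma nnsumm_vecmatn v r : nnsumm v -> nnsumm (vecmatn v Q r).
Proof. by move=> sv; elim: r => //= r ih; exact: (vecmat_sum ih sQ).1. Qed.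

Lemma vecmatn_vecmat v r : vecmatn (vecmat v Q) Q r = vecmatn v Q r.+1.
Proof. by elim: r => //= r ->. Qed.

Lemma vecmatn_lin (a b : R) u v r : 0 <= a -> 0 <= b -> nnsumm u -> nnsumm v ->
  vecmatn (fun x => a * u x + b * v x) Q r =1 fun y => a * vecmatn u Q r y + b * vecmatn v Q r y.
Proof.
move=> a0 b0 su sv; elim: r => //= r ih y.
rewrite -vecmatD//; try exact: nnsumm_vecmatn.
by rewrite (funext ih).
Qed.

(** Distance to [mu] of the law at time [N] after [r] further steps of [Q]. Since the kernel at time
    [N] is a combination of the identity and [Q], one step of the chain involves only [b r] and
    [b r.+1]. *)
Let b r N := dist (vecmatn (V 0 N) Q r) mu.

Let b_ge0 r N : 0 <= b r N.
Proof. exact: rsum_ge0. Qed.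

Let b_decr r N : (0 < N)%N -> b r.+1 N <= b r N.
Proof.
move=> N0; apply: le_trans _ (vecmat_dist (nnsumm_vecmatn r (sV 0 N0)) smu sQ).
by rewrite le_eqVlt; apply/orP; left; apply/eqP/eq_rsum => x; rewrite muQ.
Qed.

Let b_step r N : (0 < N)%N -> (M < N)%N ->
  b r N.+1 <= `|1 - theta / N%:R| * b r N + theta / N%:R * b r.+1 N.
Proof.
move=> N0 MN; set t := theta / _.
have t0 : 0 <= t by rewrite divr_ge0// ltW.
have sr := nnsumm_vecmatn _ (sV 0 N0).
rewrite /b -!rsumZ//; try (apply: nnsumm_dist => //; exact: sr).
rewrite -rsumD; try (apply: nnsummZ => //; apply: nnsumm_dist => //; exact: sr).
apply: le_rsum; last first.
  by apply: nnsummD; apply: nnsummZ => //; apply: nnsumm_dist => //; exact: sr.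
move=> x; rewrite normr_ge0/=.
have h : vecmatn (V 0 N.+1) Q r x + t * vecmatn (V 0 N) Q r x =
   vecmatn (V 0 N) Q r x + t * vecmatn (V 0 N) Q r.+1 x.
  have -> : V 0 N.+1 = KV 0 N.
    by apply/funext => y; rewrite V_rec// big_ord1 bin0 expr0 !mul1r.
  have := vecmatn_lin r ler01 t0 (sKV 0 N0) (sV 0 N0) x.
  rewrite mul1r => <-.
  rewrite -vecmatn_vecmat -[X in _ = X + _]mul1r -vecmatn_lin//;
    [|exact: sV|exact: (vecmat_sum (sV 0 N0) sQ).1].
  by apply: (congr1 (fun v => vecmatn v Q r x)); apply/funext => y; rewrite !mul1r KV_step.
have -> : vecmatn (V 0 N.+1) Q r x - mu x = (1 - t) * (vecmatn (V 0 N) Q r x - mu x) +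
   t * (vecmatn (V 0 N) Q r.+1 x - mu x) by lra.
by apply: le_trans (ler_normD _ _) _; rewrite normrM (normrM t) (ger0_norm t0).
Qed.

(** The hypothesis on [V 0 1] gives this at time 1. Each later step of the chain enlarges [b r] by a
    bounded factor at most, which a better choice of [r] absorbs. *)
Let b_small N : (0 < N)%N -> forall e, 0 < e -> exists r, b r N <= e.
Proof.
case: N => // N _; elim: N => [|N ih] e e0.
  have /(_ _ e0)[r hr] := (iffLR (cvg0P (b_ge0 ^~ 1%N))) V1.
  by exists r; exact: hr.
have [MN|NM] := ltnP M N.+1; last first.
  have [r hr] := ih _ e0; exists r.
  have -> : b r N.+2 = b r N.+1; last by [].
  rewrite /b; suff -> : V 0 N.+2 = V 0 N.+1 by [].
  by apply/funext => y; rewrite V_rec// big_ord1 bin0 expr0 !mul1r KV_id.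
set t := theta / N.+1%:R.
have t0 : 0 <= t by rewrite divr_ge0// ltW.
pose A := `|1 - t| + t + 1.
have A0 : 0 < A by rewrite /A; have := normr_ge0 (1 - t); lra.
have [r hr] := ih (e / A) (divr_gt0 e0 A0); exists r.
apply: le_trans (b_step r (ltn0Sn N) MN) _.
have h1 := b_decr r (ltn0Sn N).
have : `|1 - t| * b r N.+1 + t * b r.+1 N.+1 <= A * b r N.+1.
  rewrite /A !mulrDl mul1r; have := ler_wpM2l t0 h1; have := b_ge0 r N.+1; lra.
move=> /le_trans; apply; by rewrite mulrC -ler_pdivlMr.
Qed.

(** From time [J] on the kernel is a true convex combination [(1 - t) I + t Q] with
    [t = theta / N]. *)
Let J := (maxn M (Num.bound theta)).+1.

Let J_spec N : (J <= N)%N -> [/\ (0 < N)%N, (M < N)%N & theta / N%:R <= 1].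
Proof.
rewrite /J gtn_max => /andP[MN tN]; have N0 : (0 < N)%N by exact: leq_trans MN.
split=> //; rewrite ler_pdivrMr ?ltr0n// mul1r.
apply: le_trans (ltW (archi_boundP (ltW theta0))) _.
by rewrite ler_nat ltnW.
Qed.

Lemma law_cvg : (fun N => dist (V 0 N.+1) mu) @ \oo --> 0.
Proof.
suff h e : 0 < e -> exists n1, forall N, (n1 <= N)%N -> b 0 N <= e.
  apply/cvg0P => [N|e e0]; first exact: rsum_ge0.
  have [n1 hn1] := h _ e0; exists n1 => N n1N.
  by apply: hn1; exact: leq_trans (leqnSn _).
move=> e0; have e2 : 0 < e / 2 by lra.
have [J0 MJ tJ] := J_spec (leqnn J).
have [r0 hr0] := b_small J0 e2.
(* For this fixed [r0] the distance does not increase after [J], so it stays below [e / 2]. *)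
have [n0 hn0] : exists n0, forall d, 0 < d -> exists2 n1, (n0 <= n1)%N & forall N, (n1 <= N)%N -> b r0 N <= e / 2 + d.
  exists J => d d0; exists J => // N JN.
  have hc r N' : (J <= N')%N -> b r N'.+1 <= b r N'.
    move=> JN'; have [N'0 MN' tN'] := J_spec JN'.
    apply: le_trans (b_step r N'0 MN') _.
    rewrite ger0_norm ?subr_ge0//.
    have t0 : 0 <= theta / N'%:R by rewrite divr_ge0// ltW.
    have := ler_wpM2l t0 (b_decr r N'0); lra.
  have : b r0 N <= b r0 J.
    rewrite -(subnK JN); elim: (N - J)%N => [|m ih]; first by rewrite add0n.
    by rewrite addSn; apply: le_trans (hc _ _ (leq_addl _ _)) ih.
  lra.
have {n0 hn0} : forall d, 0 < d -> exists n1, forall N, (n1 <= N)%N -> b r0 N <= e / 2 + d.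
  by move=> d /hn0[n1 _ h]; exists n1.
(* Descent in [r]: [b r] is averaged towards [b r.+1] with weights [theta / N], so an asymptotic
   bound on [b r.+1] passes to [b r], down to [r = 0]. *)
elim: r0 {hr0} => [h|r ih h]; first by have [n1 hn1] := h _ e2; exists n1 => N /hn1; lra.
apply: ih => d d0; have d2 : 0 < d / 2 by lra.
have [n1 hn1] := h _ d2.
have := @averaging_recursion R (b r) (fun N => theta / N%:R) theta (e / 2 + d / 2) (d / 2)
  (maxn J n1) theta0 d2.
case.
- move=> N; rewrite geq_max => /andP[/J_spec[N0 _ tN] _]; split.
    by rewrite tN divr_ge0// ltW.
  by rewrite ler_pM2l// lef_pV2 ?posrE ?ltr0n// ler_nat.
- move=> N; rewrite geq_max => /andP[/J_spec[N0 MN tN] n1N].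
  apply: le_trans (b_step r N0 MN) _; rewrite ger0_norm ?subr_ge0//.
  by rewrite lerD2l ler_wpM2l ?hn1// divr_ge0// ltW.
by move=> n2 hn2; exists n2 => N /hn2; lra.
Qed.

Lemma nnsummZphi (c : nat) v : nnsumm v -> nnsumm (fun y => phi y ^+ c * v y) /\
  rsum (fun y => phi y ^+ c * v y) <= C ^+ c * rsum v.
Proof.
move=> sv.
have h x : 0 <= phi x ^+ c * v x <= C ^+ c * v x.
  have /andP[p0 pC] := phiC x.
  rewrite mulr_ge0 ?exprn_ge0 ?sv.1//= ler_wpM2r ?sv.1// lerXn2r ?nnegrE//.
split; first by apply: nnsumm_le h _; apply: nnsummZ => //; exact: exprn_ge0.
by rewrite -rsumZ ?exprn_ge0//; apply: le_rsum h _; apply: nnsummZ => //; exact: exprn_ge0.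
Qed.

Let u k N x := V k N x / N%:R ^+ k.

Let su k N : (0 < N)%N -> nnsumm (u k N) /\ rsum (u k N) <= C ^+ k.
Proof.
move=> N0; have -> : u k N = fun x => (N%:R ^+ k)^-1 * V k N x.
  by apply/funext => x; rewrite mulrC.
have c0 : 0 <= (N%:R ^+ k)^-1 :> R by rewrite invr_ge0 exprn_ge0.
split; first by apply: nnsummZ => //; exact: sV.
rewrite rsumZ//; last exact: sV.
rewrite mulrC ler_pdivrMr ?exprn_gt0 ?ltr0n// -exprMn; exact: V_le.
Qed.

(** The terms of the binomial expansion with at least two factors [phi] at the new state; after
    normalisation they are of order [N^-2]. *)
Let rest k N y := \sum_(r < k) 'C(k.+1, r)%:R * phi y ^+ (k.+1 - r) * KV r N y.

Let rest_le k : exists2 A : R, 0 <= A & forall N, (0 < N)%N ->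
  nnsumm (rest k N) /\ rsum (rest k N) <= A * N%:R ^+ k.+1 / N%:R ^+ 2.
Proof.
exists (\sum_(r < k) 'C(k.+1, r)%:R * C ^+ k.+1).
  by apply: sumr_ge0 => r _; rewrite mulr_ge0// exprn_ge0.
move=> N N0.
have h (r : 'I_k) := nnsummZphi (k.+1 - r) (sKV r N0).
have sF (r : 'I_k) : nnsumm (fun y => 'C(k.+1, r)%:R * phi y ^+ (k.+1 - r) * KV r N y).
  apply: nnsumm_ext (nnsummZ (ler0n _ 'C(k.+1, r)) (h r).1) => y.
  by rewrite mulrA.
split; first exact: nnsumm_sum.
rewrite rsum_sum// !mulr_suml; apply: ler_sum => r _.
have -> : rsum (fun y => 'C(k.+1, r)%:R * phi y ^+ (k.+1 - r) * KV r N y) =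
  'C(k.+1, r)%:R * rsum (fun y => phi y ^+ (k.+1 - r) * KV r N y).
  rewrite -rsumZ//; last exact: (h r).1.
  by apply: eq_rsum => y; rewrite mulrA.
rewrite -!mulrA ler_wpM2l//.
apply: le_trans (h r).2 _; rewrite KV_sum//.
have := ler_wpM2l (exprn_ge0 (k.+1 - r) C0) (V_le r N0) => /le_trans; apply.
rewrite exprMn (mulrA (C ^+ (k.+1 - r)%N)) -exprD subnK ?(leq_trans (ltnW (ltn_ord r)))//.
rewrite ler_wpM2l ?exprn_ge0//.
have N1 : 1 <= N%:R :> R by rewrite ler1n.
have Np : 0 < N%:R ^+ 2 :> R by rewrite exprn_gt0// ltr0n.
rewrite ler_pdivlMr// -exprD; apply: ler_weXn2l => //.
by rewrite addn2 ltnS.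
Qed.

Let e k N := dist (u k N) (w k).

(** The kernel at time [N] differs from the identity by [(theta / N) (Q - I)], so it moves a
    normalised moment by at most [2 theta C^k / N]. *)
Let KV_dist k N : (J <= N)%N -> nnsumm (fun y => `|KV k N y / N%:R ^+ k - w k y|) /\
  rsum (fun y => `|KV k N y / N%:R ^+ k - w k y|) <= e k N + 2 * theta * C ^+ k / N%:R.
Proof.
move=> /J_spec[N0 MN tN]; set t := theta / _ in tN.
have t0 : 0 <= t by rewrite divr_ge0// ltW.
have [suk uk] := su k N0.
have [svu vu] := vecmat_sum suk sQ.
have sd := nnsumm_dist suk (sw k).
have sm : nnsumm (fun y => `|u k N y - w k y| + t * (vecmat (u k N) Q y + u k N y)).
  by apply: nnsummD => //; apply: nnsummZ => //; exact: nnsummD.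
have h y : 0 <= `|KV k N y / N%:R ^+ k - w k y| <=
    `|u k N y - w k y| + t * (vecmat (u k N) Q y + u k N y).
  rewrite normr_ge0/=.
  have hv : vecmat (u k N) Q y = vecmat (V k N) Q y / N%:R ^+ k.
    rewrite !vecmatE mulrC -rsumZ ?invr_ge0 ?exprn_ge0//; last exact: nnsumm_vecmat_col (sV k N0) _.
    by apply: eq_rsum => x; rewrite /u; ring.
  have -> : KV k N y / N%:R ^+ k - w k y = u k N y - w k y + t * (vecmat (u k N) Q y - u k N y).
    have := KV_step k N0 MN y; rewrite -/t hv /u => hs.
    have -> : KV k N y = V k N y + t * vecmat (V k N) Q y - t * V k N y by lra.
    by ring.
  apply: le_trans (ler_normD _ _) _; rewrite lerD2l normrM (ger0_norm t0) ler_wpM2l//.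
  by rewrite (le_trans (ler_normB _ _))// !ger0_norm ?suk.1 ?svu.1.
split; first exact: nnsumm_le h sm.
apply: le_trans (le_rsum h sm) _.
rewrite rsumD//; last by apply: nnsummZ => //; exact: nnsummD.
rewrite lerD2l rsumZ//; last exact: nnsummD.
rewrite rsumD// vu.
have -> : 2 * theta * C ^+ k / N%:R = t * (C ^+ k + C ^+ k) by rewrite /t; ring.
by rewrite ler_wpM2l// lerD.
Qed.

(** The equation for [w k.+1] is subtracted from the recursion. On the left the change of
    normalisation supplies [(1 + 1/N) ^ k.+1], which is at least [1 + k.+1 / N]; on the right
    [e k.+1 N] has coefficient 1, because [(1 - t) I + t Q] does not expand. *)
Let e_step k : exists2 A : R, 0 <= A & forall N, (J <= N)%N ->
  (1 + k.+1%:R / N%:R) * e k.+1 N.+1 <=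
  e k.+1 N + k.+1%:R / N%:R * (C * (e k N + 2 * theta * C ^+ k / N%:R)) + A / N%:R ^+ 2.
Proof.
have [A A0 hA] := rest_le k; have [B B0 hB] := @pow1D_bounds R k.+1.
exists (A + B * rsum (w k.+1)); first by rewrite addr_ge0// mulr_ge0// rsum_ge0//; exact: (sw _).1.
move=> N JN; have [N0 MN tN] := J_spec JN; set t := theta / _ in tN.
have Np : 0 < N%:R :> R by rewrite ltr0n.
have t0 : 0 <= t by rewrite divr_ge0// ltW.
have [sr hr] := hA N N0.
have [sKd hKd] := KV_dist k JN.
set k1 : R := k.+1%:R; pose s := k1 / N%:R.
have s0 : 0 <= s by rewrite divr_ge0.
pose rho : R := (1 + N%:R^-1) ^+ k.+1.
have N01 : 0 <= (N%:R^-1 : R) <= 1.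
  by apply/andP; split; [rewrite invr_ge0 ltW|rewrite invf_le1 ?ler1n].
have /andP[rho1 rho2] := hB _ N01; rewrite -/rho -/k1 -/s in rho1 rho2.
have [suN _] := su k.+1 N0; have [suN1 _] := su k.+1 (ltn0Sn N).
have [svu _] := vecmat_sum suN sQ; have [svw _] := vecmat_sum (sw k.+1) sQ.
have r0 : 0 <= (N%:R ^+ k.+1)^-1 :> R by rewrite invr_ge0 exprn_ge0.
have d0 : 0 <= rho - 1 - s by lra.
(* Five contributions: the two parts of the convex combination, the lower moment, the remainder
   [rest], and the excess of [rho] over [1 + s] acting on the limit [w k.+1]. *)
pose m y := (1 - t) * `|u k.+1 N y - w k.+1 y|
   + t * `|vecmat (u k.+1 N) Q y - vecmat (w k.+1) Q y|
   + s * C * `|KV k N y / N%:R ^+ k - w k y|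
   + (N%:R ^+ k.+1)^-1 * rest k N y + (rho - 1 - s) * w k.+1 y.
have s1 : nnsumm (fun y => (1 - t) * `|u k.+1 N y - w k.+1 y|).
  by apply: nnsummZ; rewrite ?subr_ge0//; exact: nnsumm_dist.
have s2 : nnsumm (fun y => t * `|vecmat (u k.+1 N) Q y - vecmat (w k.+1) Q y|).
  by apply: nnsummZ => //; exact: nnsumm_dist.
have s3 : nnsumm (fun y => s * C * `|KV k N y / N%:R ^+ k - w k y|).
  by apply: nnsummZ => //; exact: mulr_ge0.
have s4 : nnsumm (fun y => (N%:R ^+ k.+1)^-1 * rest k N y) by exact: nnsummZ.
have s5 : nnsumm (fun y => (rho - 1 - s) * w k.+1 y) by exact: nnsummZ.
have s12 := nnsummD s1 s2; have s123 := nnsummD s12 s3; have s1234 := nnsummD s123 s4.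
have sm : nnsumm m by exact: nnsummD.
have hm y : rho * `|u k.+1 N.+1 y - w k.+1 y| <= m y.
  have rhoE : rho * u k.+1 N.+1 y = V k.+1 N.+1 y / N%:R ^+ k.+1.
    rewrite /u /rho; have -> : 1 + N%:R^-1 = N.+1%:R / N%:R :> R.
      by rewrite -natr1; field; rewrite gt_eqF.
    rewrite expr_div_n; field; rewrite !expf_neq0 ?gt_eqF//.
  have hv : vecmat (u k.+1 N) Q y = vecmat (V k.+1 N) Q y / N%:R ^+ k.+1.
    rewrite !vecmatE mulrC -rsumZ ?invr_ge0 ?exprn_ge0//; last exact: nnsumm_vecmat_col (sV k.+1 N0) _.
    by apply: eq_rsum => x; rewrite /u; ring.
  have hV : V k.+1 N.+1 y = KV k.+1 N y + k1 * phi y * KV k N y + rest k N y.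
    rewrite V_rec// big_ord_recr/= big_ord_recr/= binn subnn expr0 !mul1r.
    by rewrite binSn subSnn expr1 /rest /k1; ring.
  have hK := KV_step k.+1 N0 MN y; rewrite -/t in hK.
  have hw := w_rec k y; rewrite -/k1 in hw.
  have hw' : (s + t) * w k.+1 y = t * vecmat (w k.+1) Q y + s * phi y * w k y.
    rewrite /s /t; have -> : (k1 / N%:R + theta / N%:R) * w k.+1 y = ((k1 + theta) * w k.+1 y) / N%:R by ring.
    by rewrite hw; ring.
  have rho0 : 0 <= rho by lra.
  rewrite -[X in X * _](ger0_norm rho0) -normrM.
  have -> : rho * (u k.+1 N.+1 y - w k.+1 y) =
     (1 - t) * (u k.+1 N y - w k.+1 y)
   + t * (vecmat (u k.+1 N) Q y - vecmat (w k.+1) Q y)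
   + s * phi y * (KV k N y / N%:R ^+ k - w k y)
   + (N%:R ^+ k.+1)^-1 * rest k N y - (rho - 1 - s) * w k.+1 y.
    have hu : u k.+1 N y = V k.+1 N y / N%:R ^+ k.+1 by [].
    rewrite mulrBr rhoE hV hv hu.
    have -> : KV k.+1 N y = V k.+1 N y + t * vecmat (V k.+1 N) Q y - t * V k.+1 N y by lra.
    have -> : s * phi y * (KV k N y / N%:R ^+ k - w k y) =
       k1 * phi y * KV k N y / N%:R ^+ k.+1 - s * phi y * w k y.
      by rewrite /s exprS invfM; ring.
    have -> : s * phi y * w k y = (s + t) * w k.+1 y - t * vecmat (w k.+1) Q y by lra.
    ring.
  have /andP[p0 pC] := phiC y.
  rewrite /m; apply: le_trans (ler_normB _ _) _; apply: lerD; last first.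
    by rewrite normrM !ger0_norm ?(sw _).1.
  apply: le_trans (ler_normD _ _) _; apply: lerD; last first.
    by rewrite normrM !ger0_norm ?sr.1.
  apply: le_trans (ler_normD _ _) _; apply: lerD; last first.
    rewrite normrM ler_wpM2r// ger0_norm ?mulr_ge0// ler_wpM2l//.
  apply: le_trans (ler_normD _ _) _.
  by rewrite normrM (normrM t) (ger0_norm t0) (ger0_norm (_ : 0 <= 1 - t)) ?subr_ge0.
have : rho * e k.+1 N.+1 <= rsum m.
  have rho0 : 0 <= rho by lra.
  rewrite /e -rsumZ//; last exact: nnsumm_dist.
  by apply: le_rsum => // y; rewrite hm mulr_ge0.
have e0 : 0 <= e k.+1 N.+1 by exact: rsum_ge0.
have hrho : (1 + s) * e k.+1 N.+1 <= rho * e k.+1 N.+1 by rewrite ler_wpM2r.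
move=> /(le_trans hrho) /le_trans; apply.
rewrite /m !rsumD// !rsumZ ?subr_ge0//; try exact: nnsumm_dist; last exact: mulr_ge0.
have h1 : t * dist (vecmat (u k.+1 N) Q) (vecmat (w k.+1) Q) <= t * e k.+1 N.
  by rewrite ler_wpM2l//; exact: vecmat_dist.
have h2 := ler_wpM2l (mulr_ge0 s0 C0) hKd.
have h3 : (N%:R ^+ k.+1)^-1 * rsum (rest k N) <= A / N%:R ^+ 2.
  apply: le_trans (ler_wpM2l r0 hr) _.
  by rewrite mulrA (mulrC A) mulrA mulVf ?mul1r// expf_neq0 ?gt_eqF.
have h4 : (rho - 1 - s) * rsum (w k.+1) <= B * rsum (w k.+1) / N%:R ^+ 2.
  rewrite mulrAC ler_wpM2r ?rsum_ge0//; first exact: (sw _).1.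
  by rewrite exprVn in rho2; lra.
  by rewrite mulrBl mul1r (mulrDl A) -/(e k.+1 N) -/s (mulrA s); move: h1 h2 h3 h4; lra.
by lra.
Qed.

(** Induction on [k] from [law_cvg]: divided by [1 + k.+1 / N], [e_step] is an averaging recursion
    whose target involves the already small [e k]. *)
Theorem moment_cvg k : (fun N => dist (fun x => V k N.+1 x / N.+1%:R ^+ k) (w k)) @ \oo --> 0.
Proof.
suff h d : 0 < d -> exists n1, forall N, (n1 <= N)%N -> e k N <= d.
  apply/cvg0P => [N|d d0]; first exact: rsum_ge0.
  have [n1 hn1] := h _ d0; exists n1 => N n1N.
  by apply: hn1; exact: leq_trans (leqnSn _).
elim: k d => [d d0|k ih d d0].
  have h0 N : 0 <= dist (V 0 N.+1) mu by exact: rsum_ge0.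
  have /(_ _ d0)[n1 hn1] := (iffLR (cvg0P h0)) law_cvg.
  exists n1.+1 => -[//|N] /hn1; congr (_ <= _); apply: eq_rsum => x.
  by rewrite /u expr0 divr1 w0.
have [A A0 hA] := e_step k.
have d2 : 0 < d / 2 by lra.
have k1 : 1 <= k.+1%:R :> R by rewrite ler1n.
pose D := 2 * theta * C ^+ k.
have D0 : 0 <= D by rewrite !mulr_ge0 ?exprn_ge0// ltW.
(* [C + 1] instead of [C], which may be zero. *)
have d8 : 0 < d / 8 / (C + 1).
  by rewrite !divr_gt0//; rewrite ltr_pwDr.
have [n1 hn1] := ih _ d8.
pose n2 := Num.bound (8 * (C * D + A) / d).
(* With [s = k.+1 / N] the weight is [s / (1 + s)], which is at least [1 / N.+1]; hence the constant
   1. *)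
have := @averaging_recursion R (e k.+1) (fun N => k.+1%:R / (N%:R + k.+1%:R)) 1 (d / 2) (d / 2)
  (maxn J (maxn n1 n2)) ltr01 d2.
case.
- move=> N; rewrite geq_max => /andP[/J_spec[N0 _ _] _].
  have N1 : 1 <= N%:R :> R by rewrite ler1n.
  have NK : 0 < N%:R + k.+1%:R :> R by lra.
  split.
    apply/andP; split; first by apply: divr_ge0 => //; exact: ltW.
    by rewrite ler_pdivrMr// mul1r; lra.
  by rewrite ler_pdivrMr ?ltr0n// mulrAC ler_pdivlMr// mul1r -natr1; nra.
- move=> N; rewrite !geq_max => /and3P[JN n1N n2N].
  have [N0 _ _] := J_spec JN.
  have N1 : 1 <= N%:R :> R by rewrite ler1n.
  have NK : 0 < N%:R + k.+1%:R :> R by lra.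
  have hs := hA N JN; rewrite -/D in hs; have he := hn1 N n1N.
  have hN : (C * D + A) / N%:R <= d / 8.
    rewrite ler_pdivrMr; last by lra.
    have h : 8 * (C * D + A) / d <= N%:R.
      apply: le_trans (ltW (archi_boundP _)) _; last by rewrite ler_nat.
      by rewrite divr_ge0 ?(ltW d0)// mulr_ge0// addr_ge0// mulr_ge0.
    by rewrite ler_pdivrMr// in h; lra.
  have hC : C * e k N <= d / 8.
    have h : C * e k N <= C * (d / 8 / (C + 1)) by rewrite ler_wpM2l.
    have C1 : 0 < C + 1 by rewrite ltr_pwDr.
    apply: le_trans h _; have -> : C * (d / 8 / (C + 1)) = d / 8 * (C / (C + 1)) by ring.
    rewrite ler_piMr; [by []|by rewrite divr_ge0// ltW|].
    by rewrite ler_pdivrMr// mul1r lerDl.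
  set a := _ / (_ + _); set s := k.+1%:R / N%:R in hs.
  have s0 : 0 <= s by rewrite divr_ge0.
  have hlast : A / N%:R ^+ 2 <= s * (A / N%:R).
    rewrite /s mulrACA -invfM -expr2 ler_wpM2r ?invr_ge0 ?exprn_ge0//.
    by rewrite ler_peMl.
  have hs' : (1 + s) * e k.+1 N.+1 <= e k.+1 N + s * (d / 2).
    have : s * (C * (e k N + D / N%:R)) + s * (A / N%:R) <= s * (d / 2).
      rewrite -mulrDr ler_wpM2l//; rewrite mulrDl in hN; lra.
    lra.
  have s1 : 0 < 1 + s by lra.
  rewrite -(ler_pM2l s1); apply: le_trans hs' _.
  rewrite le_eqVlt; apply/orP; left; apply/eqP.
  by rewrite /a /s; field; rewrite !gt_eqF//; lra.
by move=> n3 hn3; exists n3 => N /hn3; lra.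
Qed.

End moment_recursion.

(** * Expectations of bounded measurable functions *)

Section bounded_expectation.
Context {d : measure_display} {Omega : measurableType d} {R : realType}.
Variable P : probability Omega R.
Implicit Types (F G : Omega -> R).

Definition bmf F := measurable_fun [set: Omega] F /\ exists B : R, forall w, `|F w| <= B.
Definition Ex F : R := fine (\int[P]_w (F w)%:E)%E.

Lemma bmf_integrable F : bmf F -> P.-integrable [set: Omega] (EFin \o F).
Proof.
move=> [mF [B hB]]; apply: measurable_bounded_integrable => //.
  by apply: le_lt_trans (probability_le1 P measurableT) _; rewrite ltry.
exists B; split; first exact: num_real.
by move=> r Br w _ /=; exact: le_trans (hB w) (ltW Br).
Qed.

Lemma ExE F : bmf F -> (\int[P]_w (F w)%:E = (Ex F)%:E)%E.
Proof.
move=> bF; rewrite /Ex fineK//.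
exact: (integrable_fin_num measurableT (bmf_integrable bF)).
Qed.

Lemma eq_Ex F G : F =1 G -> Ex F = Ex G.
Proof. by move=> /funext ->. Qed.

Lemma bmf_cst (c : R) : bmf (fun=> c).
Proof. by split; [exact: measurable_cst|exists `|c|]. Qed.

Lemma bmfD F G : bmf F -> bmf G -> bmf (fun w => F w + G w).
Proof.
move=> [mF [A hA]] [mG [B hB]]; split; first exact: measurable_funD.
by exists (A + B) => w; apply: le_trans (ler_normD _ _) _; exact: lerD.
Qed.

Lemma bmfM F G : bmf F -> bmf G -> bmf (fun w => F w * G w).
Proof.
move=> [mF [A hA]] [mG [B hB]]; split; first exact: measurable_funM.
by exists (A * B) => w; rewrite normrM; exact: ler_pM.
Qed.

Lemma bmfZ (c : R) F : bmf F -> bmf (fun w => c * F w).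
Proof. exact/bmfM/bmf_cst. Qed.

Lemma bmfB F G : bmf F -> bmf G -> bmf (fun w => F w - G w).
Proof.
move=> bF bG; have := bmfD bF (bmfZ (-1) bG).
by under eq_fun do rewrite mulN1r.
Qed.

Lemma bmfX k F : bmf F -> bmf (fun w => F w ^+ k).
Proof.
move=> bF; elim: k => [|k ih]; first exact: bmf_cst.
by under eq_fun do rewrite exprS; exact: bmfM.
Qed.

Lemma bmf_sum (I : Type) (r : seq I) (F : I -> Omega -> R) :
  (forall i, bmf (F i)) -> bmf (fun w => \sum_(i <- r) F i w).
Proof.
move=> bF; elim: r => [|i r ih].
  by under eq_fun do rewrite big_nil; exact: bmf_cst.
by under eq_fun do rewrite big_cons; exact: bmfD.
Qed.

Lemma bmf_prod (I : Type) (r : seq I) (F : I -> Omega -> R) :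
  (forall i, bmf (F i)) -> bmf (fun w => \prod_(i <- r) F i w).
Proof.
move=> bF; elim: r => [|i r ih].
  by under eq_fun do rewrite big_nil; exact: bmf_cst.
by under eq_fun do rewrite big_cons; exact: bmfM.
Qed.

Lemma Ex_cst (c : R) : Ex (fun=> c) = c.
Proof. by rewrite /Ex integral_cst//= probability_setT mule1. Qed.

Lemma ExD F G : bmf F -> bmf G -> Ex (fun w => F w + G w) = Ex F + Ex G.
Proof. by move=> bF bG; exact: (RintegralD measurableT (bmf_integrable bF) (bmf_integrable bG)). Qed.

Lemma ExB F G : bmf F -> bmf G -> Ex (fun w => F w - G w) = Ex F - Ex G.
Proof. by move=> bF bG; exact: (RintegralB measurableT (bmf_integrable bF) (bmf_integrable bG)). Qed.

Lemma ExZ (c : R) F : bmf F -> Ex (fun w => c * F w) = c * Ex F.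
Proof. by move=> bF; exact: (RintegralZl c measurableT (bmf_integrable bF)). Qed.

Lemma le_Ex F G : bmf F -> bmf G -> (forall w, F w <= G w) -> Ex F <= Ex G.
Proof.
move=> bF bG FG; apply: (le_Rintegral measurableT (bmf_integrable bF) (bmf_integrable bG)).
by move=> w _; exact: FG.
Qed.

Lemma Ex_ge0 F : (forall w, 0 <= F w) -> 0 <= Ex F.
Proof. by move=> F0; apply/fine_ge0/integral_ge0 => w _; rewrite lee_fin. Qed.

Lemma Ex_sum (I : Type) (r : seq I) (F : I -> Omega -> R) :
  (forall i, bmf (F i)) -> Ex (fun w => \sum_(i <- r) F i w) = \sum_(i <- r) Ex (F i).
Proof.
move=> bF; elim: r => [|i r ih].
  by rewrite big_nil -[RHS](Ex_cst 0); apply: eq_Ex => w; rewrite big_nil.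
rewrite big_cons -ih -ExD//; last exact: bmf_sum.
by apply: eq_Ex => w; rewrite big_cons.
Qed.

Lemma Ex_dist F G (e : R) : bmf F -> bmf G -> (forall w, `|F w - G w| <= e) ->
  `|Ex F - Ex G| <= e.
Proof.
move=> bF bG h; rewrite -ExB// ler_norml; apply/andP; split.
  rewrite -[leLHS]Ex_cst; apply: le_Ex; [exact: bmf_cst|exact: bmfB|].
  by move=> w; have := h w; rewrite ler_norml => /andP[].
rewrite -[leRHS]Ex_cst; apply: le_Ex; [exact: bmfB|exact: bmf_cst|].
by move=> w; have := h w; rewrite ler_norml => /andP[].
Qed.

Lemma bmf_cvg (F : nat -> Omega -> R) G (B : R) : (forall n, bmf (F n)) ->
  (forall n w, `|F n w| <= B) -> (forall w, F ^~ w @ \oo --> G w) ->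
  bmf G /\ (fun n => Ex (F n)) @ \oo --> Ex G.
Proof.
move=> bF hB cF.
have mG : measurable_fun [set: Omega] G.
  apply: (@measurable_fun_cvg _ _ _ _ F) => [n|w _]; [exact: (bF n).1|exact: cF].
have bG : bmf G.
  split=> //; exists B => w.
  have h : (fun n => `|F n w|) @ \oo --> `|G w| by exact: cvg_norm (cF w).
  rewrite -(cvg_lim _ h)//; apply: limr_le; first exact: cvgP h.
  by apply: nearW => n; exact: hB.
split=> //.
have mFE n : measurable_fun [set: Omega] (fun w => (F n w)%:E).
  by apply/measurable_EFinP; exact: (bF n).1.
have mGE : measurable_fun [set: Omega] (fun w => (G w)%:E) by apply/measurable_EFinP.
have iB : P.-integrable [set: Omega] (fun=> B%:E) by exact: (bmf_integrable (bmf_cst B)).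
have cFE : {ae P, forall w, [set: Omega] w -> (fun n => (F n w)%:E) @ \oo --> (G w)%:E}.
  by apply: aeW => w _; apply: cvg_EFin (cF w); exact: nearW.
have bFE : {ae P, forall w n, [set: Omega] w -> (`|(F n w)%:E| <= B%:E)%E}.
  by apply: aeW => w n _; rewrite /= lee_fin.
have [_ _] := dominated_convergence measurableT mFE mGE cFE iB bFE.
rewrite ExE// => h; apply/fine_cvg.
by apply: cvg_trans h.
Qed.

End bounded_expectation.

(** * Random variables with values in a countable set *)

Section countable_maps.
Context {d : measure_display} {Omega : measurableType d} {R : realType}.
Variable P : probability Omega R.

(** [X] carries no sigma-algebra: measurability of [Y] is expressed by its fibres, and every
    preimage is a countable union of them. *)
Lemma measurable_countable_map (X : countType) (Y : Omega -> X) (f : X -> R) :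
  (forall x, measurable (Y @^-1` [set x])) -> measurable_fun [set: Omega] (f \o Y).
Proof.
move=> mY _ B mB; rewrite setTI.
have -> : (f \o Y) @^-1` B = \bigcup_n
   (if @choice.unpickle X n is Some x then (if f x \in B then Y @^-1` [set x] else set0) else set0).
  apply/seteqP; split=> [w /= Bw|w [n _]].
    by exists (choice.pickle (Y w)) => //; rewrite choice.pickleK mem_set.
  by case: choice.unpickle => //= x; case: ifPn => // /set_mem Bx /= ->.
apply: bigcupT_measurable => n; case: choice.unpickle => // x; case: ifP => //.
Qed.

Lemma bmf_indic (X : countType) (Y : Omega -> X) x :
  (forall x, measurable (Y @^-1` [set x])) -> bmf (fun w => (Y w == x)%:R : R).
Proof.
move=> mY; split; first exact: (measurable_countable_map (fun z => (z == x)%:R) mY).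
by exists 1 => w; case: eqP; rewrite ?normr1 ?normr0.
Qed.

Lemma Ex_indic (A : set Omega) (f : Omega -> R) : measurable A ->
  (forall w, f w = (w \in A)%:R) -> Ex P f = fine (P A).
Proof.
move=> mA fA; rewrite /Ex; congr fine.
rewrite -(setIT A) -(integral_indic P measurableT mA); apply: eq_integral => w _.
by rewrite fA indicE.
Qed.

Lemma esum_pickle (X : countType) (a : X -> \bar R) : (forall x, 0 <= a x)%E ->
  (\esum_(x in [set: X]) a x = \sum_(0 <= n <oo) oapp a 0 (pickle_inv n))%E.
Proof.
move=> a0; rewrite nneseries_esumT; last by move=> n; case: pickle_inv => /=.
rewrite (esumID (range (@choice.pickle X))); last by move=> n _; case: pickle_inv => /=.
rewrite setTI [X in (_ + X)%E]esum1 ?adde0; last first.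
  move=> n [_ /= hn]; case E : (pickle_inv n) => [x|//].
  by exfalso; apply: hn; exists x => //; have := @pickle_invK X n; rewrite E.
rewrite esum_image; last by move=> x y _ _; exact: (pcan_inj (@choice.pickleK X)).
by apply: eq_esum => x _; rewrite choice.pickleK_inv.
Qed.

Lemma esum_indic (X : countType) (y : X) (c : R) : 0 <= c ->
  (\esum_(x in [set: X]) (c * (y == x)%:R)%:E = c%:E)%E.
Proof.
move=> c0; rewrite (esumID [set y]); last by move=> x _; rewrite lee_fin mulr_ge0.
rewrite setTI esum_set1 ?eqxx ?mulr1 ?lee_fin// esum1 ?adde0// => x [_ /= xy].
by rewrite eq_sym; move/eqP/negbTE : xy => ->; rewrite mulr0.
Qed.

Lemma Ex_partition (X : countType) (Y : Omega -> X) (F : Omega -> R) :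
  (forall x, measurable (Y @^-1` [set x])) -> bmf F -> (forall w, 0 <= F w) ->
  nnsumm (fun x => Ex P (fun w => F w * (Y w == x)%:R)) /\
  rsum (fun x => Ex P (fun w => F w * (Y w == x)%:R)) = Ex P F.
Proof.
move=> mY bF F0.
have b x : bmf (fun w => F w * (Y w == x)%:R) by apply: bmfM => //; exact: bmf_indic.
have nn x w : 0 <= F w * (Y w == x)%:R by rewrite mulr_ge0.
apply: nnsumm_of_esum => [x|]; first exact: Ex_ge0.
rewrite -ExE// esum_pickle; last by move=> x; rewrite lee_fin Ex_ge0.
pose f n w : \bar R := oapp (fun x => (F w * (Y w == x)%:R)%:E) 0%E (@pickle_inv X n).
transitivity (\sum_(0 <= n <oo) \int[P]_w f n w)%E.
  apply: eq_eseriesr => n _; rewrite /f; case: pickle_inv => [x|] /=; first by rewrite -ExE.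
  by rewrite integral0.
rewrite -integral_nneseries//.
- apply: eq_integral => w _; rewrite -[RHS](esum_indic (Y w))//.
  rewrite esum_pickle; last by move=> x; rewrite lee_fin.
  by [].
- move=> n; rewrite /f; case: pickle_inv => [x|] /=; last exact: measurable_cst.
  by apply/measurable_EFinP; exact: (b x).1.
- by move=> n w _; rewrite /f; case: pickle_inv => [x|] //=; rewrite lee_fin.
Qed.

End countable_maps.

(** * Moments of occupation counts of a Markov chain *)

Section markov_chain_moments.
Context {R : realType} {X : countType} {d : measure_display} {Omega : measurableType d}.
Variables (P : probability Omega R) (T : nat -> Omega -> X) (init : X -> R).
Variables (K : nat -> X -> X -> R) (phi : X -> R) (C : R).
Hypothesis mcT : markov_chain P T init K.
Hypothesis phiC : forall x, 0 <= phi x <= C.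
Hypothesis K_ge0 : forall n x y, 0 <= K n x y.

Let sum_phi_le (p : seq X) : \sum_(x <- p) phi x <= C * (size p)%:R.
Proof.
elim: p => [|x p ih]; first by rewrite big_nil mulr0.
by rewrite big_cons/= -natr1 mulrDr mulr1 addrC lerD//; case/andP: (phiC x).
Qed.

(** The history is one variable in the countable type [seq X], so that conditioning on the whole
    past is a single use of [Ex_partition]. *)
Fixpoint path_upto n w : seq X :=
  if n is m.+1 then rcons (path_upto m w) (T m w) else [::].

Lemma size_path_upto n w : size (path_upto n w) = n.
Proof. by elim: n => //= n ih; rewrite size_rcons ih. Qed.

Lemma nth_path_upto x n w k : (k < n)%N -> nth x (path_upto n w) k = T k w.
Proof.
elim: n => // n ih; rewrite ltnS leq_eqVlt => /orP[/eqP ->|kn] /=.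
  by rewrite nth_rcons size_path_upto ltnn eqxx.
by rewrite nth_rcons size_path_upto kn ih.
Qed.

Lemma measurable_path_upto n p : measurable (path_upto n @^-1` [set p]).
Proof.
elim: n p => [|n ih] p.
  by rewrite /preimage/=; have [->|/eqP pn] := eqVneq [::] p;
    [rewrite (_ : mkset _ = setT)//; apply/seteqP; split|
     rewrite (_ : mkset _ = set0)//; apply/seteqP; split=> w //=].
case: (lastP p) => [|q x].
  rewrite (_ : _ @^-1` _ = set0)//; apply/seteqP; split=> w //= h.
  by have := size_path_upto n.+1 w; rewrite /= h.
rewrite (_ : _ @^-1` _ = path_upto n @^-1` [set q] `&` T n @^-1` [set x]).
  by apply: measurableI; [exact: ih|exact: mcT.1].
apply/seteqP; split=> w /=; first by move=> /rcons_inj[-> ->].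
by move=> [-> ->].
Qed.

Lemma bmf_sum_path n : bmf (fun w => \sum_(x <- path_upto n w) phi x).
Proof.
split; first exact: (measurable_countable_map (fun p => \sum_(x <- p) phi x) (measurable_path_upto n)).
exists (C * n%:R) => w; rewrite ger0_norm; last by apply: sumr_ge0 => x _; case/andP: (phiC x).
by apply: le_trans (sum_phi_le _) _; rewrite size_path_upto.
Qed.

Let bphi := bmf_sum_path.

Lemma sum_path_upto n w : \sum_(x <- path_upto n w) phi x = \sum_(k < n) phi (T k w).
Proof.
elim: n => [|n ih]; first by rewrite big_nil big_ord0.
by rewrite big_ord_recr/= -cats1 big_cat big_seq1 -ih.
Qed.

Let phi_ge0 n w : 0 <= \sum_(x <- path_upto n w) phi x.
Proof. by apply: sumr_ge0 => x _; case/andP: (phiC x). Qed.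

(** [T k] is the state at time [k + 1], so [T n.-1] is the last state of a history of length [n]. *)
Definition occ_moment k n y :=
  Ex P (fun w => (\sum_(x <- path_upto n w) phi x) ^+ k * (T n.-1 w == y)%:R).

Lemma occ_moment_sum k n : nnsumm (occ_moment k n) /\
  rsum (occ_moment k n) = Ex P (fun w => (\sum_(x <- path_upto n w) phi x) ^+ k).
Proof. by apply: Ex_partition; [exact: mcT.1|exact: bmfX|move=> w; rewrite exprn_ge0]. Qed.

Lemma occ_moment_le k n : 0 <= C -> rsum (occ_moment k n) <= (C * n%:R) ^+ k.
Proof.
move=> C0; rewrite (occ_moment_sum k n).2 -[leRHS](Ex_cst P); apply: le_Ex.
- exact: bmfX.
- exact: bmf_cst.
move=> w; rewrite lerXn2r ?nnegrE ?mulr_ge0//.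
by apply: le_trans (sum_phi_le _) _; rewrite size_path_upto.
Qed.

(** Both events are cylinders, and their probabilities differ by the last kernel factor only. *)
Lemma path_markov n p y : size p = n.+1 ->
  fine (P (path_upto n.+1 @^-1` [set p] `&` T n.+1 @^-1` [set y])) =
  fine (P (path_upto n.+1 @^-1` [set p])) * K n (last y p) y.
Proof.
move=> sp.
have -> : path_upto n.+1 @^-1` [set p] `&` T n.+1 @^-1` [set y] =
    [set w | forall k, (k <= n.+1)%N -> T k w = nth y p k].
  apply/seteqP; split=> w /= => [[<- Ty] k|h].
    rewrite leq_eqVlt => /orP[/eqP ->|kn]; last by rewrite (nth_path_upto _ _ kn).
    by rewrite Ty nth_default// (size_path_upto n.+1).
  split; last by rewrite h// nth_default// sp.
  apply: (@eq_from_nth _ y); first by rewrite (size_path_upto n.+1) sp.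
  by move=> k; rewrite (size_path_upto n.+1) => kn; rewrite (nth_path_upto _ _ kn) h// ltnW.
have -> : path_upto n.+1 @^-1` [set p] = [set w | forall k, (k <= n)%N -> T k w = nth y p k].
  apply/seteqP; split=> w /= => [<- k kn|h]; first by rewrite (nth_path_upto _ _ (kn : (k < n.+1)%N)).
  apply: (@eq_from_nth _ y); first by rewrite (size_path_upto n.+1) sp.
  by move=> k; rewrite (size_path_upto n.+1) => kn; rewrite (nth_path_upto _ _ kn) h.
rewrite !mcT.2/= big_ord_recr/= mulrA; congr (_ * K n _ _); last by rewrite nth_default// sp.
by rewrite (last_nth y) sp; case: p sp.
Qed.

Lemma occ_moment_step k n x y :
  Ex P (fun w => (\sum_(z <- path_upto n.+1 w) phi z) ^+ k * (T n w == x)%:R * (T n.+1 w == y)%:R) =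
  occ_moment k n.+1 x * K n x y.
Proof.
pose F w := (\sum_(z <- path_upto n.+1 w) phi z) ^+ k * (T n w == x)%:R.
have bF : bmf F by apply: bmfM; [exact: bmfX|apply: bmf_indic; exact: mcT.1].
have F0 w : 0 <= F w by rewrite mulr_ge0// exprn_ge0.
have bFy : bmf (fun w => F w * (T n.+1 w == y)%:R) by apply: bmfM => //; apply: bmf_indic; exact: mcT.1.
have Fy0 w : 0 <= F w * (T n.+1 w == y)%:R by rewrite mulr_ge0.
have [s1 e1] := Ex_partition P (measurable_path_upto n.+1) bFy Fy0.
have [s2 e2] := Ex_partition P (measurable_path_upto n.+1) bF F0.
rewrite -[LHS]e1 /occ_moment/= -[X in _ = X * _]e2 mulrC.
rewrite -rsumZ//; apply: eq_rsum => p.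
have indE (A : set Omega) w : (w \in A)%:R = \1_A w :> R by rewrite indicE.
have [sp|sp] := eqVneq (size p) n.+1; last first.
  have np w : (path_upto n.+1 w == p) = false.
    by apply/negP => /eqP h; move: sp; rewrite -h size_path_upto eqxx.
  rewrite (@eq_Ex _ _ _ P _ (fun=> 0)) ?Ex_cst; last by move=> w; rewrite np mulr0.
  by rewrite (@eq_Ex _ _ _ P _ (fun=> 0)) ?Ex_cst ?mulr0// => w; rewrite np mulr0.
(* On the history [p] the functional [F] is the constant [c], so both expectations are [c] times the
   probability of an event. *)
pose c := (\sum_(z <- p) phi z) ^+ k * (last y p == x)%:R.
pose A := path_upto n.+1 @^-1` [set p]; pose B := T n.+1 @^-1` [set y].
have mA : measurable A by exact: measurable_path_upto.
have mB : measurable B by exact: mcT.1.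
have FA w : path_upto n.+1 w = p -> F w = c.
  by rewrite /F /c => <-; rewrite /= last_rcons.
have bI (D : set Omega) : measurable D -> bmf (fun w => (w \in D)%:R : R).
  move=> mD; under eq_fun do rewrite indE; split; first exact: measurable_indic.
  by exists 1 => w; rewrite indicE; case: (_ \in _); rewrite ?normr1 ?normr0.
have -> : Ex P (fun w => F w * (T n.+1 w == y)%:R * (path_upto n.+1 w == p)%:R) =
    c * fine (P (A `&` B)).
  rewrite -(Ex_indic P (measurableI _ _ mA mB) (fun w => erefl)) -ExZ; last first.
    by apply: bI; exact: measurableI.
  apply: eq_Ex => w; rewrite in_setI -mulrA mulrC.
  have [pw|pw] := eqVneq (path_upto n.+1 w) p; last first.
    rewrite mulr0 mul0r (_ : (w \in A) = false) ?mulr0//.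
    by apply/negP => /set_mem /= h; rewrite h eqxx in pw.
  rewrite (FA _ pw) mulr1 mulrC (_ : (w \in A) = true); last by apply/mem_set.
  congr (_ * _%:R); have [Tw|Tw] := eqVneq (T n.+1 w) y; first by rewrite mem_set.
  by congr nat_of_bool; symmetry; apply/negP => /set_mem/= h; rewrite h eqxx in Tw.
have -> : Ex P (fun w => F w * (path_upto n.+1 w == p)%:R) = c * fine (P A).
  rewrite -(Ex_indic P mA (fun w => erefl)) -ExZ; last exact: bI.
  apply: eq_Ex => w.
  have [pw|pw] := eqVneq (path_upto n.+1 w) p; last first.
    rewrite mulr0 (_ : (w \in A) = false) ?mulr0//.
    by apply/negP => /set_mem /= h; rewrite h eqxx in pw.
  by rewrite (FA _ pw) (_ : (w \in A) = true)//; apply/mem_set.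
rewrite path_markov// /c; have [->|_] := eqVneq (last y p) x; last by rewrite !(mulr0, mul0r).
ring.
Qed.

(** Binomial expansion of the old sum plus [phi y], where [y] is the new state; [occ_moment_step]
    then applies the kernel to each power of the old sum. *)
Lemma occ_moment_rec k n y : (0 < n)%N ->
  occ_moment k n.+1 y =
  \sum_(r < k.+1) 'C(k, r)%:R * phi y ^+ (k - r) * vecmat (occ_moment r n) (K n.-1) y.
Proof.
case: n => // n _ /=.
have bT m x : bmf (fun w => (T m w == x)%:R : R) by apply: bmf_indic; exact: mcT.1.
have stepE r : vecmat (occ_moment r n.+1) (K n) y =
    Ex P (fun w => (\sum_(z <- path_upto n.+1 w) phi z) ^+ r * (T n.+1 w == y)%:R).
  rewrite vecmatE; transitivity (rsum (fun x => Ex P (fun w =>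
    ((\sum_(z <- path_upto n.+1 w) phi z) ^+ r * (T n.+1 w == y)%:R) * (T n w == x)%:R))).
    by apply: eq_rsum => x; rewrite -occ_moment_step; apply: eq_Ex => w; rewrite mulrAC.
  by apply: (Ex_partition P (mcT.1 n) _ _).2; [apply: bmfM => //; exact: bmfX|
    move=> w; rewrite mulr_ge0// exprn_ge0].
rewrite /occ_moment/=.
transitivity (Ex P (fun w => \sum_(r < k.+1) ('C(k, r)%:R * phi y ^+ (k - r)) *
   ((\sum_(z <- path_upto n.+1 w) phi z) ^+ r * (T n.+1 w == y)%:R))).
  apply: eq_Ex => w; under [RHS]eq_bigr do rewrite mulrA; rewrite -[RHS]mulr_suml.
  have [Ty|_] := eqVneq (T n.+1 w) y; last by rewrite !mulr0.
  rewrite !mulr1 -cats1 big_cat big_seq1 Ty.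
  rewrite -[X in X ^+ k]/(_ + _) addrC exprDn; apply: eq_bigr => r _.
  by rewrite -mulr_natl mulrA.
have bF r : bmf (fun w => (\sum_(z <- path_upto n.+1 w) phi z) ^+ r * (T n.+1 w == y)%:R).
  by apply: bmfM => //; exact: bmfX.
rewrite Ex_sum; last by move=> r; apply: bmfZ; exact: bF.
by apply: eq_bigr => r _; rewrite ExZ// stepE.
Qed.

End markov_chain_moments.

(** * Generators, uniformised kernels and time reversal *)

Section generators.
Context {R : realType} {X : countType}.
Variables (G : X -> X -> R) (theta : R) (M : nat) (mu : X -> R).
Hypothesis gG : generator G.

Lemma rsum_indicr (v : X -> R) y : (forall x, 0 <= v x) ->
  nnsumm (fun x => v x * (x == y)%:R) /\ rsum (fun x => v x * (x == y)%:R) = v y.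
Proof.
move=> v0; apply: nnsumm_of_esum => [x|]; first by rewrite mulr_ge0.
rewrite -(@esum_indic R X y (v y))//; apply: eq_esum => x _.
by have [->|] := eqVneq x y; rewrite ?mulr0// eq_sym => /negbTE ->; rewrite mulr0.
Qed.

Lemma rsum_indic (y : X) : nnsumm (fun x => (y == x)%:R : R) /\ rsum (fun x => (y == x)%:R : R) = 1.
Proof.
apply: nnsumm_of_esum => //; rewrite -(@esum_indic R X y 1)//.
by apply: eq_esum => x _; rewrite mul1r.
Qed.

(** The admissible set is upward closed, since a larger [r] raises the diagonal entries with
    [G i i < 0]; so everything above its infimum belongs to it. *)
Lemma unif_rate_lt (r : R) : unif_rate G < r ->
  0 < r /\ forall i j, 0 <= (i == j)%:R + G i j / r.
Proof.
case: gG => G0 [Gd [C hC]].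
pose S := [set r : R | 0 < r /\ forall i j, 0 <= (i == j)%:R + G i j / r].
move=> ltr.
have S0 : S !=set0.
  (* Nonemptiness makes [inf] a true infimum; the bound on the diagonal provides a member. *)
  exists (`|C| + 1); have C1 : 0 < `|C| + 1 by rewrite ltr_wpDl.
  split=> // i j; have [<-|ij] := eqVneq i j; last by rewrite add0r divr_ge0 ?G0// ltW.
  have : - (`|C| + 1) <= G i i.
    by have := hC i; rewrite ler_norml => /andP[+ _]; have := ler_norm C; lra.
  by rewrite -(ler_pM2r (x := (`|C| + 1)^-1)) ?invr_gt0// mulNr divff ?gt_eqF// => ?; rewrite /=; lra.
have Slb : has_inf S by split=> //; exists 0 => x [/ltW].
have [s [s0 hs] sr] : exists2 s, S s & s < r.
  have e0 : 0 < r - unif_rate G by lra.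
  have [s Ss hs] := inf_adherent e0 Slb; exists s => //.
  by apply: lt_le_trans hs _; rewrite -/(unif_rate G); lra.
have r0 : 0 < r by exact: lt_trans sr.
split=> // i j; have [<-|ij] := eqVneq i j; last by rewrite add0r divr_ge0 ?G0// ltW.
have := hs i i; rewrite eqxx => h.
have [Gp|Gn] := leP 0 (G i i); first by rewrite addr_ge0// divr_ge0// ltW.
apply: le_trans h _; rewrite lerD2l ler_nM2l// lef_pV2 ?posrE//; exact: ltW.
Qed.

Lemma stochastic_unif (r : R) : 0 < r -> (forall i j, 0 <= (i == j)%:R + G i j / r) ->
  stochastic (fun i j => (i == j)%:R + G i j / r).
Proof.
move=> r0 h; split=> // i; apply: nnsumm_of_esum => //.
case: gG => G0 [Gd _].
rewrite (esumID [set i]); last by move=> j _; rewrite lee_fin.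
rewrite setTI esum_set1 ?lee_fin// eqxx.
have -> : [set: X] `&` ~` [set i] = [set j | j != i].
  by apply/seteqP; split=> j /=; [move=> [_ /eqP]|move=> /eqP].
rewrite esum_mkcond.
transitivity ((1 + G i i / r)%:E + \esum_(j in [set: X]) ((r^-1)%:E *
   (if j \in [set j | j != i] then (G i j)%:E else 0)))%E.
  congr (_ + _)%E; apply: eq_esum => j _; rewrite mem_setE/=.
  case: ifPn => [ji|_]; last by rewrite mule0.
  by rewrite eq_sym (negbTE ji) add0r mulrC.
rewrite esumZl ?invr_ge0 ?ltW//; last first.
  by move=> j; rewrite mem_setE/=; case: ifPn => // ji; rewrite lee_fin G0// eq_sym.
by rewrite -esum_mkcond -Gd -EFinM -EFinD; congr (_%:E); lra.
Qed.

Lemma stochastic_id : stochastic (fun i j : X => (i == j)%:R : R).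
Proof. by split=> // i; exact: rsum_indic. Qed.

Lemma stochastic_Qmat : unif_rate G < theta -> stochastic (Qmat G theta).
Proof. by move=> /unif_rate_lt[t0 h]; exact: stochastic_unif. Qed.

Lemma stochastic_Kinh n : unif_rate G < M%:R -> stochastic (Kinh G M n).
Proof.
move=> uM; rewrite /Kinh; have [Mn|nM] := ltnP M n; last first.
  by under [fun i j => _]eq_fun2 do rewrite mulr0 addr0; exact: stochastic_id.
under [fun i j => _]eq_fun2 do rewrite mulr1.
have /unif_rate_lt[n0 h] : unif_rate G < n%:R by apply: lt_trans uM _; rewrite ltr_nat.
exact: stochastic_unif.
Qed.

(** This is [Kinh = I + (theta / n) (Q - I)], with the negative term moved to the other side so that
    only nonnegative families are summed. *)
Lemma vecmat_Kinh v n y : 0 < theta -> nnsumm v -> unif_rate G < theta -> unif_rate G < M%:R ->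
  (M < n)%N -> vecmat v (Kinh G M n) y + theta / n%:R * v y =
  v y + theta / n%:R * vecmat v (Qmat G theta) y.
Proof.
move=> t0 sv ut uM Mn; have sQ := stochastic_Qmat ut; have sK := stochastic_Kinh n uM.
have n0 : 0 < n%:R :> R by rewrite ltr0n; exact: leq_ltn_trans Mn.
have c0 : 0 <= theta / n%:R by rewrite divr_ge0// ltW.
have [s1 e1] := rsum_indicr y sv.1.
rewrite !vecmatE -[in LHS]e1 -[X in _ = X + _]e1 -!rsumZ//; last exact: nnsumm_vecmat_col.
rewrite -!rsumD//; try exact: nnsumm_vecmat_col; try exact: nnsummZ.
  apply: eq_rsum => x; rewrite /Kinh /Qmat Mn mulr1; field.
  by rewrite !gt_eqF.
by apply: nnsummZ => //; exact: nnsumm_vecmat_col.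
Qed.

Lemma vecmat_id (v : X -> R) y : (forall x, 0 <= v x) -> vecmat v (fun i j : X => (i == j)%:R) y = v y.
Proof. by move=> v0; rewrite vecmatE (rsum_indicr y v0).2. Qed.

Hypothesis smu : stationary mu (Qmat G theta).

Lemma stationaryP (Q : X -> X -> R) : stochastic Q -> stationary mu Q <->
  [/\ nnsumm mu, rsum mu = 1 & forall y, nnsumm (fun x => mu x * Q x y) /\ vecmat mu Q y = mu y].
Proof.
move=> sQ; split=> [[/prob_vectorP[sm m1] h]|[sm m1 h]].
  split=> // y; have := h y => hy.
  have [] := nnsumm_of_esum (f := fun x => mu x * Q x y) (s := mu y) _ hy => //.
  by move=> x; rewrite mulr_ge0 ?sm.1 ?sQ.1.
split; first exact/prob_vectorP.
by move=> y; have [s <-] := h y; rewrite esum_rsum.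
Qed.

(** [Q'] is the time reversal of [Q] with respect to [mu]. At a state with [mu x = 0] stationarity
    forces every [mu y * Q y x] to vanish. *)
Lemma Grev_balance x y : unif_rate G < theta ->
  mu x * Qmat (Grev G mu) theta x y = mu y * Qmat G theta y x.
Proof.
move=> ut; have sQ := stochastic_Qmat ut.
have /(stationaryP sQ)[sm m1 hm] := smu.
have [m0|m0] := eqVneq (mu x) 0.
  rewrite m0 mul0r; have [s] := hm x; rewrite m0 => e.
  by rewrite (rsum_eq0 s e y).
have t0 : theta != 0 by have [/gt_eqF ->] := unif_rate_lt ut.
rewrite /Qmat /Grev (negbTE m0); have [<-|xy] := eqVneq x y.
  by field; rewrite ?m0 ?t0.
by rewrite ?(eq_sym y x) ?(negbTE xy) /=; field; rewrite ?m0 ?t0.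
Qed.

(** States of zero mass get identity rows; the other rows sum to 1 by stationarity of [mu]. *)
Lemma stochastic_Grev : unif_rate G < theta -> stochastic (Qmat (Grev G mu) theta).
Proof.
move=> ut; have sQ := stochastic_Qmat ut.
have /(stationaryP sQ)[sm m1 hm] := smu.
have h x y : mu x != 0 -> Qmat (Grev G mu) theta x y = (mu x)^-1 * (mu y * Qmat G theta y x).
  by move=> m0; rewrite -Grev_balance// mulKf.
have h0 x : mu x = 0 -> Qmat (Grev G mu) theta x = fun y => (x == y)%:R.
  by move=> m0; apply/funext => y; rewrite /Qmat /Grev m0 eqxx mul0r addr0.
split=> [x y|x].
  have [m0|m0] := eqVneq (mu x) 0; first by rewrite h0.
  by rewrite h// mulr_ge0 ?invr_ge0 ?sm.1// mulr_ge0 ?sm.1 ?sQ.1.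
have [m0|m0] := eqVneq (mu x) 0; first by rewrite h0//; exact: rsum_indic.
have [s e] := hm x; have i0 : 0 <= (mu x)^-1 by rewrite invr_ge0 sm.1.
have -> : Qmat (Grev G mu) theta x = fun y => (mu x)^-1 * (mu y * Qmat G theta y x).
  by apply/funext => y; rewrite h.
split; first exact: nnsummZ.
by rewrite rsumZ// -[rsum _]/(vecmat mu _ x) e mulVf.
Qed.

Lemma stationary_Grev : unif_rate G < theta -> stationary mu (Qmat (Grev G mu) theta).
Proof.
move=> ut; have sQ := stochastic_Qmat ut.
have /(stationaryP sQ)[sm m1 hm] := smu.
split; first exact/prob_vectorP.
move=> y; under eq_esum do rewrite Grev_balance// EFinM.
rewrite esumZl ?sm.1//; last by move=> x; rewrite lee_fin sQ.1.
by have [s e] := sQ.2 y; rewrite esum_rsum// e mule1.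
Qed.

End generators.

(** * Convergence of the moments of the empirical vectors *)

Section occupation_limit.
Context {R : realType} {X : countType} {d : measure_display} {Omega : measurableType d}.
Variables (G : X -> X -> R) (theta : R) (M : nat) (pi mu : X -> R).
Variables (P : probability Omega R) (T : nat -> Omega -> X).
Hypotheses (gG : generator G) (theta0 : 0 < theta).
Hypotheses (ut : unif_rate G < theta) (uM : unif_rate G < M%:R).
Hypotheses (ppi : prob_vector pi) (smu : stationary mu (Qmat G theta)).
Hypothesis cpi : forall j, (fun n => vecmatn pi (Qmat G theta) n j) @ \oo --> mu j.
Hypothesis mcT : markov_chain P T pi (fun k => Kinh G M k.+1).

(** [L] may repeat states: multiplicities arise when exponentials are multiplied by concatenating
    lists. *)
Definition occ (L : seq X) (z : X) : R := \sum_(x <- L) (z == x)%:R.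

Lemma occ_bound L z : 0 <= occ L z <= (size L)%:R.
Proof.
rewrite sumr_ge0//= -sum1_size natr_sum; apply: ler_sum => x _.
by rewrite ler_nat; case: eqP.
Qed.

Lemma sum_empirical L n (Ts : nat -> X) :
  \sum_(x <- L) empirical (R := R) Ts n x = n%:R^-1 * \sum_(k < n) occ L (Ts k).
Proof. by rewrite -mulr_sumr exchange_big. Qed.

Lemma occupation_cvg (L : seq X) (w : nat -> X -> R) k :
  (forall k, nnsumm (w k)) -> w 0 =1 mu ->
  (forall k y, (k.+1%:R + theta) * w k.+1 y =
    theta * vecmat (w k.+1) (Qmat G theta) y + k.+1%:R * occ L y * w k y) ->
  (fun N => Ex P (fun o => (\sum_(x <- L) empirical (T ^~ o) N.+1 x) ^+ k)) @ \oo --> rsum (w k).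
Proof.
move=> sw w0 wr.
have sQ := stochastic_Qmat gG ut.
have /(stationaryP mu sQ)[sm m1 hm] := smu.
have K0 n x y : 0 <= Kinh G M n.+1 x y by exact: (stochastic_Kinh gG n.+1 uM).1.
pose V k N := occ_moment P T (occ L) k N.
pose KV k N := vecmat (V k N) (Kinh G M N).
have C0 : 0 <= (size L)%:R :> R by [].
have sV k' N : nnsumm (V k' N) by exact: (occ_moment_sum mcT (occ_bound L) k' N).1.
have := @moment_cvg R X theta (size L)%:R M (Qmat G theta) mu (occ L) V KV w
  theta0 C0 sQ sm _ (occ_bound L) _ _ _ _ _ _ _ sw w0 wr _ k.
have mN k' N : rsum (V k' N.+1) = Ex P (fun o => (\sum_(x <- path_upto T N.+1 o) occ L x) ^+ k').
  exact: (occ_moment_sum mcT (occ_bound L) k' N.+1).2.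
move=> h; have {h} h : (fun N => rsum (fun x => `|V k N.+1 x / N.+1%:R ^+ k - w k x|)) @ \oo --> 0.
  apply: h.
  - by move=> y; exact: (hm y).2.
  - by [].
  - by move=> k' N _; exact: (occ_moment_le mcT (occ_bound L) k' N C0).
  - by move=> k' N _; exact: (vecmat_sum (sV k' N) (stochastic_Kinh gG N uM)).1.
  - by move=> k' N _; exact: (vecmat_sum (sV k' N) (stochastic_Kinh gG N uM)).2.
  - move=> k' N _ NM y; rewrite /KV.
    have -> : Kinh G M N = fun i j => (i == j)%:R.
      by apply/funext => i; apply/funext => j; rewrite /Kinh ltnNge NM mulr0 addr0.
    exact: vecmat_id (sV k' N).1.
  - by move=> k' N _ MN y; exact: vecmat_Kinh.
  - by move=> k' [//|N] _ y; exact: (occ_moment_rec mcT (occ_bound L) K0).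
  (* At time 1 the law is [pi]; the entrywise convergence of [pi Q^n] is then upgraded to L1 by
     [prob_vector_cvg_rsum]. *)
  - have -> : V 0 1%N = pi.
      apply/funext => y; rewrite /V /occ_moment.
      rewrite (@Ex_indic _ _ _ P (T 0 @^-1` [set y])); last 2 first.
      + exact: mcT.1.
      + move=> o; rewrite expr0 mul1r; congr (_%:R); congr nat_of_bool.
        by apply/eqP/idP => [?|/set_mem//]; exact/mem_set.
      have := mcT.2 0%N (fun=> y); rewrite big_ord0 mulr1 => e.
      rewrite (_ : T 0 @^-1` _ = [set o | forall k, (k <= 0)%N -> T k o = y]) ?e//.
      by apply/seteqP; split=> o /= => [<- [|//]|->].
    apply: prob_vector_cvg_rsum => //.
    + move=> r; apply/prob_vectorP; have /prob_vectorP[sp p1] := ppi.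
      by elim: r => //= r [ih1 ih2]; have [s2 e2] := vecmat_sum ih1 sQ; rewrite e2.
    + exact: smu.1.
apply/cvgrPdist_le => e e0; move/cvgrPdist_le : h => /(_ _ e0).
apply: filterS => N; rewrite sub0r normrN => hN.
have i0 : 0 <= (N.+1%:R ^+ k)^-1 :> R by rewrite invr_ge0 exprn_ge0.
have VE : (fun x => V k N.+1 x / N.+1%:R ^+ k) = fun x => (N.+1%:R ^+ k)^-1 * V k N.+1 x.
  by apply/funext => x; rewrite mulrC.
have -> : Ex P (fun o => (\sum_(x <- L) empirical (T ^~ o) N.+1 x) ^+ k) =
    rsum (fun x => V k N.+1 x / N.+1%:R ^+ k).
  rewrite VE rsumZ// mN -ExZ; last by apply: bmfX; exact: (bmf_sum_path mcT (occ_bound L)).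
  by apply: eq_Ex => o; rewrite sum_empirical exprMn exprVn sum_path_upto.
rewrite distrC; apply: le_trans (rsum_dist _ _) _ => //.
  by rewrite VE; exact: nnsummZ.
by apply: le_trans hN; rewrite ler_norm.
Qed.

End occupation_limit.

(** * Moments of stick-breaking sums along a Markov chain *)

Section moment_process.
Context {R : realType} {X : countType} {d : measure_display} {Omega : measurableType d}.
Variables (P : probability Omega R) (Y : nat -> Omega -> X) (Z : nat -> Omega -> R).
Variables (mu : X -> R) (K : X -> X -> R) (b : X -> nat -> nat -> R).

(* [b x s r] is the moment [E (Z^s (1 - Z)^r)] of a stick variable attached to state [x]. *)
Definition moment_process :=
  [/\ forall k x, measurable (Y k @^-1` [set x]),
      forall k, measurable_fun [set: Omega] (Z k),
      forall k w, 0 <= Z k w <= 1 &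
      forall n (y : nat -> X) (s r : nat -> nat),
        Ex P (fun w => \prod_(j < n.+1) (Z j w ^+ s j * (1 - Z j w) ^+ r j * (Y j w == y j)%:R)) =
        mu (y 0) * \prod_(k < n) K (y k) (y k.+1) * \prod_(k < n.+1) b (y k) (s k) (r k)].

Hypothesis mpYZ : moment_process.
Hypotheses (sK : stochastic K) (mu0 : forall x, 0 <= mu x).
Hypotheses (b01 : forall x s r, 0 <= b x s r <= 1) (b00 : forall x, b x 0 0 = 1).

Let mY : forall k x, measurable (Y k @^-1` [set x]). Proof. by case: mpYZ. Qed.
Let Z01 : forall k w, 0 <= Z k w <= 1. Proof. by case: mpYZ. Qed.
Let mpE := let: And4 _ _ _ h := mpYZ in h.

Let bZ k : bmf (Z k).
Proof.
case: mpYZ => _ mZ _ _; split; first exact: mZ.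
by exists 1 => w; have /andP[z0 z1] := Z01 k w; rewrite ger0_norm.
Qed.

Let bU k : bmf (fun w => 1 - Z k w).
Proof. by apply: bmfB => //; exact: bmf_cst. Qed.

Let bY k x : bmf (fun w => (Y k w == x)%:R : R).
Proof. by apply: bmf_indic. Qed.

Let Z0 k w : 0 <= Z k w. Proof. by case/andP: (Z01 k w). Qed.
Let U0 k w : 0 <= 1 - Z k w. Proof. by rewrite subr_ge0; case/andP: (Z01 k w). Qed.
Let U1 k w : 1 - Z k w <= 1. Proof. by rewrite lerBlDr lerDl. Qed.

(** The factor contributed by one time: a bounded nonnegative function of the state times a monomial
    in the stick and its complement. Products of such factors span the powers of a stick-breaking
    sum. *)
Record weight := Weight { wfun : X -> R; wexp : nat; wcoexp : nat;
  wfun_bound : exists B : R, forall x, 0 <= wfun x <= B }.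

Fixpoint wprod i (l : seq weight) w : R :=
  if l is q :: l' then
    wfun q (Y i w) * (Z i w ^+ wexp q * (1 - Z i w) ^+ wcoexp q) * wprod i.+1 l' w
  else 1.

(** Conditional expectation of [wprod] given the starting state, as a backward recursion that also
    makes sense at states of zero mass. *)
Fixpoint wmom (l : seq weight) x : R :=
  if l is q :: l' then wfun q x * b x (wexp q) (wcoexp q) * rsum (fun y => K x y * wmom l' y)
  else 1.

Let bwfun k q : bmf (fun w => wfun q (Y k w)).
Proof.
split; first exact: (measurable_countable_map (wfun q) (mY k)).
case: (wfun_bound q) => B hB; exists B => w.
by have /andP[f0 fB] := hB (Y k w); rewrite ger0_norm.
Qed.

Let wprod_bmf i l : bmf (wprod i l) /\ forall w, 0 <= wprod i l w.
Proof.
elim: l i => [|q l ih] i /=; first by split=> //; exact: bmf_cst.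
have [b1 p0] := ih i.+1; split.
  by apply: bmfM => //; apply: bmfM => //; apply: bmfM; apply: bmfX.
move=> w; rewrite !mulr_ge0 ?exprn_ge0//.
by case: (wfun_bound q) => B /(_ (Y i w))/andP[].
Qed.

Let nnsummK x (f : X -> R) B : (forall y, 0 <= f y <= B) -> nnsumm (fun y => K x y * f y) /\
  rsum (fun y => K x y * f y) <= B.
Proof.
move=> hf; have [s e] := sK.2 x.
have h y : 0 <= K x y * f y <= B * K x y.
  have /andP[f0 fB] := hf y; rewrite mulr_ge0 ?sK.1//= mulrC ler_wpM2r ?sK.1//.
have B0 : 0 <= B by have /andP[f0 fB] := hf x; exact: le_trans fB.
split; first exact: nnsumm_le h (nnsummZ B0 s).
by apply: le_trans (le_rsum h (nnsummZ B0 s)) _; rewrite rsumZ// e mulr1.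
Qed.

Let wmom_bound l : exists B, forall x, 0 <= wmom l x <= B.
Proof.
elim: l => [|q l [B ih]]; first by exists 1 => x /=; rewrite ler01 lexx.
case: (wfun_bound q) => A hA; exists (A * 1 * B) => x /=.
have [s e] := nnsummK x ih; have /andP[f0 fA] := hA x; have /andP[b0 b1] := b01 x (wexp q) (wcoexp q).
have s0 : 0 <= rsum (fun y => K x y * wmom l y) by exact: rsum_ge0 s.1.
apply/andP; split; first by rewrite !mulr_ge0.
by apply: ler_pM => //; [exact: mulr_ge0|exact: ler_pM].
Qed.

Let wpoint (s r : nat -> nat) (y : nat -> X) j w : R :=
  Z j w ^+ s j * (1 - Z j w) ^+ r j * (Y j w == y j)%:R.

Let bwpoint s r y j : bmf (wpoint s r y j).
Proof. by rewrite /wpoint; do ![apply: bmfM|apply: bmfX|exact: bY]. Qed.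

Let wpoint0 s r y j w : 0 <= wpoint s r y j w.
Proof. by rewrite /wpoint !mulr_ge0 ?exprn_ge0. Qed.

(** A cylinder up to time [n] followed by a list of weights. In the induction the state at time
    [n.+1] is summed over and joins the cylinder. *)
Let path_moment l n (y : nat -> X) (s r : nat -> nat) :
  Ex P (fun w => (\prod_(j < n.+1) wpoint s r y j w) * wprod n.+1 l w) =
  mu (y 0) * \prod_(k < n) K (y k) (y k.+1) * \prod_(k < n.+1) b (y k) (s k) (r k) *
  rsum (fun x => K (y n) x * wmom l x).
Proof.
elim: l n y s r => [|q l ih] n y s r.
  have -> : rsum (fun x => K (y n) x * wmom [::] x) = 1.
    by rewrite -(sK.2 (y n)).2; apply: eq_rsum => x; rewrite mulr1.
  by rewrite mulr1 -mpE; apply: eq_Ex => w; rewrite mulr1.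
pose F w := (\prod_(j < n.+1) wpoint s r y j w) * wprod n.+1 (q :: l) w.
have bF : bmf F.
  by apply: bmfM; [apply: bmf_prod => j; exact: bwpoint|exact: (wprod_bmf n.+1 (q :: l)).1].
have F0 w : 0 <= F w by rewrite mulr_ge0 ?prodr_ge0//; exact: (wprod_bmf n.+1 (q :: l)).2.
rewrite -[LHS](Ex_partition P (mY n.+1) bF F0).2.
set c := mu _ * _ * _.
have c0 : 0 <= c.
  rewrite /c !mulr_ge0 ?prodr_ge0// => i _; first exact: sK.1.
  by have /andP[] := b01 (y i) (s i) (r i).
have [B hB] := wmom_bound (q :: l).
rewrite -rsumZ//; last exact: (nnsummK (y n) hB).1.
apply: eq_rsum => x.
pose upd (T : Type) (f : nat -> T) (v : T) k := if k == n.+1 then v else f k.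
have updn T f v (i : 'I_n.+1) : @upd T f v i = f i by rewrite /upd ltn_eqF.
have updS T f v : @upd T f v n.+1 = v by rewrite /upd eqxx.
have := ih n.+1 (upd _ y x) (upd _ s (wexp q)) (upd _ r (wcoexp q)).
have upd0 : upd _ y x 0%N = y 0%N by [].
have updn' : upd _ y x n = y n by rewrite /upd ltn_eqF.
rewrite upd0 updS (big_ord_recr n.+1)/= (big_ord_recr n) /= updn' updS !updS.
under [X in _ * (X * _) * _]eq_bigr do rewrite !updn.
have -> : \prod_(i < n) K (upd _ y x i) (upd _ y x i.+1) = \prod_(i < n) K (y i) (y i.+1).
  apply: eq_bigr => i _; congr (K _ _); last exact: (updn _ y x (lift ord0 i)).
  by exact: (updn _ y x (widen_ord (leqnSn n) i)).
move=> e.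
transitivity (wfun q x * Ex P (fun w => (\prod_(j < n.+2) wpoint (upd _ s (wexp q)) (upd _ r (wcoexp q)) (upd _ y x) j w) * wprod n.+2 l w)).
  rewrite -ExZ; last first.
    by apply: bmfM; [apply: bmf_prod => j; exact: bwpoint|exact: (wprod_bmf _ _).1].
  apply: eq_Ex => w; rewrite /F [in RHS]big_ord_recr/=.
  have -> : \prod_(i < n.+1) wpoint (upd _ s (wexp q)) (upd _ r (wcoexp q)) (upd _ y x) i w =
     \prod_(j < n.+1) wpoint s r y j w.
    by apply: eq_bigr => i _; rewrite /wpoint !updn.
  rewrite [X in _ = _ * (_ * X * _)]/wpoint !updS.
  have [->|_] := eqVneq (Y n.+1 w) x; last by rewrite !(mulr0, mul0r).
  by ring.
by rewrite e /c; ring.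
Qed.

(** Stands in for the empty list, since a cylinder involves at least one time. *)
Let unitw : weight.
Proof. by apply: (@Weight (fun=> 1) 0 0); exists 1 => x; rewrite ler01 lexx. Defined.

Let wprod_unit i w : wprod i [::] w = wprod i [:: unitw] w.
Proof. by rewrite /= !expr0 !mulr1. Qed.

Let wmom_unit x : wmom [::] x = wmom [:: unitw] x.
Proof.
by rewrite /= b00 !mul1r -[LHS](sK.2 x).2; apply: eq_rsum => y; rewrite mulr1.
Qed.

Let start_moment_cons q l x :
  Ex P (fun w => wprod 0 (q :: l) w * (Y 0 w == x)%:R) = mu x * wmom (q :: l) x.
Proof.
have := path_moment l 0 (fun=> x) (fun=> wexp q) (fun=> wcoexp q).
rewrite big_ord0 big_ord1 mulr1 => e.
transitivity (wfun q x * Ex P (fun w => (\prod_(j < 1) wpoint (fun=> wexp q) (fun=> wcoexp q) (fun=> x) j w) * wprod 1 l w)).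
  rewrite -ExZ; last first.
    by apply: bmfM; [apply: bmf_prod => j; exact: bwpoint|exact: (wprod_bmf _ _).1].
  apply: eq_Ex => w; rewrite big_ord1 /wpoint/=.
  have [->|_] := eqVneq (Y 0 w) x; last by rewrite !(mulr0, mul0r).
  by ring.
by rewrite e /=; ring.
Qed.

Lemma start_moment l x :
  Ex P (fun w => wprod 0 l w * (Y 0 w == x)%:R) = mu x * wmom l x.
Proof.
case: l => [|q l]; last exact: start_moment_cons.
rewrite wmom_unit -start_moment_cons; apply: eq_Ex => w.
by rewrite [in LHS]wprod_unit.
Qed.

Let front_moment_cons q l s r x y :
  Ex P (fun w => Z 0 w ^+ s * (1 - Z 0 w) ^+ r * (Y 0 w == x)%:R * wprod 1 (q :: l) w * (Y 1 w == y)%:R) =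
  b x s r * (mu x * K x y * wmom (q :: l) y).
Proof.
pose yy k := if k == 0%N then x else y.
pose ss k := if k == 0%N then s else wexp q.
pose rr k := if k == 0%N then r else wcoexp q.
have := path_moment l 1 yy ss rr.
rewrite big_ord1 !big_ord_recr !big_ord0 /= !mul1r => e.
transitivity (wfun q y * Ex P (fun w => (\prod_(j < 2) wpoint ss rr yy j w) * wprod 2 l w)).
  rewrite -ExZ; last first.
    by apply: bmfM; [apply: bmf_prod => j; exact: bwpoint|exact: (wprod_bmf _ _).1].
  apply: eq_Ex => w; rewrite !big_ord_recr !big_ord0 /wpoint/= /yy /ss /rr/=.
  have [->|_] := eqVneq (Y 1 w) y; last by rewrite !(mulr0, mul0r).
  by ring.
by rewrite e /=; ring.
Qed.

(** Given the states, the first stick is independent of the future, so it enters through [b x s r]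
    alone. *)
Lemma front_moment l s r x y :
  Ex P (fun w => Z 0 w ^+ s * (1 - Z 0 w) ^+ r * (Y 0 w == x)%:R * wprod 1 l w * (Y 1 w == y)%:R) =
  b x s r * (mu x * K x y * wmom l y).
Proof.
case: l => [|q l]; last exact: front_moment_cons.
rewrite wmom_unit -front_moment_cons; apply: eq_Ex => w.
by rewrite [in LHS]wprod_unit.
Qed.

(** The residual mass is the product along a constant list of weights [1 - Z], and each backward
    step contributes at most [rho]. *)
Lemma residual_moment_le (rho : R) n : rsum mu = 1 -> nnsumm mu -> 0 <= rho -> (forall x, b x 0 1 <= rho) ->
  Ex P (fun w => \prod_(j < n) (1 - Z j w)) <= rho ^+ n.
Proof.
move=> m1 sm rho0 hrho.
have bd1 : exists B : R, forall x : X, 0 <= (fun=> 1 : R) x <= B.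
  by exists 1 => x; rewrite ler01 lexx.
pose q := @Weight (fun=> 1) 0 1 bd1.
have qE i m w : wprod i (nseq m q) w = \prod_(j < m) (1 - Z (i + j)%N w).
  elim: m i => [|m ih] i; first by rewrite big_ord0.
  rewrite big_ord_recl/= ih expr0 !mul1r expr1 addn0; congr (_ * _).
  by apply: eq_bigr => j _; rewrite /bump/= add1n addSnnS.
have hq m x : 0 <= wmom (nseq m q) x <= rho ^+ m.
  elim: m x => [|m ih] x /=; first by rewrite expr0 ler01 lexx.
  have [s e] := nnsummK x ih; have s0 := rsum_ge0 s.1.
  have /andP[b0 _] := b01 x 0 1.
  by rewrite mul1r mulr_ge0//= exprS ler_pM.
have -> : Ex P (fun w => \prod_(j < n) (1 - Z j w)) = rsum (fun x => mu x * wmom (nseq n q) x).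
  transitivity (Ex P (wprod 0 (nseq n q))).
    by apply: eq_Ex => w; rewrite qE; apply: eq_bigr => j _; rewrite add0n.
  have [b1 p1] := wprod_bmf 0 (nseq n q).
  by rewrite -(Ex_partition P (mY 0) b1 p1).2; apply: eq_rsum => x; exact: start_moment.
rewrite -[leRHS]mulr1 -m1 -rsumZ ?exprn_ge0//; apply: le_rsum.
  move=> x; have /andP[h0 h1] := hq n x.
  by rewrite mulr_ge0//= mulrC ler_wpM2r.
by apply: nnsummZ => //; rewrite exprn_ge0.
Qed.


Variables (phi : X -> R) (C : R).
Hypothesis phiC : forall x, 0 <= phi x <= C.

(** Horner form of the partial sum of [phi] over [N] sticks from time [i]. It makes the bound by [C]
    and the removal of the first stick immediate. *)
Fixpoint psum N i w : R :=
  if N is N'.+1 then Z i w * phi (Y i w) + (1 - Z i w) * psum N' i.+1 w else 0.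

Let C0 (w : Omega) : 0 <= C.
Proof. by have /andP[p0 pC] := phiC (Y 0 w); exact: le_trans pC. Qed.

Lemma psum_bound N i w : 0 <= psum N i w <= C.
Proof.
elim: N i => [|N ih] i /=; first by rewrite lexx (C0 w).
have /andP[s0 s1] := ih i.+1; have /andP[p0 pC] := phiC (Y i w).
have z0 := Z0 i w; have u0 := U0 i w.
apply/andP; split; first by rewrite addr_ge0// mulr_ge0.
have := ler_wpM2l z0 pC; have := ler_wpM2l u0 s1; lra.
Qed.

Lemma psum_ndecr i w : nondecreasing_seq (fun N => psum N i w).
Proof.
apply/nondecreasing_seqP => N; elim: N i => [|N ih] i.
  by have /andP[] := psum_bound 1 i w.
by rewrite [leLHS]/= [leRHS]/= lerD2l ler_wpM2l.
Qed.

Definition occlim i w : R := lim ((fun N => psum N i w) @ \oo).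

Lemma psum_cvg i w : (fun N => psum N i w) @ \oo --> occlim i w.
Proof.
apply: nondecreasing_is_cvgn; first exact: psum_ndecr.
by exists C => _ [N _ <-]; have /andP[] := psum_bound N i w.
Qed.

Lemma occlim_front i w : occlim i w = Z i w * phi (Y i w) + (1 - Z i w) * occlim i.+1 w.
Proof.
have h1 : (fun N => psum N.+1 i w) @ \oo --> occlim i w.
  by have := psum_cvg (i := i) (w := w); rewrite -(@cvg_shiftS _ (fun N => psum N i w)).
have h2 : (fun N => psum N.+1 i w) @ \oo --> Z i w * phi (Y i w) + (1 - Z i w) * occlim i.+1 w.
  by apply: cvgD; [exact: cvg_cst|apply: cvgMr; exact: psum_cvg].
by rewrite -(cvg_lim _ h1)// -(cvg_lim _ h2).
Qed.

Lemma bmf_psum N i : bmf (psum N i).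
Proof.
elim: N i => [|N ih] i /=; first exact: bmf_cst.
apply: bmfD; last exact: bmfM.
apply: bmfM => //; split; first exact: (measurable_countable_map phi (mY i)).
by exists C => w; have /andP[p0 pC] := phiC (Y i w); rewrite ger0_norm.
Qed.

Let psum_normX N i k w : `|psum N i w ^+ k| <= C ^+ k.
Proof.
have /andP[s0 s1] := psum_bound N i w.
by rewrite ger0_norm ?exprn_ge0// lerXn2r// ?nnegrE ?(C0 w).
Qed.

Lemma Ex_psum_cvg i k (F : Omega -> R) (B : R) : bmf F -> (forall w, `|F w| <= B) ->
  bmf (fun w => F w * occlim i w ^+ k) /\
  (fun N => Ex P (fun w => F w * psum N i w ^+ k)) @ \oo --> Ex P (fun w => F w * occlim i w ^+ k).
Proof.
move=> bF FB; apply: (@bmf_cvg _ _ _ _ (fun N w => F w * psum N i w ^+ k) _ (B * C ^+ k)).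
- by move=> N; apply: bmfM => //; apply: bmfX; exact: bmf_psum.
- by move=> N w; rewrite normrM ler_pM.
move=> w; apply: cvgMr.
elim: k => [|k ih]; first by under eq_fun do rewrite expr0; exact: cvg_cst.
by under eq_fun do rewrite exprS; rewrite exprS; apply: cvgM => //; exact: psum_cvg.
Qed.

(** One binomial expansion per level of the Horner form; [k - r] and [r] become the exponents of the
    first stick and of its complement. *)
Lemma psum_expand N k : exists A : seq (seq weight), forall i w,
  psum N i w ^+ k = \sum_(l <- A) wprod i l w.
Proof.
elim: N k => [|N ih] k.
  case: k => [|k]; first by exists [:: [::]] => i w; rewrite big_seq1.
  by exists [::] => i w; rewrite big_nil /= expr0n.
have [A hA] := choice ih.
have wb r : exists B : R, forall x, 0 <= 'C(k, r)%:R * phi x ^+ (k - r) <= B.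
  exists ('C(k, r)%:R * C ^+ (k - r)) => x; have /andP[p0 pC] := phiC x.
  rewrite mulr_ge0 ?exprn_ge0//= ler_wpM2l// lerXn2r// nnegrE//.
  exact: le_trans pC.
pose W r := @Weight _ (k - r) r (wb r).
exists (flatten [seq [seq W r :: l | l <- A r] | r <- iota 0 k.+1]) => i w.
rewrite big_flatten big_map /= exprDn -(big_mkord xpredT (fun r =>
  (Z i w * phi (Y i w)) ^+ (k - r) * ((1 - Z i w) * psum N i.+1 w) ^+ r *+ 'C(k, r))).
rewrite /index_iota subn0; apply: eq_bigr => r _.
rewrite big_map /= -mulr_sumr -hA !exprMn -mulr_natl; ring.
Qed.

(** The Markov property: the same [m] serves for the sum from time 0 and, after one step, for the
    sum from time 1. It is eliminated before [N] tends to infinity. *)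
Lemma psum_moment N k : exists m : X -> R,
  (forall x, Ex P (fun w => (Y 0 w == x)%:R * psum N 0 w ^+ k) = mu x * m x) /\
  (forall s r x y, Ex P (fun w => (Z 0 w ^+ s * (1 - Z 0 w) ^+ r * (Y 0 w == x)%:R * (Y 1 w == y)%:R) * psum N 1 w ^+ k) =
    b x s r * (mu x * K x y * m y)).
Proof.
have [A hA] := psum_expand N k.
exists (fun x => \sum_(l <- A) wmom l x); split=> [x|s r x y].
  rewrite mulr_sumr; under eq_bigr do rewrite -start_moment.
  rewrite -Ex_sum; last by move=> l; apply: bmfM => //; exact: (wprod_bmf 0 l).1.
  by apply: eq_Ex => w; rewrite hA mulr_sumr; apply: eq_bigr => l _; rewrite mulrC.
rewrite !mulr_sumr; under eq_bigr do rewrite -front_moment.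
rewrite -Ex_sum; last first.
  by move=> l; do ![apply: bmfM|exact: bY|exact: (wprod_bmf 1 l).1|apply: bmfX].
by apply: eq_Ex => w; rewrite hA mulr_sumr; apply: eq_bigr => l _; rewrite mulrAC.
Qed.

Definition occmom k x := Ex P (fun w => (Y 0 w == x)%:R * occlim 0 w ^+ k).

Let ind_le1 (x y : X) : `|(x == y)%:R : R| <= 1.
Proof. by case: eqP; rewrite ?normr1 ?normr0. Qed.

Let indF s r x y w := Z 0 w ^+ s * (1 - Z 0 w) ^+ r * (Y 0 w == x)%:R * (Y 1 w == y)%:R.

Let bindF s r x y : bmf (indF s r x y).
Proof. by rewrite /indF; do ![apply: bmfM|exact: bY|apply: bmfX]. Qed.

Let indF_le1 s r x y w : `|indF s r x y w| <= 1.
Proof.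
rewrite /indF !normrM !normrX (ger0_norm (Z0 _ _)) (ger0_norm (U0 _ _)).
have z1 : Z 0 w <= 1 by case/andP: (Z01 0 w).
have h (a c : R) : 0 <= a -> 0 <= c -> a <= 1 -> c <= 1 -> a * c <= 1.
  by move=> a0 c0 a1 c1; rewrite -[leRHS]mulr1; exact: ler_pM.
by rewrite !h ?mulr_ge0 ?exprn_ge0 ?exprn_ile1.
Qed.

(** Limit in [N] of the relations of [psum_moment]. The factor [mu y] stands in place of a division,
    as [mu y] may vanish. *)
Lemma occlim_front_moment k s r x y :
  Ex P (fun w => indF s r x y w * occlim 1 w ^+ k) = b x s r * Ex P (fun w => indF 0 0 x y w * occlim 1 w ^+ k) /\
  mu y * Ex P (fun w => indF 0 0 x y w * occlim 1 w ^+ k) = mu x * K x y * occmom k y.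
Proof.
have [_ c1] := Ex_psum_cvg 1 k (bindF s r x y) (indF_le1 s r x y).
have [_ c2] := Ex_psum_cvg 1 k (bindF 0 0 x y) (indF_le1 0 0 x y).
have [_ c3] := Ex_psum_cvg 0 k (bY 0 y) (fun w => ind_le1 (Y 0 w) y).
split.
  have c2' : (fun N => Ex P (fun w => indF s r x y w * psum N 1 w ^+ k)) @ \oo -->
      b x s r * Ex P (fun w => indF 0 0 x y w * occlim 1 w ^+ k).
    have -> : (fun N => Ex P (fun w => indF s r x y w * psum N 1 w ^+ k)) =
        fun N => b x s r * Ex P (fun w => indF 0 0 x y w * psum N 1 w ^+ k).
      by apply/funext => N; have [m [_ hm]] := psum_moment N k; rewrite !hm b00 mul1r.
    by apply: cvgMr.
  by rewrite -(cvg_lim _ c1)// -(cvg_lim _ c2').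
have l2 : (fun N => mu y * Ex P (fun w => indF 0 0 x y w * psum N 1 w ^+ k)) @ \oo -->
   mu y * Ex P (fun w => indF 0 0 x y w * occlim 1 w ^+ k) by apply: cvgMr.
have l3 : (fun N => mu y * Ex P (fun w => indF 0 0 x y w * psum N 1 w ^+ k)) @ \oo -->
    mu x * K x y * occmom k y.
  have -> : (fun N => mu y * Ex P (fun w => indF 0 0 x y w * psum N 1 w ^+ k)) =
      fun N => mu x * K x y * Ex P (fun w => (Y 0 w == y)%:R * psum N 0 w ^+ k).
    apply/funext => N; have [m [h1 h2]] := psum_moment N k.
    by rewrite h2 h1 b00; ring.
  by apply: cvgMr.
by rewrite -(cvg_lim _ l2)// -(cvg_lim _ l3).
Qed.

Lemma occlim_bound i w : 0 <= occlim i w <= C.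
Proof.
rewrite -(cvg_lim _ (psum_cvg (i := i) (w := w)))//.
apply/andP; split; [apply: limr_ge|apply: limr_le].
- by apply: cvgP; exact: psum_cvg.
- by apply: nearW => N; have /andP[] := psum_bound N i w.
- by apply: cvgP; exact: psum_cvg.
- by apply: nearW => N; have /andP[] := psum_bound N i w.
Qed.

Lemma bmf_occlimX i k : bmf (fun w => occlim i w ^+ k).
Proof.
have [+ _] := Ex_psum_cvg i k (bmf_cst 1) (fun w => lexx `|1|).
by under eq_fun do rewrite mul1r.
Qed.

Lemma occmom_sum k : nnsumm (occmom k) /\ rsum (occmom k) = Ex P (fun w => occlim 0 w ^+ k).
Proof.
have nn w : 0 <= occlim 0 w ^+ k by rewrite exprn_ge0//; case/andP: (occlim_bound 0 w).
have [s e] := Ex_partition P (mY 0) (bmf_occlimX 0 k) nn.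
have h x : Ex P (fun w => occlim 0 w ^+ k * (Y 0 w == x)%:R) = occmom k x.
  by apply: eq_Ex => w; rewrite mulrC.
split; first exact: nnsumm_ext h s.
by rewrite -e; apply: eq_rsum => x; rewrite h.
Qed.

Let occmom0 x : occmom 0 x = mu x.
Proof.
rewrite -[RHS]mulr1 -[X in _ = _ * X]/(wmom [::] x) -start_moment.
by apply: eq_Ex => w; rewrite expr0 /= mul1r mulr1.
Qed.

Lemma occmom_init : occmom 0 =1 mu.
Proof. exact: occmom0. Qed.

Let nextmom k x := Ex P (fun w => (Y 0 w == x)%:R * occlim 1 w ^+ k).

Let bnext k s r x : bmf (fun w => Z 0 w ^+ s * (1 - Z 0 w) ^+ r * (Y 0 w == x)%:R * occlim 1 w ^+ k).
Proof. by do ![apply: bmfM|exact: bY|exact: bmf_occlimX|apply: bmfX]. Qed.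

Let next0 k s r x w : 0 <= Z 0 w ^+ s * (1 - Z 0 w) ^+ r * (Y 0 w == x)%:R * occlim 1 w ^+ k.
Proof. by rewrite !mulr_ge0 ?exprn_ge0//; case/andP: (occlim_bound 1 w). Qed.

Let next_sum k s r x : nnsumm (fun y => Ex P (fun w => indF s r x y w * occlim 1 w ^+ k)) /\
  rsum (fun y => Ex P (fun w => indF s r x y w * occlim 1 w ^+ k)) =
  Ex P (fun w => Z 0 w ^+ s * (1 - Z 0 w) ^+ r * (Y 0 w == x)%:R * occlim 1 w ^+ k).
Proof.
have [s1 e1] := Ex_partition P (mY 1) (bnext k s r x) (next0 k s r x).
have h y : Ex P (fun w => Z 0 w ^+ s * (1 - Z 0 w) ^+ r * (Y 0 w == x)%:R * occlim 1 w ^+ k * (Y 1 w == y)%:R) =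
    Ex P (fun w => indF s r x y w * occlim 1 w ^+ k).
  by apply: eq_Ex => w; rewrite mulrAC.
split; first exact: nnsumm_ext h s1.
by rewrite -e1; apply: eq_rsum => y; rewrite h.
Qed.

Let nextmom_sum k x : nnsumm (fun y => Ex P (fun w => indF 0 0 x y w * occlim 1 w ^+ k)) /\
  rsum (fun y => Ex P (fun w => indF 0 0 x y w * occlim 1 w ^+ k)) = nextmom k x.
Proof.
have [s e] := next_sum k 0 0 x; split=> //; rewrite e.
by apply: eq_Ex => w; rewrite !expr0 !mul1r.
Qed.

Let next_indep k s r x :
  Ex P (fun w => Z 0 w ^+ s * (1 - Z 0 w) ^+ r * (Y 0 w == x)%:R * occlim 1 w ^+ k) = b x s r * nextmom k x.
Proof.
have [_ <-] := next_sum k s r x; have [s2 <-] := nextmom_sum k x.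
rewrite -rsumZ//; last by case/andP: (b01 x s r).
by apply: eq_rsum => y; have [-> _] := occlim_front_moment k s r x y.
Qed.

Let occmom_binomial k x :
  occmom k x = \sum_(r < k.+1) 'C(k, r)%:R * phi x ^+ (k - r) * b x (k - r) r * nextmom r x.
Proof.
under eq_bigr do rewrite -mulrA -next_indep -ExZ//.
rewrite -Ex_sum; last by move=> r; apply: bmfZ.
apply: eq_Ex => w; have [Yx|Yx] := eqVneq (Y 0 w) x; last first.
  by rewrite mul0r big1// => r _; rewrite !(mulr0, mul0r).
rewrite mul1r occlim_front Yx exprDn; apply: eq_bigr => r _.
by rewrite !exprMn -mulr_natl mulr1n; ring.
Qed.

Variable c : X -> R.
Hypothesis c0 : forall x, 0 <= c x.
Hypothesis b0r : forall x r, (c x + r%:R) * b x 0 r = c x.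
Hypothesis bSr : forall x s r, b x s.+1 r = b x s r - b x s r.+1.

(** The ratio of consecutive Beta moments [c B(s+1, c+r)], derived from the moments of [1 - Z] and
    the difference rule; denominators are cleared to include [c x = 0]. *)
Let b_rec x s r : (c x + (s.+1 + r)%:R) * b x s.+1 r = s.+1%:R * b x s r.
Proof.
elim: s r => [|s ih] r; rewrite bSr.
  have h1 := b0r x r; have h2 := b0r x r.+1.
  by rewrite mul1r mulrBr add1n h2 -{2}h1 -natr1; ring.
have h1 := ih r; have h2 := ih r.+1.
have h3 : s.+1%:R * b x s.+1 r = s.+1%:R * b x s r - s.+1%:R * b x s r.+1.
  by rewrite bSr mulrBr.
move: h1 h2 h3; rewrite !addSn !addnS -!natr1 natrD.
move: (b x s.+1 r) (b x s.+1 r.+1) (b x s r) (b x s r.+1) => B B' D D'.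
move: (c x) s%:R r%:R => cx n m; lra.
Qed.

(** The binomial theorem on the first stick. The terms of lower order match through [b_rec] and
    [(k+1-r) C(k+1, r) = (k+1) C(k, r)]. *)
Lemma occmom_front_rec k x :
  (c x + k.+1%:R) * occmom k.+1 x = c x * nextmom k.+1 x + k.+1%:R * phi x * occmom k x.
Proof.
rewrite !occmom_binomial big_ord_recr/= subnn expr0 binn !mul1r mulrDr addrC; congr (_ + _).
  by rewrite mulrA b0r.
rewrite !mulr_sumr; apply: eq_bigr => r _.
have rk : (r <= k)%N by rewrite -ltnS.
rewrite subSn// exprS.
have e := b_rec x (k - r) r; rewrite addSn subnK// in e.
have binE : 'C(k.+1, r)%:R * (k - r).+1%:R = k.+1%:R * 'C(k, r)%:R :> R.
  by rewrite -!natrM; congr (_%:R); rewrite -subSn// [LHS]mulnC mul_bin_down.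
transitivity ('C(k.+1, r)%:R * (phi x * phi x ^+ (k - r)) * ((c x + k.+1%:R) * b x (k - r).+1 r) * nextmom r x).
  by ring.
rewrite e.
transitivity (('C(k.+1, r)%:R * (k - r).+1%:R) * (phi x * phi x ^+ (k - r)) * b x (k - r) r * nextmom r x).
  by ring.
by rewrite binE; ring.
Qed.

Variables (theta : R) (Q Q' : X -> X -> R).
Hypothesis cK : forall x y, c x * K x y + (theta - c x) * (x == y)%:R = theta * Q' x y.
Hypothesis balance : forall x y, mu x * Q' x y = mu y * Q y x.
Hypotheses (theta0 : 0 < theta) (c_le : forall x, c x <= theta) (sQ : stochastic Q).

Let occmom_le k x : 0 <= occmom k x <= C ^+ k * mu x.
Proof.
have nn w : 0 <= occlim 0 w ^+ k <= C ^+ k.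
  have /andP[h0 h1] := occlim_bound 0 w.
  by rewrite exprn_ge0//= lerXn2r// nnegrE (C0 w).
apply/andP; split; first by apply: Ex_ge0 => w; rewrite mulr_ge0//; case/andP: (nn w).
rewrite -occmom0 -ExZ; last by apply: bmfM => //; exact: bmf_occlimX.
apply: le_Ex.
- by apply: bmfM => //; exact: bmf_occlimX.
- by apply: bmfZ; apply: bmfM => //; exact: bmf_occlimX.
by move=> w; rewrite expr0 mulr1 mulrC ler_wpM2r//; case/andP: (nn w).
Qed.

(** Uniformisation [cK] replaces the rates [c x] by the constant [theta], and [balance] reverses
    time: the sum over the next state becomes a sum against a column of [Q]. *)
Lemma occmom_rec k x :
  (k.+1%:R + theta) * occmom k.+1 x = theta * vecmat (occmom k.+1) Q x + k.+1%:R * phi x * occmom k x.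
Proof.
suff h : c x * nextmom k.+1 x + (theta - c x) * occmom k.+1 x = theta * vecmat (occmom k.+1) Q x.
  have := occmom_front_rec k x; rewrite -h; lra.
move: k.+1 => {}k.
have [so _] := occmom_sum k; have [sn <-] := nextmom_sum k x.
have [si ei] := rsum_indicr x so.1.
have tc : 0 <= theta - c x by rewrite subr_ge0.
rewrite vecmatE -{1}ei -!rsumZ//; [|exact: ltW|exact: nnsumm_vecmat_col].
rewrite -rsumD; [|exact: nnsummZ|exact: nnsummZ].
apply: eq_rsum => y.
have [_ hb] := occlim_front_moment k 0 0 x y.
set a := Ex P _ in hb *.
have a0 : 0 <= a.
  by apply: Ex_ge0 => w; rewrite !mulr_ge0 ?exprn_ge0//; case/andP: (occlim_bound 1 w).
have hc := cK x y; have hB := balance x y.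
(* Zero mass cannot be divided out. There [balance] gives [mu x * Q' x y = 0], hence
   [c x * (mu x * K x y) = 0], and a multiple of this dominates the term. *)
have [m0|m0] := eqVneq (mu y) 0.
  have w0 : occmom k y = 0.
    by apply/eqP; rewrite eq_le; have := occmom_le k y; rewrite m0 mulr0 andbC.
  rewrite w0 !(mul0r, mulr0) addr0.
  have aC : a <= C ^+ k * (mu x * K x y).
    have [_ h2] := occlim_front_moment 0 0 0 x y.
    have hm := front_moment [::] 0 0 x y; rewrite b00 mul1r /= mulr1 in hm.
    rewrite -hm -ExZ; last first.
      by do ![apply: bmfM|exact: bY|exact: bmf_cst|apply: bmfX].
    apply: le_Ex.
    - by apply: bmfM; [exact: bindF|exact: bmf_occlimX].
    - by apply: bmfZ; do ![apply: bmfM|exact: bY|exact: bmf_cst|apply: bmfX].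
    move=> w; have /andP[h0 h1] := occlim_bound 1 w.
    rewrite mulr1 mulrC ler_wpM2r//; first by rewrite !mulr_ge0 ?exprn_ge0.
    by rewrite lerXn2r// nnegrE (C0 w).
  have ck0 : c x * (mu x * K x y) = 0.
    have : mu x * (theta * Q' x y) = 0 by rewrite mulrCA hB m0 !(mul0r, mulr0).
    rewrite -hc mulrDr => h.
    have [xy|xy] := eqVneq x y; first by rewrite xy m0 !(mul0r, mulr0).
    by move: h; rewrite (negbTE xy) !mulr0 addr0 => <-; ring.
  apply/eqP; rewrite eq_le; apply/andP; split; last exact: mulr_ge0.
  by apply: le_trans (ler_wpM2l (c0 x) aC) _; rewrite mulrCA ck0 mulr0.
apply: (mulfI m0); rewrite mulrDr.
have -> : mu y * (c x * a) = c x * (mu x * K x y * occmom k y) by rewrite -hb; ring.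
have -> : mu y * (theta * (occmom k y * Q y x)) = theta * occmom k y * (mu y * Q y x) by ring.
rewrite -hB.
have -> : theta * occmom k y * (mu x * Q' x y) = occmom k y * mu x * (theta * Q' x y) by ring.
rewrite -hc; have [->|xy] := eqVneq x y; first by ring.
by rewrite ?(eq_sym y x) ?(negbTE xy) ?mulr0n; ring.
Qed.

End moment_process.

(** * From indicators to nonnegative measurable functions *)

Section transfer.
Context {R : realType}.
Context {d1 d2 : measure_display} {O1 : measurableType d1} {O2 : measurableType d2}.
Variables (m1 : {measure set O1 -> \bar R}) (m2 : {measure set O2 -> \bar R}).
Variables (F1 Z1 : O1 -> R) (F2 Z2 : O2 -> R) (C : \bar R).
Hypotheses (mF1 : measurable_fun [set: O1] F1) (mZ1 : measurable_fun [set: O1] Z1).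
Hypotheses (mF2 : measurable_fun [set: O2] F2) (mZ2 : measurable_fun [set: O2] Z2).
Hypotheses (F10 : forall w, 0 <= F1 w) (F20 : forall w, 0 <= F2 w) (fC : C \is a fin_num).
Hypothesis agree : forall B : set R, measurable B ->
  (\int[m1]_w (F1 w * \1_B (Z1 w))%:E = C * \int[m2]_w (F2 w * \1_B (Z2 w))%:E)%E.

Let sum_int d (O : measurableType d) (m : {measure set O -> \bar R}) (F Z : O -> R)
    (h : {nnsfun R >-> R}) (s := finmap.enum_fset (fset_set (range h))) :
  measurable_fun [set: O] F -> measurable_fun [set: O] Z -> (forall w, 0 <= F w) ->
  (\int[m]_w (F w * h (Z w))%:E =
   \sum_(y <- s) y%:E * \int[m]_w (F w * \1_(h @^-1` [set y]) (Z w))%:E)%E.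
Proof.
move=> mF mZ F0.
have mI y : measurable_fun [set: O] (fun w => F w * \1_(h @^-1` [set y]) (Z w)).
  have mi : measurable_fun [set: R] (\1_(h @^-1` [set y]) : R -> R).
    by apply: measurable_indic; exact: measurable_funPTI.
  exact: measurable_funM mF (measurableT_comp mi mZ).
have sy y : y \in s -> 0 <= y.
  move=> ys; have : y \in fset_set (range h) by [].
  by rewrite in_fset_set// inE => -[x _ <-].
transitivity (\int[m]_w \sum_(y <- s) (fun y w => if y \in s then y%:E * (F w * \1_(h @^-1` [set y]) (Z w))%:E else 0) y w)%E.
  apply: eq_integral => w _; rewrite (fimfunE h) fsbig_finite//= mulr_sumr -sumEFin big_seq [RHS]big_seq.
  by apply: eq_bigr => y ys; rewrite ys -EFinM mulrCA.
rewrite ge0_integral_sum//.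
- rewrite big_seq [RHS]big_seq; apply: eq_bigr => y ys; rewrite ys.
  rewrite ge0_integralZl_EFin//; [|by apply/measurable_EFinP|exact: sy].
  by move=> w _; rewrite lee_fin mulr_ge0.
- move=> y; case: (y \in s); last exact: measurable_cst.
  by apply: measurable_funeM; apply/measurable_EFinP.
- move=> y w _; case: ifP => // /sy y0; by rewrite mule_ge0// lee_fin mulr_ge0.
Qed.

(** Simple functions from below and monotone convergence. [F1] can hold all other coordinates and
    [F2] a density, so that one coordinate is treated at a time. *)
Lemma transfer (h : R -> R) : measurable_fun [set: R] h -> (forall t, 0 <= h t) ->
  (\int[m1]_w (F1 w * h (Z1 w))%:E = C * \int[m2]_w (F2 w * h (Z2 w))%:E)%E.
Proof.
move=> mh h0.
have mhE : measurable_fun [set: R] (EFin \o h) by apply/measurable_EFinP.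
pose g := nnsfun_approx measurableT mhE.
have gh t : (fun n => (g n t)%:E) @ \oo --> (h t)%:E.
  by apply: cvg_nnsfun_approx => // x _; rewrite lee_fin.
have key d (O : measurableType d) (m : {measure set O -> \bar R}) (F Z : O -> R) :
    measurable_fun [set: O] F -> measurable_fun [set: O] Z -> (forall w, 0 <= F w) ->
    (fun n => \int[m]_w (F w * g n (Z w))%:E)%E @ \oo --> (\int[m]_w (F w * h (Z w))%:E)%E.
  move=> mF mZ F0.
  have hl w : (fun n => (F w * g n (Z w))%:E) @ \oo --> (F w * h (Z w))%:E.
    apply: cvg_EFin; first exact: nearW.
    by have /fine_cvgP[_ hh] := gh (Z w); apply: cvgMr; exact: hh.
  rewrite (_ : (\int[m]_w (F w * h (Z w))%:E)%E = (\int[m]_w (limn (fun n => (F w * g n (Z w))%:E)))%E); last first.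
    by apply: eq_integral => w _; rewrite (cvg_lim _ (hl w)).
  apply: (@cvg_monotone_convergence _ _ _ m setT measurableT (fun n w => (F w * g n (Z w))%:E)).
  - move=> n; apply/measurable_EFinP.
    exact: (measurable_funM mF (measurableT_comp (measurable_funPT (g n)) mZ)).
  - by move=> n w _; rewrite lee_fin mulr_ge0.
  - move=> w _ n1 n2 n12; rewrite lee_fin ler_wpM2l//.
    by have /lefP := nd_nnsfun_approx measurableT mhE n12; apply.
have k1 := key _ _ m1 F1 Z1 mF1 mZ1 F10; have k2 := key _ _ m2 F2 Z2 mF2 mZ2 F20.
have e n : (\int[m1]_w (F1 w * g n (Z1 w))%:E = C * \int[m2]_w (F2 w * g n (Z2 w))%:E)%E.
  rewrite !sum_int// big_seq [in RHS]big_seq ge0_sume_distrr; last first.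
    move=> y ys; apply: mule_ge0; last by apply: integral_ge0 => w _; rewrite lee_fin mulr_ge0.
    rewrite lee_fin; have : y \in fset_set (range (g n)) by [].
    by rewrite in_fset_set// inE => -[x _ <-].
  apply: eq_bigr => y ys; rewrite agree; first by rewrite muleCA.
  exact: measurable_funPTI.
have k2' := cvgeZl fC k2.
rewrite -(cvg_lim _ k1)// -(cvg_lim _ k2')//; congr (lim (_ @ \oo)).
by apply/funext => n; exact: e.
Qed.

End transfer.

(** * Stick laws given as image measures *)

Section stick_laws.
Context {R : realType} {X : countType} {d d2 : measure_display} {Omega : measurableType d} {O2 : measurableType d2}.
Variables (P : probability Omega R) (Y : nat -> Omega -> X) (S : nat -> Omega -> R).
Variables (init : X -> R) (K : X -> X -> R).
Variables (m2 : X -> {measure set O2 -> \bar R}) (F2 Z2 : X -> O2 -> R).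
Hypotheses (mF2 : forall x, measurable_fun [set: O2] (F2 x)) (mZ2 : forall x, measurable_fun [set: O2] (Z2 x)).
Hypothesis F20 : forall x t, 0 <= F2 x t.

(** The stick law at [x] is the image under [Z2 x] of the measure with density [F2 x] with respect
    to [m2 x]. This covers the Beta densities as well as sticks computed from a uniform number. *)
Definition lawint x (h : R -> R) : \bar R := (\int[m2 x]_t (F2 x t * h (Z2 x t))%:E)%E.

Hypothesis mass1 : forall x, lawint x (fun=> 1) = 1%E.
Hypotheses (mY : forall k x, measurable (Y k @^-1` [set x])) (mS : forall k, measurable_fun [set: Omega] (S k)).
Hypothesis cyl : forall n (y : nat -> X) (B : nat -> set R), (forall k, measurable (B k)) ->
  P [set w | forall k, (k <= n)%N -> Y k w = y k /\ B k (S k w)] =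
  ((init (y 0%N) * \prod_(k < n) K (y k) (y k.+1))%:E * \prod_(k < n.+1) lawint (y k) \1_(B k))%E.

Lemma measurable_lawint x (h : R -> R) : measurable_fun [set: R] h ->
  measurable_fun [set: O2] (fun t => (F2 x t * h (Z2 x t))%:E).
Proof.
move=> mh; apply/measurable_EFinP; apply: measurable_funM => //.
exact: (measurableT_comp mh (mZ2 x)).
Qed.

Lemma le_lawint x (h g : R -> R) : measurable_fun [set: R] h -> measurable_fun [set: R] g ->
  (forall t, 0 <= h t <= g t) -> (0 <= lawint x h <= lawint x g)%E.
Proof.
move=> mh mg hg; apply/andP; split.
  by apply: integral_ge0 => t _; rewrite lee_fin mulr_ge0//; case/andP: (hg (Z2 x t)).
apply: ge0_le_integral => //.
- by move=> t _; rewrite lee_fin mulr_ge0//; case/andP: (hg (Z2 x t)).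
- exact: measurable_lawint.
- exact: measurable_lawint.
- by move=> t _; rewrite lee_fin ler_wpM2l//; case/andP: (hg (Z2 x t)).
Qed.

Lemma lawint_fin x (h : R -> R) : measurable_fun [set: R] h -> (forall t, 0 <= h t <= 1) ->
  lawint x h \is a fin_num /\ (0 <= lawint x h <= 1)%E.
Proof.
move=> mh h01; have m1 : measurable_fun [set: R] (fun=> 1 : R) by exact: measurable_cst.
have := le_lawint x mh m1 h01; rewrite mass1 => /andP[h0 h1].
by rewrite h0 h1 ge0_fin_numE//; split=> //; apply: le_lt_trans h1 _; rewrite ltry.
Qed.

Lemma lawint_prod n (y : nat -> X) (h : nat -> R -> R) :
  (forall j, measurable_fun [set: R] (h j)) -> (forall j t, 0 <= h j t <= 1) ->
  (\int[P]_w (\prod_(j < n.+1) (h j (S j w) * (Y j w == y j)%:R))%:E =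
   (init (y 0%N) * \prod_(k < n) K (y k) (y k.+1))%:E * \prod_(k < n.+1) lawint (y k) (h k))%E.
Proof.
set c := (_ * _)%:E.
have hY k x w : (0 : R) <= (Y k w == x)%:R by [].
have mterm (g : R -> R) j : measurable_fun [set: R] g -> measurable_fun [set: Omega] (fun w => g (S j w) * (Y j w == y j)%:R).
  move=> mg; apply: measurable_funM; last by have [] := bmf_indic (R := R) (y j) (mY j).
  exact: (measurableT_comp mg (mS j)).
(* Coordinates are freed one at a time: the first [m] functions are arbitrary and the others are
   indicators, the case [m = 0] being the cylinder hypothesis. *)
suff main m : (m <= n.+1)%N -> forall h : nat -> R -> R,
  (forall j, measurable_fun [set: R] (h j)) -> (forall j t, 0 <= h j t <= 1) ->
  (forall j, (m <= j)%N -> exists2 B : set R, measurable B & h j = \1_B) ->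
  (\int[P]_w (\prod_(j < n.+1) (h j (S j w) * (Y j w == y j)%:R))%:E =
   c * \prod_(k < n.+1) lawint (y k) (h k))%E.
  move=> mh h01.
  pose h' j := if (j < n.+1)%N then h j else \1_setT.
  have h'E (j : 'I_n.+1) : h' j = h j by rewrite /h' ltn_ord.
  under eq_integral do under eq_bigr do rewrite -h'E.
  under [in RHS]eq_bigr do rewrite -h'E.
  apply: (main n.+1) => //.
  - by move=> j; rewrite /h'; case: ifP => // _; exact: measurable_indic.
  - move=> j t; rewrite /h'; case: ifP => // _; rewrite indicE in_setT/=; exact/andP.
  - by move=> j nj; exists setT => //; rewrite /h' ltnNge nj.
elim: m => [_|m ih mn] {}h mh h01 hB.
  have /choice[B hB'] : forall j, exists B : set R, measurable B /\ h j = \1_B.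
    by move=> j; have [B mB e] := hB j (leq0n j); exists B.
  have mB j := (hB' j).1; have eB j := (hB' j).2.
  rewrite (eq_bigr (fun k : 'I_n.+1 => lawint (y k) \1_(B k))); last by move=> k _; rewrite eB.
  rewrite -(cyl n y mB) -[X in P X]setIT -integral_indic//.
    apply: eq_integral => w _; congr (_%:E); rewrite indicE.
    under eq_bigr do rewrite eB indicE -natrM mulnb.
    have [/set_mem/= hw|/negP hw] := boolP (w \in _).
      rewrite big1// => k _; have [-> Bk] := hw k (ltn_ord k).
      by rewrite eqxx (mem_set Bk).
    have [k hk] : exists k : 'I_n.+1, ~ (Y k w = y k /\ B k (S k w)).
      apply: contrapT => /forallNP hk; apply: hw; apply/mem_set => k kn /=.
      by have /contrapT := hk (Ordinal (kn : (k < n.+1)%N)).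
    rewrite (bigD1 k)//=; suff -> : (S k w \in B k) && (Y k w == y k) = false by rewrite mul0r.
    by apply/negP => /andP[/set_mem Bk /eqP Yk]; exact: hk.
  have -> : [set w | forall k, (k <= n)%N -> Y k w = y k /\ B k (S k w)] =
      \bigcap_(k in [set k | (k <= n)%N]) (Y k @^-1` [set y k] `&` S k @^-1` (B k)).
    by apply/seteqP; split=> w /= hw k; have := hw k.
  apply: bigcap_measurable; first by exists 0%N.
  by move=> k _; apply: measurableI => //; rewrite -[X in measurable X]setTI; exact: mS.
(* Everything but coordinate [m] is absorbed into [F1] and [C], and [transfer] acts on coordinate
   [m]. *)
pose om : 'I_n.+1 := Ordinal mn.
pose F1 w := (Y m w == y m)%:R * \prod_(j < n.+1 | j != om) (h j (S j w) * (Y j w == y j)%:R).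
pose C : \bar R := (c * \prod_(k < n.+1 | k != om) lawint (y k) (h k))%E.
have mF1 : measurable_fun [set: Omega] F1.
  apply: measurable_funM; first by have [] := bmf_indic (R := R) (y m) (mY m).
  under eq_fun do rewrite big_mkcond.
  apply: measurable_prod => j _; case: (j != om) => //.
  by apply: mterm.
have F10 w : 0 <= F1 w.
  rewrite mulr_ge0// prodr_ge0// => j _; rewrite mulr_ge0//.
  by case/andP: (h01 j (S j w)).
have fC : C \is a fin_num.
  rewrite /C fin_numM//; apply: (big_ind (fun z : \bar R => z \is a fin_num)) => //; first by move=> a b fa fb; exact: fin_numM.
  by move=> k _; exact: (lawint_fin (y k) (mh k) (h01 k)).1.
have agree (B : set R) : measurable B ->
    (\int[P]_w (F1 w * \1_B (S m w))%:E = C * \int[m2 (y m)]_t (F2 (y m) t * \1_B (Z2 (y m) t))%:E)%E.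
  move=> mB; pose h' j := if j == m then \1_B else h j.
  have h'm : h' m = \1_B by rewrite /h' eqxx.
  have h'E (j : 'I_n.+1) : j != om -> h' j = h j.
    by move=> jm; rewrite /h'; case: eqP => // e; case/eqP: jm; apply/val_inj.
  have e := ih (ltnW mn) h' _ _ _.
  transitivity (\int[P]_w (\prod_(j < n.+1) (h' j (S j w) * (Y j w == y j)%:R))%:E)%E.
    apply: eq_integral => w _; congr (_%:E); rewrite (bigD1 om)//= h'm /F1.
    under [in RHS]eq_bigr => j jm do rewrite h'E//.
    by ring.
  rewrite e.
  - rewrite (bigD1 om)//= h'm /C.
    under eq_bigr => j jm do rewrite h'E//.
    by rewrite -/(lawint (y m) \1_B) muleCA muleC.
  - by move=> j; rewrite /h'; case: eqP => // _; exact: measurable_indic.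
  - move=> j t; rewrite /h'; case: eqP => // _; rewrite indicE.
    by case: (_ \in _); rewrite /= ?ler01 ?lexx.
  - move=> j; rewrite leq_eqVlt => /orP[/eqP <-|mj]; first by exists B.
    by rewrite /h' gtn_eqF//; exact: hB.
have := transfer mF1 (mS m) (mF2 (y m)) (mZ2 (y m)) F10 (F20 (y m)) fC agree (mh m) _.
move=> tr; transitivity (\int[P]_w (F1 w * h m (S m w))%:E)%E.
  by apply: eq_integral => w _; congr (_%:E); rewrite (bigD1 om)//= /F1; ring.
rewrite tr; last by move=> t; case/andP: (h01 m t).
by rewrite [in RHS](bigD1 om)//= /C -/(lawint (y m) (h m)) muleCA muleC.
Qed.

(** Sticks lie in the unit interval only almost surely; clipping gives bounds at every sample point.
    The same function is the distribution function of the uniform law. *)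
Definition clip01 (t : R) : R := Num.min 1 (Num.max 0 t).

Lemma clip01_bound t : 0 <= clip01 t <= 1.
Proof. by rewrite /clip01 ge_min lexx le_min ler01 le_max lexx. Qed.

Lemma clip01_id t : 0 <= t <= 1 -> clip01 t = t.
Proof. by move=> /andP[t0 t1]; rewrite /clip01 (max_idPr t0) (min_idPr t1). Qed.

Lemma measurable_clip01 : measurable_fun [set: R] clip01.
Proof. by apply: measurable_minr; [exact: measurable_cst|apply: measurable_maxr]. Qed.

Definition stickmono s r t := clip01 t ^+ s * (1 - clip01 t) ^+ r.

Lemma stickmono_bound s r t : 0 <= stickmono s r t <= 1.
Proof.
have /andP[c0 c1] := clip01_bound t.
have u0 : 0 <= 1 - clip01 t by rewrite subr_ge0.
have u1 : 1 - clip01 t <= 1 by rewrite lerBlDr lerDl.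
rewrite mulr_ge0 ?exprn_ge0//= -[leRHS]mulr1 ler_pM ?exprn_ge0 ?exprn_ile1//.
Qed.

Lemma measurable_stickmono s r : measurable_fun [set: R] (stickmono s r).
Proof.
apply: measurable_funM; apply: measurable_funX; first exact: measurable_clip01.
by apply: measurable_funB; [exact: measurable_cst|exact: measurable_clip01].
Qed.

Definition lawmom x s r : R := fine (lawint x (stickmono s r)).

Lemma lawmomE x s r : lawint x (stickmono s r) = (lawmom x s r)%:E.
Proof.
by rewrite fineK//; exact: (lawint_fin x (measurable_stickmono s r) (stickmono_bound s r)).1.
Qed.

Lemma lawmom_bound x s r : 0 <= lawmom x s r <= 1.
Proof.
have [_] := lawint_fin x (measurable_stickmono s r) (stickmono_bound s r).
by rewrite lawmomE !lee_fin.
Qed.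

Lemma lawmom00 x : lawmom x 0 0 = 1.
Proof.
rewrite /lawmom -[RHS]/(fine 1%E) -(mass1 x); congr fine.
by apply: eq_integral => t _; rewrite /stickmono !expr0 mul1r.
Qed.

Lemma lawmomS x s r : lawmom x s.+1 r = lawmom x s r - lawmom x s r.+1.
Proof.
suff : lawmom x s r = lawmom x s.+1 r + lawmom x s r.+1 by move=> ->; rewrite addrK.
apply: EFin_inj; rewrite EFinD -!lawmomE /lawint -ge0_integralD//.
- apply: eq_integral => t _; rewrite -EFinD; congr (_%:E); rewrite /stickmono !exprS; ring.
- by move=> t _; rewrite lee_fin mulr_ge0//; case/andP: (stickmono_bound s.+1 r (Z2 x t)).
- by apply: measurable_lawint; exact: measurable_stickmono.
- by move=> t _; rewrite lee_fin mulr_ge0//; case/andP: (stickmono_bound s r.+1 (Z2 x t)).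
- by apply: measurable_lawint; exact: measurable_stickmono.
Qed.

Lemma stick_moment_process :
  moment_process P Y (fun k w => clip01 (S k w)) init K lawmom.
Proof.
split=> //.
- by move=> k; exact: (measurableT_comp measurable_clip01 (mS k)).
- by move=> k w; exact: clip01_bound.
move=> n y s r.
have := lawint_prod n y (fun j => measurable_stickmono (s j) (r j)) (fun j => stickmono_bound (s j) (r j)).
under [X in _ = (_ * X)%E]eq_bigr do rewrite lawmomE.
by rewrite prodEFin -EFinM /Ex => ->.
Qed.

End stick_laws.

(** * The Beta(1, c) law *)

Section beta_law.
Context {R : realType}.
Local Notation mu := (@lebesgue_measure R).

Lemma is_derive_powR_onem (a t : R) : t < 1 ->
  is_derive t 1 (fun t : R => - powR (1 - t) a) (a * powR (1 - t) (a - 1)).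
Proof.
move=> t1; have p : 0 < 1 - t by lra.
have h1 : is_derive t 1 (fun t : R => 1 - t) (-1).
  by have := is_deriveB (is_derive_cst (1 : R) t 1) (is_derive_id t 1); rewrite sub0r.
have h2 := is_derive1_powR a p.
have h3 := @is_derive1_comp R ((@powR R) ^~ a) (fun t : R => 1 - t) t _ _ h2 h1.
by have := is_deriveN h3; rewrite mulrN1 opprK.
Qed.

(** The interval stops short of 1, where the density is unbounded for [a < 1]. *)
Lemma integral_powR_onem (a s : R) : 0 < a -> 0 < s < 1 ->
  (\int[mu]_(t in `[0%R, s]) (a * powR (1 - t) (a - 1))%:E = (1 - powR (1 - s) a)%:E)%E.
Proof.
move=> a0 /andP[s0 s1].
have D (b t : R) : t < 1 -> derivable (fun t : R => - powR (1 - t) b) t 1.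
  by move=> t1; have [] := is_derive_powR_onem b t1.
have Dc (b t : R) : t < 1 -> {for t, continuous (fun t : R => - powR (1 - t) b)}.
  by move=> t1; apply/differentiable_continuous/derivable1_diffP; exact: D.
rewrite (@continuous_FTC2 _ _ (fun t : R => - powR (1 - t) a))//.
- by rewrite subr0 powR1 -EFinB opprK addrC.
- apply: continuous_in_subspaceT => t; rewrite inE/= in_itv/= => /andP[_ ts].
  have t1 : t < 1 by exact: le_lt_trans s1.
  have := @Dc (a - 1) t t1 => h.
  rewrite (_ : (fun t : R => a * powR (1 - t) (a - 1)) = (fun t : R => (- a) * (- powR (1 - t) (a - 1)))); last first.
    by apply/funext => u; rewrite mulrNN.
  by apply: cvgMr; exact: h.
- split.
  + by move=> t; rewrite in_itv/= => /andP[_ ts]; apply: D; exact: lt_trans s1.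
  + by apply: cvg_at_right_filter; apply: Dc.
  + by apply: cvg_at_left_filter; apply: Dc.
- move=> t; rewrite in_itv/= => /andP[_ ts].
  by rewrite derive1E; apply: derive_val; apply: is_derive_powR_onem; exact: lt_trans s1.
Qed.

Lemma integral_powR_onem1 (a : R) : 0 < a ->
  (\int[mu]_(t in `[0%R, 1%R]) (a * powR (1 - t) (a - 1))%:E = 1)%E.
Proof.
move=> a0.
pose f t : \bar R := (a * powR (1 - t) (a - 1))%:E.
have mf D : measurable_fun D f.
  apply: (@measurable_funS _ _ _ _ setT) => //; apply/measurable_EFinP; apply: measurable_funM => //.
  apply: (measurableT_comp (measurable_powR _)); exact: measurable_funB.
have f0 t : (0 <= f t)%E by rewrite lee_fin mulr_ge0 ?powR_ge0// ltW.
pose F n : set R := `[0%R, (1 - n.+2%:R^-1)%R]%classic.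
have s01 n : 0 < (1 - n.+2%:R^-1 : R) < 1.
  by rewrite subr_gt0 invf_lt1 ?ltr1n//= ltrBlDr ltrDl invr_gt0.
have ndF : nondecreasing_seq F.
  move=> m n mn; apply/subsetPset => t; rewrite /F/= !in_itv/= => /andP[-> h]/=.
  by apply: le_trans h _; rewrite lerD2l lerN2 lef_pV2 ?posrE// ler_nat.
have UF : \bigcup_n F n = `[0%R, 1%R[%classic.
  apply/seteqP; split=> [t [n _]|t]; rewrite /F/= !in_itv/=.
    by move=> /andP[-> h]/=; apply: le_lt_trans h _; case/andP: (s01 n).
  move=> /andP[t0 t1]; have e0 : 0 < 1 - t by lra.
  have [n hn] : exists n, n.+1%:R^-1 < 1 - t.
    by exists (Num.truncn (1 - t)^-1); rewrite invf_plt ?posrE// truncnS_gt.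
  exists n => //=; rewrite in_itv/= t0/=.
  rewrite lerBrDr -lerBrDl; apply: le_trans (ltW hn).
  by rewrite lef_pV2 ?posrE// ler_nat.
have c1 : (fun n => \int[mu]_(t in F n) f t)%E @ \oo --> (\int[mu]_(t in `[0%R, 1%R[) f t)%E.
  by rewrite -UF; apply: ge0_nondecreasing_set_cvg_integral => // i; [exact: measurable_itv|exact: mf].
have c2 : (fun n => \int[mu]_(t in F n) f t)%E @ \oo --> 1%E.
  rewrite (_ : (fun n => _) = fun n => (1 - powR (n.+2%:R^-1) a)%:E); last first.
    by apply/funext => n; rewrite /F integral_powR_onem// opprB addrCA subrr addr0.
  apply: cvg_EFin; first exact: nearW.
  rewrite -[X in _ --> X]subr0; apply: cvgB; first exact: cvg_cst.
  have /cvg_at_rightP/(_ (fun n => n.+2%:R^-1)) := powR_cvg0 a0.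
  apply; split; first by move=> n; rewrite invr_gt0.
  by have := @cvg_harmonic R; rewrite -(@cvg_shiftS _ (@harmonic R)).
transitivity (\int[mu]_(t in `[0%R, 1%R[) f t)%E.
  by symmetry; exact: (@integral_itv_bndo_bndc R (BLeft 0) 1 f (mf _)).
by rewrite -(cvg_lim _ c1)// (cvg_lim _ c2).
Qed.


Variables (X : countType) (c : X -> R).
Hypothesis c0 : forall x, 0 <= c x.

(** Beta(1, 0) is the point mass at 1 and has no Lebesgue density, so the base measure depends on
    the state. *)
Definition beta_base (x : X) : {measure set (measurableTypeR R) -> \bar R} :=
  if c x == 0 then [the {measure set (measurableTypeR R) -> \bar R} of @dirac _ (measurableTypeR R) 1 R]
  else [the {measure set (measurableTypeR R) -> \bar R} of @lebesgue_measure R].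

Definition beta_density (x : X) (t : measurableTypeR R) : R :=
  if c x == 0 then 1 else c x * powR (1 - t) (c x - 1) * \1_(`[0%R, 1%R]%classic : set R) t.

Lemma measurable_beta_density x : measurable_fun [set: measurableTypeR R] (beta_density x).
Proof.
rewrite /beta_density; case: (c x == 0); first exact: measurable_cst.
apply: measurable_funM; last exact: measurable_indic.
apply: measurable_funM => //.
by apply: (measurableT_comp (measurable_powR _)); exact: measurable_funB.
Qed.

Lemma beta_density_ge0 x t : 0 <= beta_density x t.
Proof. by rewrite /beta_density; case: ifP => // _; rewrite !mulr_ge0 ?powR_ge0. Qed.

Local Notation lawb := (lawint beta_base beta_density (fun _ t => t : R)).

Lemma lawint_dirac x (h : R -> R) : c x = 0 -> measurable_fun [set: R] h -> lawb x h = (h 1)%:E.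
Proof.
move=> cx mh; rewrite /lawint /beta_base /beta_density cx eqxx.
rewrite integral_dirac//; first by rewrite diracT mul1e mul1r.
by apply/measurable_EFinP; apply: measurable_funM => //; exact: measurable_cst.
Qed.

Lemma lawint_density x (h : R -> R) : c x != 0 -> lawb x h =
  (\int[mu]_(t in `[0%R, 1%R]) (c x * powR (1 - t) (c x - 1) * h t)%:E)%E.
Proof.
move=> cx; rewrite /lawint /beta_base /beta_density (negbTE cx) [RHS]integral_mkcond.
apply: eq_integral => t _; rewrite patchE indicE; case: ifP => _; first by rewrite mulr1.
by rewrite mulr0 mul0r.
Qed.

Lemma lawint_beta1 x (B : set R) : measurable B -> lawb x \1_B = beta1 (c x) B.
Proof.
move=> mB; rewrite /beta1; have [cx|cx] := eqVneq (c x) 0.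
  by rewrite lawint_dirac//; exact: measurable_indic.
rewrite lawint_density// setIC integral_mkcondr; apply: eq_integral => t _.
by rewrite patchE indicE; case: ifP => _; rewrite ?mulr1 ?mulr0.
Qed.

Lemma lawint_beta_mass x : lawb x (fun=> 1) = 1%E.
Proof.
have [cx|cx] := eqVneq (c x) 0.
  by rewrite lawint_dirac//; exact: measurable_cst.
rewrite lawint_density//; under eq_integral do rewrite mulr1.
by rewrite integral_powR_onem1// lt_neqAle eq_sym cx c0.
Qed.

(** The factor [(1 - t)^r] turns the density of Beta(1, c) into [c / (c + r)] times that of Beta(1,
    c + r). With the denominator cleared the identity also covers [c x = 0]. *)
Lemma lawmom_beta x r : (c x + r%:R) * lawmom beta_base beta_density (fun _ t => t : R) x 0 r = c x.
Proof.
rewrite /lawmom; have [cx|cx] := eqVneq (c x) 0.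
  rewrite lawint_dirac//; last exact: measurable_stickmono.
  rewrite cx add0r /stickmono clip01_id ?lexx ?ler01// subrr expr0 mul1r.
  by case: r => [|r]; rewrite ?mul0r// expr0n mulr0.
have cp : 0 < c x by rewrite lt_neqAle eq_sym cx c0.
have crp : 0 < c x + r%:R by rewrite ltr_pwDl.
rewrite lawint_density//.
rewrite (_ : (\int[mu]_(t in _) _)%E = (c x / (c x + r%:R))%:E); first by rewrite /= mulrC divfK ?gt_eqF.
transitivity ((c x / (c x + r%:R))%:E * \int[mu]_(t in `[0%R, 1%R]) ((c x + r%:R) * powR (1 - t) (c x + r%:R - 1))%:E)%E.
  rewrite -ge0_integralZl_EFin//.
  - apply: eq_integral => t; rewrite inE/= in_itv/= => t01; have /andP[t0 t1] := t01.
    rewrite /stickmono clip01_id// expr0 mul1r -EFinM; congr (_%:E).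
    rewrite mulrA divfK ?gt_eqF// -mulrA; congr (_ * _).
    rewrite -powR_mulrn ?subr_ge0//.
    case: r crp => [|r] crp; first by rewrite powRr0 mulr1 addr0.
    (* At [t = 1] the powers cannot be merged, but both sides vanish. *)
    have [t1'|t1'] := eqVneq (1 - t) 0.
      have cr : c x + r.+1%:R - 1 = c x + r%:R by rewrite -natr1; ring.
      by rewrite t1' (powR0 (x := r.+1%:R)) ?mulr0// cr powR0// gt_eqF// ltr_pwDl.
    by rewrite -powRD ?t1' ?implybT// addrAC.
  - by move=> t _; rewrite lee_fin mulr_ge0 ?powR_ge0// ltW.
  - apply: (@measurable_funS _ _ _ _ setT) => //; apply/measurable_EFinP; apply: measurable_funM => //.
    by apply: (measurableT_comp (measurable_powR _)); exact: measurable_funB.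
  - by rewrite divr_ge0// ltW.
by rewrite integral_powR_onem1// mule1.
Qed.

End beta_law.

(** * Weighted vectors of a fixed sequence of sticks *)

Section stick_vectors.
Context {R : realType} {X : countType}.
Variables (x : nat -> R) (y : nat -> X).
Hypothesis x01 : forall j, 0 <= x j <= 1.

Let x0 j : 0 <= x j. Proof. by case/andP: (x01 j). Qed.
Let u0 j : 0 <= 1 - x j. Proof. by rewrite subr_ge0; case/andP: (x01 j). Qed.

Lemma stick_ge0 j : 0 <= stick x j.
Proof. by rewrite mulr_ge0// prodr_ge0. Qed.

Lemma sum_stick n : \sum_(j < n) stick x j = 1 - \prod_(j < n) (1 - x j).
Proof.
elim: n => [|n ih]; first by rewrite !big_ord0 subrr.
by rewrite !big_ord_recr/= ih /stick; ring.
Qed.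

Lemma sum_stick_le1 n : \sum_(j < n) stick x j <= 1.
Proof. by rewrite sum_stick lerBlDr lerDl prodr_ge0. Qed.

Let wsum (f : X -> R) n := \sum_(j < n) stick x j * f (y j).

Let wsum_cvg (f : X -> R) (B : R) : (forall l, 0 <= f l <= B) ->
  cvg (wsum f @ \oo).
Proof.
move=> fB; apply: nondecreasing_is_cvgn.
  apply/nondecreasing_seqP => n; rewrite /wsum big_ord_recr/= lerDl mulr_ge0 ?stick_ge0//.
  by case/andP: (fB (y n)).
exists B => _ [n _ <-]; rewrite /wsum.
have B0 : 0 <= B by case/andP: (fB (y 0)) => f0 fb; exact: le_trans fb.
apply: (@le_trans _ _ (\sum_(j < n) stick x j * B)).
  by apply: ler_sum => j _; rewrite ler_wpM2l ?stick_ge0//; case/andP: (fB (y j)).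
by rewrite -mulr_suml ler_piMl// sum_stick_le1.
Qed.

Let ereal_wsum (f : X -> R) (B : R) : (forall l, 0 <= f l <= B) ->
  (\sum_(0 <= j <oo) (stick x j * f (y j))%:E = (lim (wsum f @ \oo))%:E)%E.
Proof.
move=> fB; apply/cvg_lim => //.
have h : (fun n => (wsum f n)%:E) @ \oo --> (lim (wsum f @ \oo))%:E.
  by apply: cvg_EFin; [exact: nearW|exact: wsum_cvg fB].
apply: cvg_trans h; apply: near_eq_cvg; apply: nearW => n.
by rewrite big_mkord sumEFin.
Qed.

Let ind01 l : forall z : X, 0 <= ((z == l)%:R : R) <= 1.
Proof. by move=> z; case: eqP; rewrite ?ler01 ?lexx. Qed.

Lemma weighted_vectorE l : weighted_vector x y l = lim (wsum (fun z => (z == l)%:R) @ \oo).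
Proof. by rewrite /weighted_vector (ereal_wsum (ind01 l)). Qed.

Lemma sum_weighted_vector (L : seq X) :
  (fun n => \sum_(j < n) stick x j * occ L (y j)) @ \oo --> \sum_(l <- L) weighted_vector x y l.
Proof.
have -> : (fun n => \sum_(j < n) stick x j * occ L (y j)) =
    fun n => \sum_(l <- L) wsum (fun z => (z == l)%:R) n.
  by apply/funext => n; rewrite exchange_big; apply: eq_bigr => j _; rewrite mulr_sumr.
elim: L => [|l L ih].
  by rewrite big_nil; under eq_fun do rewrite big_nil; exact: cvg_cst.
rewrite big_cons weighted_vectorE.
under eq_fun do rewrite big_cons.
by apply: cvgD ih; exact: wsum_cvg (ind01 l).
Qed.

(** After exchanging the sums over states and sticks, the total mass is 1 minus the limit of the
    residual product. *)
Lemma weighted_vector_prob : (fun n => \prod_(j < n) (1 - x j)) @ \oo --> 0 ->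
  prob_vector (weighted_vector x y).
Proof.
move=> c0.
have wE l : (weighted_vector x y l)%:E = (\sum_(0 <= j <oo) (stick x j * (y j == l)%:R)%:E)%E.
  by rewrite weighted_vectorE (ereal_wsum (ind01 l)).
have nn j l : (0 <= (stick x j * (y j == l)%:R)%:E)%E by rewrite lee_fin mulr_ge0 ?stick_ge0.
split=> [l|].
  by rewrite -lee_fin wE; apply: nneseries_ge0 => j _ _.
under eq_esum do rewrite wE nneseries_esumT//.
rewrite esum_swap//.
under eq_esum do rewrite esum_indic ?stick_ge0//.
rewrite -nneseries_esumT; last by move=> j; rewrite lee_fin stick_ge0.
apply/cvg_lim => //.
have h : (fun n => (\sum_(j < n) stick x j)%:E) @ \oo --> (1 - 0 : R)%:E.
  apply: cvg_EFin; first exact: nearW.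
  by under eq_fun do rewrite sum_stick; apply: cvgB; [exact: cvg_cst|].
rewrite subr0 in h; apply: cvg_trans h; apply: near_eq_cvg; apply: nearW => n.
by rewrite big_mkord sumEFin.
Qed.

End stick_vectors.

(** * Sticks that exhaust the unit mass *)

Section good_sticks.
Context {R : realType} {X : countType} {d : measure_display} {Omega : measurableType d}.
Variables (P : probability Omega R) (Y : nat -> Omega -> X) (S : nat -> Omega -> R).
Variables (mu : X -> R) (K : X -> X -> R) (b : X -> nat -> nat -> R) (rho : R).
Hypothesis mS : forall k, measurable_fun [set: Omega] (S k).
Hypothesis mp : moment_process P Y (fun k w => clip01 (S k w)) mu K b.
Hypotheses (sK : stochastic K) (pmu : prob_vector mu).
Hypotheses (b01 : forall x s r, 0 <= b x s r <= 1) (b00 : forall x, b x 0 0 = 1).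
Hypotheses (rho01 : 0 <= rho < 1) (b_rho : forall x, b x 0 1 <= rho).
Hypothesis S_unit : forall k, P [set w | ~ (0 <= S k w <= 1)] = 0%E.

Let Z k w : R := clip01 (S k w).
Let Z01 k w : 0 <= Z k w <= 1. Proof. exact: clip01_bound. Qed.
Let U0 k w : 0 <= 1 - Z k w. Proof. by rewrite subr_ge0; case/andP: (Z01 k w). Qed.
Let U1 k w : 1 - Z k w <= 1. Proof. by rewrite lerBlDr lerDl; case/andP: (Z01 k w). Qed.

Let bZ k : bmf (Z k).
Proof.
case: mp => _ mZ _ _; split; first exact: mZ.
by exists 1 => w; have /andP[z0 z1] := Z01 k w; rewrite ger0_norm.
Qed.

Let res n w := \prod_(j < n) (1 - Z j w).
Let res01 n w : 0 <= res n w <= 1.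
Proof. by rewrite prodr_ge0//= prodr_ile1// => j _; rewrite U0 U1. Qed.

Let bres n : bmf (res n).
Proof. by apply: bmf_prod => j; apply: bmfB => //; exact: bmf_cst. Qed.

Let reslim w := lim ((res ^~ w) @ \oo).

Let res_cvg w : (res ^~ w) @ \oo --> reslim w.
Proof.
apply: nonincreasing_is_cvgn.
  apply/nonincreasing_seqP => n; rewrite /res big_ord_recr/= ler_piMr//.
  exact: prodr_ge0.
by exists 0 => _ [n _ <-]; case/andP: (res01 n w).
Qed.

(** On this event clipping changes nothing and the weighted vector is a probability vector. *)
Definition good_sticks : set Omega :=
  [set w | (forall k, 0 <= S k w <= 1) /\ reslim w = 0].

Lemma measurable_unit_stick k : measurable [set w | 0 <= S k w <= 1].
Proof.
have m01 : measurable (`[0%R, 1%R]%classic : set R) by exact: measurable_itv.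
have := mS k measurableT m01; rewrite setTI.
by [].
Qed.

Let reslim_bmf : bmf reslim /\ (fun n => Ex P (res n)) @ \oo --> Ex P reslim.
Proof.
apply: (@bmf_cvg _ _ _ _ res reslim 1) => // n w.
by have /andP[r0 r1] := res01 n w; rewrite ger0_norm.
Qed.

Lemma measurable_good_sticks : measurable good_sticks.
Proof.
have -> : good_sticks = (\bigcap_k [set w | 0 <= S k w <= 1]) `&` reslim @^-1` [set 0].
  by apply/seteqP; split=> w [h1 h2]; split=> // k; [move=> _|]; exact: h1.
apply: measurableI; first by apply: bigcapT_measurable => k; exact: measurable_unit_stick.
by have [[mr _] _] := reslim_bmf; rewrite -[X in measurable X]setTI; apply: mr.
Qed.

Let Ex_reslim : Ex P reslim = 0.
Proof.
have [_ c] := reslim_bmf; rewrite -(cvg_lim _ c)//; apply/cvg_lim => //.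
have /prob_vectorP[sm m1] := pmu; have /andP[rho0 rho1] := rho01.
have h0 : (fun=> 0 : R) @ \oo --> (0 : R) by exact: cvg_cst.
have h1 : (fun n => rho ^+ n) @ \oo --> (0 : R) by apply: cvg_expr; rewrite ger0_norm.
apply: (squeeze_cvgr _ h0 h1); apply: nearW => n.
rewrite Ex_ge0/=; last by move=> w; case/andP: (res01 n w).
exact: (residual_moment_le mp sK sm.1 b01 b00 n m1 sm rho0 b_rho).
Qed.

(** The residual products decrease to a nonnegative limit whose expectation is 0, since theirs are
    at most [rho ^ n]. *)
Lemma good_sticks_full : P (~` good_sticks) = 0%E.
Proof.
have mG : measurable (~` good_sticks) by apply: measurableC; exact: measurable_good_sticks.
apply: (iffLR (negligibleP P mG)).
pose A n := if n is k.+1 then [set w | ~ (0 <= S k w <= 1)] else [set w | reslim w <> 0].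
apply: (@negligibleS _ _ _ P (\bigcup_n A n)).
  move=> w; rewrite /good_sticks/= => /not_andP[/existsNP[k hk]|hr]; first by exists k.+1.
  by exists 0%N.
apply: negligible_bigcup => -[|k] /=.
  have [br _] := reslim_bmf.
  have mr : measurable_fun [set: Omega] (fun w => (reslim w)%:E) by apply/measurable_EFinP; exact: br.1.
  have : (\int[P]_w `|(reslim w)%:E| = 0)%E.
    rewrite -[RHS]/(0%:E) -Ex_reslim -ExE//; apply: eq_integral => w _.
    rewrite /= ger0_norm// -(cvg_lim _ (@res_cvg w))//; apply: limr_ge.
      by apply: cvgP; exact: res_cvg.
    by apply: nearW => n; case/andP: (res01 n w).
  move=> /(ae_eq_integral_abs P measurableT mr)[N [mN N0 sN]].
  exists N; split=> // w hw; apply: sN => /= h; apply: hw.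
  by have := h I => -[].
have mk : measurable [set w | ~ (0 <= S k w <= 1)].
  by rewrite (_ : [set w | _] = ~` [set w | 0 <= S k w <= 1])//; apply: measurableC; exact: measurable_unit_stick.
by apply/(negligibleP P mk); exact: S_unit.
Qed.

Lemma good_sticks_prob w : good_sticks w ->
  prob_vector (weighted_vector (fun j => S j w) (fun j => Y j w)).
Proof.
move=> [hS hr]; apply: weighted_vector_prob => //.
rewrite (_ : (fun n => _) = res ^~ w); first by rewrite -hr; exact: res_cvg.
by apply/funext => n; apply: eq_bigr => j _; rewrite /Z clip01_id.
Qed.

Lemma good_sticks_occ w (L : seq X) : good_sticks w ->
  \sum_(l <- L) weighted_vector (fun j => S j w) (fun j => Y j w) l = occlim Y Z (occ L) 0 w.
Proof.
move=> [hS hr].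
have ps N i : psum Y Z (occ L) N i w =
    \sum_(j < N) (Z (i + j)%N w * \prod_(k < j) (1 - Z (i + k)%N w)) * occ L (Y (i + j)%N w).
  elim: N i => [|N ih] i; first by rewrite big_ord0.
  rewrite big_ord_recl/= big_ord0 mulr1 addn0 ih; congr (_ + _).
  rewrite [LHS]mulr_sumr; apply: eq_bigr => j _; rewrite /bump/= add1n big_ord_recl/= addn0 addnS addSn.
  under [in RHS]eq_bigr do rewrite /bump/= add1n addnS -addSn.
  ring.
have := @sum_weighted_vector R X (fun j => S j w) (fun j => Y j w) hS L => h.
rewrite -(cvg_lim _ h)// /occlim; congr (lim (_ @ \oo)); apply/funext => N.
rewrite ps; apply: eq_bigr => j _; rewrite add0n /stick /Z clip01_id//; congr (_ * _ * _).
by apply: eq_bigr => k _; rewrite add0n clip01_id.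
Qed.

End good_sticks.

(** * Support of the sticks from cylinder probabilities *)

Section unit_sticks.
Context {R : realType} {X : countType} {d : measure_display} {Omega : measurableType d}.
Variables (P : probability Omega R) (Y : nat -> Omega -> X) (S : nat -> Omega -> R).
Variables (mu : X -> R) (K : X -> X -> R) (law : X -> set R -> \bar R).
Hypotheses (mY : forall k x, measurable (Y k @^-1` [set x])) (mS : forall k, measurable_fun [set: Omega] (S k)).
Hypothesis cyl : forall n (y : nat -> X) (B : nat -> set R), (forall k, measurable (B k)) ->
  P [set w | forall k, (k <= n)%N -> Y k w = y k /\ B k (S k w)] =
  ((mu (y 0%N) * \prod_(k < n) K (y k) (y k.+1))%:E * \prod_(k < n.+1) law (y k) (B k))%E.
Hypotheses (law1 : forall x, law x setT = 1%E) (law_unit : forall x, law x (~` `[0%R, 1%R]%classic) = 0%E).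

Lemma cyl_markov_chain : markov_chain P Y mu (fun=> K).
Proof.
split=> // n y.
have := @cyl n y (fun=> [set: R]) (fun=> measurableT).
rewrite [X in (_ * X)%E]big1; last by move=> k _; exact: law1.
rewrite mule1 => <-; congr (P _); apply/seteqP; split=> w /= h k kn.
  by split=> //; exact: h.
by have [] := h k kn.
Qed.

(** Cylinder probabilities also fix the states, so the event is split over the countably many
    histories up to [k], each of probability zero by [law_unit]. *)
Lemma cyl_unit_sticks k : P [set w | ~ (0 <= S k w <= 1)] = 0%E.
Proof.
pose A := [set w | ~ (0 <= S k w <= 1)].
have mA : measurable A.
  rewrite (_ : A = ~` [set w | 0 <= S k w <= 1])//; apply: measurableC; exact: measurable_unit_stick.
pose F w : R := \1_A w.
have bF : bmf F.
  split; first exact: measurable_indic.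
  by exists 1 => w; rewrite /F indicE; case: (_ \in _); rewrite ?normr1 ?normr0.
have F0 w : 0 <= F w by rewrite /F indicE.
have mp := @measurable_path_upto _ _ _ _ _ _ _ _ cyl_markov_chain k.+1.
have [s e] := Ex_partition P mp bF F0.
suff h p : Ex P (fun w => F w * (path_upto Y k.+1 w == p)%:R) = 0.
  have := e; rewrite (eq_rsum h) rsum0 (@Ex_indic _ _ _ P A)//.
  by move=> /esym pA; rewrite -/A -[LHS]fineK ?pA// fin_num_measure.
have [sp|sp] := eqVneq (size p) k.+1; last first.
  rewrite (@eq_Ex _ _ _ P _ (fun=> 0)) ?Ex_cst// => w.
  suff -> : (path_upto Y k.+1 w == p) = false by rewrite mulr0.
  by apply/negP => /eqP hp; move: sp; rewrite -hp size_path_upto eqxx.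
case: p sp => [//|x0 p] sp.
rewrite (@Ex_indic _ _ _ P (A `&` path_upto Y k.+1 @^-1` [set x0 :: p])); last 2 first.
- exact: measurableI.
- move=> w; rewrite /F indicE -natrM mulnb in_setI; congr (_ && _)%:R.
  by apply/eqP/idP => [?|/set_mem//]; exact/mem_set.
pose B j : set R := if j == k then ~` `[0%R, 1%R]%classic else setT.
have mB j : measurable (B j).
  by rewrite /B; case: (j == k) => //; apply: measurableC; exact: measurable_itv.
have sub : A `&` path_upto Y k.+1 @^-1` [set x0 :: p] =
    [set w | forall j, (j <= k)%N -> Y j w = nth x0 (x0 :: p) j /\ B j (S j w)].
  apply/seteqP; split=> w /=.
    move=> [Aw hp] j jk; split.
      by rewrite -hp (nth_path_upto Y x0 w (jk : (j < k.+1)%N)).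
    by rewrite /B; case: eqP => // ->; rewrite /= in_itv.
  move=> h; split.
    by have [_] := h k (leqnn k); rewrite /B eqxx /= in_itv.
  apply: (@eq_from_nth _ x0); first by rewrite (size_path_upto Y k.+1).
  move=> j; rewrite (size_path_upto Y k.+1) => jk.
  by rewrite (nth_path_upto Y x0 w jk); have [] := h j jk.
by rewrite sub cyl// big_ord_recr/= {2}/B eqxx law_unit !mule0.
Qed.

End unit_sticks.

(** * Uniform closure of the exponential polynomials on the simplex *)

Section exponential_algebra.
Context {R : realType} {X : countType}.
Implicit Types (s : seq (R * seq X)) (p : X -> R) (g h : (X -> R) -> R).

Definition exp_poly s p := \sum_(a <- s) a.1 * expR (\sum_(x <- a.2) p x).

Definition approx g := forall e, 0 < e ->
  exists s, forall p, prob_vector p -> `|g p - exp_poly s p| <= e.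

Lemma prob_vector_le1 p x : prob_vector p -> 0 <= p x <= 1.
Proof.
move=> /prob_vectorP[sm <-]; rewrite sm.1/=; exact: ler_term_rsum.
Qed.

Lemma prob_vector_sum_bound p (L : seq X) : prob_vector p ->
  0 <= \sum_(x <- L) p x <= (size L)%:R.
Proof.
move=> pp; elim: L => [|x L /andP[l0 l1]]; first by rewrite big_nil lexx.
have /andP[x0 x1] := prob_vector_le1 x pp.
by rewrite big_cons addr_ge0//= -natr1 addrC lerD.
Qed.

Lemma exp_poly_bound s : exists B, forall p, prob_vector p -> `|exp_poly s p| <= B.
Proof.
exists (\sum_(a <- s) `|a.1| * expR (size a.2)%:R) => p pp.
apply: le_trans (ler_norm_sum _ _ _) _; apply: ler_sum => a _.
rewrite normrM ler_wpM2l// ger0_norm ?expR_ge0// ler_expR.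
by case/andP: (prob_vector_sum_bound a.2 pp).
Qed.

Lemma approx_bound g : approx g -> exists B, 0 < B /\ forall p, prob_vector p -> `|g p| <= B.
Proof.
move=> /(_ 1 ltr01)[s hs]; have [B hB] := exp_poly_bound s.
exists (`|B| + 2); split; first by rewrite ltr_wpDl.
move=> p pp; rewrite -(subrK (exp_poly s p) (g p)).
apply: le_trans (ler_normD _ _) _.
have := hs p pp; have := hB p pp; have := ler_norm B; lra.
Qed.

Lemma approx_exp_poly s : approx (exp_poly s).
Proof. by move=> e e0; exists s => p _; rewrite subrr normr0 ltW. Qed.

Lemma approx_ext g h : approx g -> (forall p, prob_vector p -> g p = h p) -> approx h.
Proof. by move=> ag gh e e0; have [s hs] := ag e e0; exists s => p pp; rewrite -gh// hs. Qed.

Lemma approx_lim g : (forall e, 0 < e -> exists h, approx h /\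
  forall p, prob_vector p -> `|g p - h p| <= e) -> approx g.
Proof.
move=> hg e e0; have e2 : 0 < e / 2 by rewrite divr_gt0.
have [h [/(_ _ e2)[s hs] gh]] := hg _ e2; exists s => p pp.
have := hs p pp; have := gh p pp.
have := ler_distD (h p) (g p) (exp_poly s p); lra.
Qed.

Lemma approx_exp x : approx (fun p => expR (p x)).
Proof.
apply: (@approx_ext (exp_poly [:: (1, [:: x])])); first exact: approx_exp_poly.
by move=> p _; rewrite /exp_poly big_seq1/= mul1r big_seq1.
Qed.

Lemma approx_cst c : approx (fun=> c).
Proof.
apply: (@approx_ext (exp_poly [:: (c, [::])])); first exact: approx_exp_poly.
by move=> p _; rewrite /exp_poly big_seq1/= big_nil expR0 mulr1.
Qed.

Lemma approxD g h : approx g -> approx h -> approx (fun p => g p + h p).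
Proof.
move=> ag ah e e0; have e2 : 0 < e / 2 by rewrite divr_gt0.
have [[s hs] [t ht]] := (ag _ e2, ah _ e2); exists (s ++ t) => p pp.
rewrite /exp_poly big_cat/= -/(exp_poly s p) -/(exp_poly t p).
have := hs p pp; have := ht p pp.
have := ler_normD (g p - exp_poly s p) (h p - exp_poly t p).
rewrite (_ : g p - exp_poly s p + (h p - exp_poly t p) = g p + h p - (exp_poly s p + exp_poly t p)); last ring.
lra.
Qed.

Let exp_polyM s t p :
  exp_poly [seq (a.1 * b.1, a.2 ++ b.2) | a <- s, b <- t] p = exp_poly s p * exp_poly t p.
Proof.
rewrite /exp_poly big_allpairs_dep mulr_suml; apply: eq_bigr => a _.
rewrite mulr_sumr; apply: eq_bigr => b _ /=.
by rewrite big_cat/= expRD; ring.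
Qed.

Lemma approxM g h : approx g -> approx h -> approx (fun p => g p * h p).
Proof.
move=> ag ah e e0.
have [B [B0 hB]] := approx_bound ah.
have e1 : 0 < e / 2 / B by rewrite !divr_gt0.
have [s hs] := ag _ e1; have [C hC] := exp_poly_bound s.
have C0 : 0 < `|C| + 1 by rewrite ltr_wpDl.
have e2 : 0 < e / 2 / (`|C| + 1) by rewrite !divr_gt0.
have [t ht] := ah _ e2.
exists [seq (a.1 * b.1, a.2 ++ b.2) | a <- s, b <- t] => p pp.
rewrite exp_polyM.
rewrite (_ : _ - _ = (g p - exp_poly s p) * h p + exp_poly s p * (h p - exp_poly t p)); last ring.
apply: le_trans (ler_normD _ _) _; rewrite !normrM.
have -> : e = e / 2 / B * B + (`|C| + 1) * (e / 2 / (`|C| + 1)).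
  by rewrite divfK ?gt_eqF// [X in _ + X]mulrC divfK ?gt_eqF// -splitr.
apply: lerD; apply: ler_pM => //; [exact: hs|exact: hB| |exact: ht].
by have := hC p pp; have := ler_norm C; lra.
Qed.

Lemma approxZ c g : approx g -> approx (fun p => c * g p).
Proof. by move=> ag; apply: approxM => //; exact: approx_cst. Qed.

(** The classical polynomial iteration that increases to the absolute value on [[-1, 1]]; it yields
    closure under [max]. *)
Fixpoint abs_iter n (t : R) : R :=
  if n is m.+1 then abs_iter m t + (t ^+ 2 - abs_iter m t ^+ 2) / 2 else 0.

Lemma abs_iter_dist n t : `|t| <= 1 ->
  0 <= `|t| - abs_iter n t <= `|t| * (1 - `|t| / 2) ^+ n.
Proof.
move=> t1; have t0 := normr_ge0 t.
suff [] : 0 <= abs_iter n t /\ 0 <= `|t| - abs_iter n t <= `|t| * (1 - `|t| / 2) ^+ n by [].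
elim: n => [|n [q0 /andP[d0 d1]]] /=; first by rewrite expr0 mulr1 subr0 !lexx t0.
rewrite -(real_normK (num_real t)).
set q := abs_iter n t in q0 d0 d1 *; set a := `|t| in t1 t0 d0 d1 *.
have -> : a - (q + (a ^+ 2 - q ^+ 2) / 2) = (a - q) * (1 - (a + q) / 2) by field.
split; first by apply: addr_ge0 => //; apply: divr_ge0 => //; nra.
apply/andP; split; first by apply: mulr_ge0 => //; lra.
apply: (@le_trans _ _ ((a - q) * (1 - a / 2))).
  by rewrite ler_wpM2l//; lra.
by rewrite exprSr mulrA ler_wpM2r//; lra.
Qed.

(** Since [(n+1) q^n <= 1 + q + ... + q^n] for [q = 1 - a/2], and [a] times this sum is at most 2,
    the rate is uniform even near 0. *)
Lemma abs_iter_unif n t : `|t| <= 1 -> `| `|t| - abs_iter n t| <= 2 / n.+1%:R.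
Proof.
move=> t1; have /andP[d0 d1] := abs_iter_dist n t1.
rewrite ger0_norm//; apply: le_trans d1 _.
have t0 := normr_ge0 t; set a := `|t| in t1 t0 *.
have h : a * (n.+1%:R * (1 - a / 2) ^+ n) <= 2.
  have hs : n.+1%:R * (1 - a / 2) ^+ n <= \sum_(i < n.+1) (1 - a / 2) ^+ i.
    rewrite mulr_natl -[X in _ *+ X]card_ord -sumr_const; apply: ler_sum => i _.
    by apply: ler_wiXn2l; [lra|lra|rewrite -ltnS].
  apply: (@le_trans _ _ (a * \sum_(i < n.+1) (1 - a / 2) ^+ i)); first exact: ler_wpM2l.
  have := subrXX 1 (1 - a / 2) n.+1; rewrite expr1n.
  under eq_bigr do rewrite expr1n mul1r.
  rewrite (_ : 1 - (1 - a / 2) = a / 2); last ring.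
  move=> e; have : 0 <= (1 - a / 2) ^+ n.+1 by apply: exprn_ge0; lra.
  lra.
by rewrite ler_pdivlMr ?ltr0n// -mulrA [_ ^+ n * _]mulrC.
Qed.

Lemma approx_abs g : approx g -> approx (fun p => `|g p|).
Proof.
move=> ag; have [B [B0 hB]] := approx_bound ag.
have aB : approx (fun p => g p / B).
  by apply: (@approx_ext (fun p => B^-1 * g p)); [exact: approxZ|move=> p _; rewrite mulrC].
have aq n : approx (fun p => abs_iter n (g p / B)).
  elim: n => [|n ih] /=; first exact: approx_cst.
  apply: approxD => //.
  apply: (@approx_ext (fun p => 2^-1 * ((g p / B) * (g p / B) + (-1) * (abs_iter n (g p / B) * abs_iter n (g p / B))))).
    by apply: approxZ; apply: approxD; [exact: approxM|apply: approxZ; exact: approxM].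
  by move=> p _; rewrite mulrC -!expr2 mulN1r.
apply: (@approx_ext (fun p => B * `|g p / B|)); last first.
  by move=> p pp; rewrite normrM normfV (gtr0_norm B0) mulrC divfK ?gt_eqF.
apply: approxZ; apply: approx_lim => e e0.
have [n hn] : exists n : nat, 2 / n.+1%:R <= e.
  have e2 : 0 < e / 2 by rewrite divr_gt0.
  have [n hn] := ltr_add_invr e2.
  by exists n; move: hn; rewrite add0r => hn; rewrite mulrC -ler_pdivlMr// ltW.
exists (fun p => abs_iter n (g p / B)); split=> // p pp.
apply: le_trans hn; apply: abs_iter_unif.
by rewrite normrM normfV (gtr0_norm B0) ler_pdivrMr// mul1r hB.
Qed.

Lemma approx_max g h : approx g -> approx h -> approx (fun p => Num.max (g p) (h p)).
Proof.
move=> ag ah; apply: (@approx_ext (fun p => 2^-1 * (g p + h p + `|g p + (-1) * h p|))).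
  by apply: approxZ; apply: approxD; [exact: approxD|apply/approx_abs/approxD/approxZ].
move=> p _; rewrite mulN1r; case: (leP (g p) (h p)) => gh.
  by rewrite ler0_norm ?subr_le0//; lra.
by rewrite gtr0_norm ?subr_gt0//; lra.
Qed.

Lemma approx_sum (I : Type) (r : seq I) (g : I -> (X -> R) -> R) :
  (forall i, approx (g i)) -> approx (fun p => \sum_(i <- r) g i p).
Proof.
move=> ag; elim: r => [|i r ih].
  by under eq_fun do rewrite big_nil; exact: approx_cst.
by under eq_fun do rewrite big_cons; exact: approxD.
Qed.

End exponential_algebra.

(** * Coordinatewise neighbourhoods of a point *)

Section cylinder_neighborhoods.
Context {R : realType} {X : countType}.

(** Neighbourhoods of [p] that restrict finitely many coordinates. Convergence of this filter to [p]
    turns continuity of a test function into a statement about a finite set and a radius. *)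
Definition cylinder_filter (p : {ptws X -> R}) : set_system {ptws X -> R} :=
  [set A | exists (F : seq X) (e : R), 0 < e /\
    forall q : {ptws X -> R}, (forall x, x \in F -> `|q x - p x| < e) -> A q].

Lemma cylinder_filter_filter p : Filter (cylinder_filter p).
Proof.
split.
- by exists [::], 1; split.
- move=> A B [F [e [e0 hA]]] [F' [e' [e'0 hB]]].
  exists (F ++ F'), (Num.min e e'); split; first by rewrite lt_min e0.
  move=> q hq; split; [apply: hA|apply: hB] => x xF.
    by have := hq x; rewrite mem_cat xF lt_min => /(_ isT)/andP[].
  by have := hq x; rewrite mem_cat xF orbT lt_min => /(_ isT)/andP[].
- by move=> A B AB [F [e [e0 hA]]]; exists F, e; split=> // q hq; exact/AB/hA.
Qed.

Lemma cylinder_filter_cvg (p : {ptws X -> R}) : cylinder_filter p --> p.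
Proof.
have FF := cylinder_filter_filter p.
apply/cvg_sup => x.
apply/cvg_image => /=.
  by rewrite eqEsubset; split=> v // _; exists (cst v).
move=> W /= nW.
have [e e0 eW] : exists2 e : R, 0 < e & forall v, `|v - p x| < e -> W v.
  have /nbhs_ballP[e e0 eW] := nW; exists e => // v hv; apply: eW.
  by rewrite /ball/= distrC.
exists (@^~ x @^-1` W).
  exists [:: x], e; split=> // q hq; apply: eW; apply: hq; exact: mem_head.
rewrite eqEsubset; split=> [v [q qW <-]//|v Wv].
by exists (cst v).
Qed.

Lemma bc_test_cylinder (f : {ptws X -> R} -> R) (p : {ptws X -> R}) (e : R) :
  bc_test f -> prob_vector p -> 0 < e ->
  exists (F : seq X) (r : R), 0 < r /\ forall q : {ptws X -> R}, prob_vector q ->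
    (forall x, x \in F -> `|q x - p x| < r) -> `|f q - f p| < e.
Proof.
move=> [cf _] pp e0.
have /subspace_continuousP/(_ p pp) := cf.
move=> /cvgr_dist_lt/(_ e e0)/cylinder_filter_cvg[F [r [r0 h]]].
by exists F, r; split=> // q pq hq; rewrite distrC; apply: h.
Qed.

End cylinder_neighborhoods.

(** * Approximation of a test function from below *)

Section bumps.
Context {R : realType} {X : countType}.

(** A tent concentrated where finitely many [expR (p x)] are near rational targets. Rational data
    keep the family countable; exponentials replace the coordinates because they belong to the
    algebra. *)
Definition bump (c : rat * nat * seq (X * rat)) (p : X -> R) : R :=
  Num.max 0 (ratr c.1.1 - c.1.2%:R * \sum_(a <- c.2) `|expR (p a.1) - ratr a.2|).

Lemma approx_bump c : approx (bump c).
Proof.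
apply: approx_max; first exact: approx_cst.
apply: (@approx_ext _ _ (fun p => ratr c.1.1 + (- c.1.2%:R) * \sum_(a <- c.2) `|expR (p a.1) + ratr (- a.2)|)).
  apply: approxD; first exact: approx_cst.
  apply: approxZ; apply: approx_sum => a; apply: approx_abs; apply: approxD; last exact: approx_cst.
  exact: approx_exp.
move=> p _; rewrite mulNr; congr (_ - _ * _); apply: eq_bigr => a _.
by rewrite rmorphN.
Qed.

Variable f : {ptws X -> R} -> R.
Hypotheses (bf : bc_test f) (f0 : forall p : {ptws X -> R}, prob_vector p -> 0 <= f p).

Definition below c := forall p : {ptws X -> R}, prob_vector p -> bump c p <= f p.

Definition bump_below n (p : X -> R) : R :=
  if @choice.unpickle (rat * nat * seq (X * rat))%type n is Some c then if `[< below c >] then bump c p else 0 else 0.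

(** Running maximum over an enumeration of the bumps below [f], so that the approximation is a
    monotone sequence in the closed algebra. *)
Fixpoint max_bump n (p : X -> R) : R :=
  if n is m.+1 then Num.max (max_bump m p) (bump_below m p) else 0.

Lemma approx_max_bump n : approx (max_bump n).
Proof.
elim: n => [|n ih] /=; first exact: approx_cst.
apply: approx_max => //; rewrite /bump_below; case: choice.unpickle => [c|]; last exact: approx_cst.
by case: asboolP => _; [exact: approx_bump|exact: approx_cst].
Qed.

Lemma max_bump_le n (p : {ptws X -> R}) : prob_vector p -> 0 <= max_bump n p <= f p.
Proof.
move=> pp; elim: n => [|n /andP[m0 mf]] /=; first by rewrite lexx f0.
rewrite le_max m0/= ge_max mf/= /bump_below; case: choice.unpickle => [c|]; last exact: f0.
by case: asboolP => [cb|_]; [exact: cb|exact: f0].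
Qed.

Lemma max_bump_mono (p : X -> R) m n : (m <= n)%N -> max_bump m p <= max_bump n p.
Proof. by move=> /subnK <-; elim: (n - m)%N => //= k ih; rewrite le_max ih. Qed.

(** [expR] has slope at least 1 on nonnegative numbers, so a coordinate far from its target is
    detected by its exponential. *)
Lemma expR_dist (a b : R) : 0 <= a -> 0 <= b -> `|a - b| <= `|expR a - expR b|.
Proof.
wlog ab : a b / b <= a.
  move=> h a0 b0; case: (leP b a) => ab; first exact: h.
  by rewrite distrC [leRHS]distrC; apply: h => //; exact: ltW.
move=> a0 b0; rewrite !ger0_norm ?subr_ge0 ?ler_expR//.
rewrite -[in expR a](subrK b a) expRD.
have := expR_ge1Dx (a - b); have : 1 <= expR b by rewrite -expR0 ler_expR.
set u := expR (a - b); set v := expR b => v1 u1.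
have : 0 <= (u - 1 - (a - b)) * v by apply: mulr_ge0; lra.
have : 0 <= (a - b) * (v - 1) by apply: mulr_ge0; lra.
lra.
Qed.

Lemma bump_approaches (p : {ptws X -> R}) (e : R) : prob_vector p -> 0 < e -> e < f p ->
  exists c, below c /\ f p - e <= bump c p.
Proof.
move=> pp e0 ef.
have e2 : 0 < e / 2 by rewrite divr_gt0.
have [F [r [r0 hF]]] := bc_test_cylinder bf pp (divr_gt0 e2 (ltr0Sn _ 1)).
(* The height [q] lies below [f] near [p], where [f] moves by less than [e / 4], and within [e / 2]
   of [f p]. *)
have qlt : f p - e / 2 < f p - e / 4 by lra.
have [q] := rat_in_itvoo qlt.
rewrite in_itv/= => /andP[q1 q2].
have fp0 := f0 pp.
(* The slope: once a coordinate in [F] is off by [r], the sum is at least [r / 2] and the bump has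
   dropped to 0. *)
pose k := Num.bound (f p / (r / 2)).
have hk : f p <= k%:R * (r / 2).
  by rewrite -ler_pdivrMr ?divr_gt0// ltW// archi_boundP// divr_ge0// ltW// divr_gt0.
pose C : R := k%:R * (size F)%:R + 1.
have C0 : 0 < C by rewrite ltr_wpDl// mulr_ge0.
(* The bound [r / 2] leaves room for the rational targets in that argument; the other bound makes
   the loss at [p] itself at most [e / 2]. *)
pose eta : R := Num.min (r / 2) (e / 2 / C).
have eta0 : 0 < eta by rewrite lt_min !divr_gt0.
have etar : eta <= r / 2 by rewrite ge_min lexx.
have etaC : C * eta <= e / 2 by rewrite mulrC -ler_pdivlMr// ge_min lexx orbT.
have hq x : exists qx : rat, `|expR (p x) - ratr qx| < eta.
  have h : expR (p x) - eta < expR (p x) + eta by lra.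
  have [qx] := rat_in_itvoo h; rewrite in_itv/= => /andP[h1 h2]; exists qx.
  by rewrite ltr_norml; lra.
have [Q hQ] := choice hq.
have sum_ge0 (p' : X -> R) : 0 <= \sum_(x <- F) `|expR (p' x) - ratr (Q x)| by apply: sumr_ge0.
exists (q, k, [seq (x, Q x) | x <- F]); split.
  move=> p' pp'; rewrite /bump/= ge_max f0//= big_map/=.
  have [hp'|/existsNP[x]] := pselect (forall x, x \in F -> `|p' x - p x| < r).
    have := hF _ pp' hp'; rewrite ltr_norml => /andP[h1 h2].
    have := mulr_ge0 (ler0n R k) (sum_ge0 p'); lra.
  move=> /not_implyP[xF /negP]; rewrite -leNgt => hx.
  have d1 : r / 2 <= `|expR (p' x) - ratr (Q x)|.
    have := expR_dist (proj1 (andP (prob_vector_le1 x pp'))) (proj1 (andP (prob_vector_le1 x pp))).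
    have := ler_distD (ratr (Q x)) (expR (p' x)) (expR (p x)).
    rewrite [ `|ratr (Q x) - _|]distrC; have := hQ x; lra.
  have d2 : r / 2 <= \sum_(z <- F) `|expR (p' z) - ratr (Q z)|.
    apply: le_trans d1 _; rewrite (big_rem x)//= lerDl; exact: sumr_ge0.
  have := ler_wpM2l (ler0n R k) d2; have := f0 pp'; lra.
rewrite /bump/= le_max big_map/=; apply/orP; right.
have d : \sum_(x <- F) `|expR (p x) - ratr (Q x)| <= (size F)%:R * eta.
  rewrite mulr_natl; elim: (F) => [|x F' ih]; first by rewrite big_nil.
  by rewrite big_cons/= mulrS lerD// ltW.
have := ler_wpM2l (ler0n R k) d; rewrite mulrA.
move: etaC; rewrite /C mulrDl mul1r; lra.
Qed.

Lemma max_bump_cvg (p : {ptws X -> R}) : prob_vector p -> max_bump ^~ p @ \oo --> f p.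
Proof.
move=> pp; apply/cvgrPdist_le => e e0.
have [fe|ef] := leP (f p) e.
  apply: nearW => n; have /andP[m0 mf] := max_bump_le n pp.
  by rewrite ger0_norm ?subr_ge0//; lra.
have [c [cb hc]] := bump_approaches pp e0 ef.
have [m bm] : exists m, bump_below m p = bump c p.
  by exists (choice.pickle c); rewrite /bump_below choice.pickleK asboolT.
exists m.+1 => // n hn; have /andP[m0 mf] := max_bump_le n pp.
rewrite ger0_norm ?subr_ge0// lerBlDr -lerBlDl; apply: le_trans hc _.
by apply: le_trans (max_bump_mono p hn); rewrite /= bm le_max lexx orbT.
Qed.

End bumps.

(** * Integrals of functions that agree on a full set *)

Section almost_everywhere_equal.
Context {d : measure_display} {T : measurableType d} {R : realType}.
Variable P : probability T R.

Let nnint (f : T -> \bar R) := ereal_sup [set sintegral P h |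
  h in [set h : {nnsfun T >-> R} | forall x, ((h x)%:E <= f x)%E]].

Let nnint_le (A : set T) (f g : T -> \bar R) : measurable A -> P (~` A) = 0%E ->
  (forall x, 0 <= g x)%E -> (forall x, A x -> f x = g x) -> (nnint f <= nnint g)%E.
Proof.
move=> mA PA g0 fg; apply: ge_ereal_sup => /= _ [h /= hf <-].
(* Restricted to [A], the simple function [h] lies below [g] and keeps its integral, as the
   complement of [A] is null. *)
apply: (@le_trans _ _ (sintegral P (proj_nnsfun h mA))); last first.
  apply: ereal_sup_ubound; exists (proj_nnsfun h mA) => //= x.
  rewrite mindicE; have [xA|xA] := boolP (x \in A).
    by rewrite mulr1 -fg; [exact: hf|exact/set_mem].
  by rewrite mulr0.
rewrite -!integralT_nnsfun le_eqVlt; apply/orP; left; apply/eqP.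
apply: ae_eq_integral => //; try exact/measurable_EFinP.
exists (~` A); split=> //; first exact: measurableC.
move=> x /= hx Ax; apply: hx => _ /=.
by rewrite mindicE mem_set// mulr1.
Qed.

(* No measurability of [f] or [g] is assumed: the integral is defined through
   simple functions below the positive and negative parts. *)
Lemma integral_eq_on_full (A : set T) (f g : T -> R) : measurable A -> P (~` A) = 0%E ->
  (forall x, A x -> f x = g x) -> (\int[P]_x (f x)%:E = \int[P]_x (g x)%:E)%E.
Proof.
move=> mA PA fg; rewrite /integral -!/(nnint _).
have eqn (f' g' : T -> \bar R) : (forall x, 0 <= f' x)%E -> (forall x, 0 <= g' x)%E ->
    (forall x, A x -> f' x = g' x) -> nnint f' = nnint g'.
  move=> f0 g0 fg'; apply/eqP; rewrite eq_le (nnint_le mA PA g0 fg') (nnint_le mA PA f0)//.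
  by move=> x Ax; rewrite fg'.
by congr (_ - _)%E; apply: eqn => // x Ax; rewrite !patch_setT ?funeposE ?funenegE fg.
Qed.

End almost_everywhere_equal.

(** * Convergence in law from convergence of moments *)

Section weak_convergence.
Context {R : realType} {X : countType} {d d0 : measure_display}.
Context {Omega : measurableType d} {Omega0 : measurableType d0}.
Variables (P : probability Omega R) (P0 : probability Omega0 R).
Variables (V : nat -> Omega -> {ptws X -> R}) (W : Omega0 -> {ptws X -> R}).
Hypotheses (pV : forall n w, prob_vector (V n w)) (pW : forall w, prob_vector (W w)).
Hypotheses (mV : forall n x, measurable_fun [set: Omega] (fun w => V n w x)).
Hypothesis mW : forall x, measurable_fun [set: Omega0] (fun w => W w x).
Hypothesis cvg_moments : forall (L : seq X) k,
  (fun n => Ex P (fun w => (\sum_(x <- L) V n w x) ^+ k)) @ \oo -->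
  Ex P0 (fun w => (\sum_(x <- L) W w x) ^+ k).

(** Measurability after composition is part of the property: for a test function it is obtained only
    at the end, as a limit of bumps. *)
Let cvgE (g : (X -> R) -> R) := [/\ forall n, bmf (fun w => g (V n w)), bmf (fun w => g (W w)) &
  (fun n => Ex P (fun w => g (V n w))) @ \oo --> Ex P0 (fun w => g (W w))].

Let bmf_coord d' (T : measurableType d') (U : T -> X -> R) x :
  (forall w, prob_vector (U w)) -> measurable_fun [set: T] (U ^~ x) -> bmf (U ^~ x).
Proof.
move=> pU mU; split=> //; exists 1 => w.
by have /andP[u0 u1] := prob_vector_le1 x (pU w); rewrite ger0_norm.
Qed.

Let cvgE_lim g : (forall e, 0 < e -> exists h, cvgE h /\
  forall p, prob_vector p -> `|g p - h p| <= e) -> cvgE g.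
Proof.
move=> hg.
have e0 k : 0 < (k.+1%:R : R)^-1 by rewrite invr_gt0.
have [h hh] := choice (fun k => hg _ (e0 k)).
have bU d' (T : measurableType d') (Q : probability T R) (U : T -> X -> R) :
    (forall w, prob_vector (U w)) -> (forall k, bmf (fun w => h k (U w))) -> bmf (fun w => g (U w)).
  move=> pU bh; have [_ [B hB]] := bh 0%N.
  apply: (@bmf_cvg _ _ _ Q (fun k w => h k (U w)) _ (B + 2) bh _ _).1 => [k w|w].
    have := (hh k).2 _ (pU w); have := (hh 0%N).2 _ (pU w); have := hB w.
    have i1 : (k.+1%:R : R)^-1 <= 1 by rewrite invf_le1// ler1n.
    rewrite invr1; have := ler_distD (g (U w)) (h k (U w)) (h 0%N (U w)).
    rewrite [ `|h k _ - g _|]distrC.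
    have := ler_normD (h k (U w) - h 0%N (U w)) (h 0%N (U w)); rewrite subrK.
    move=> ? ? ? ? /le_trans/(_ i1) ?; lra.
  apply/cvgrPdist_le => e e0'.
  have [N hN] := ltr_add_invr e0'; rewrite add0r in hN.
  exists N => // k /= Nk; apply: le_trans ((hh k).2 _ (pU w)) _; apply: le_trans (ltW hN).
  by rewrite lef_pV2 ?posrE// ler_nat.
have bV n : bmf (fun w => g (V n w)).
  by apply: (bU _ _ P) => // k; have [] := (hh k).1.
have bW : bmf (fun w => g (W w)) by apply: (bU _ _ P0) => // k; have [] := (hh k).1.
split=> //; apply/cvgrPdist_le => e e1.
have e3 : 0 < e / 3 by rewrite divr_gt0.
have [h' [[bhV bhW ch] hd]] := hg _ e3.
move/cvgrPdist_le/(_ _ e3) : ch; apply: filterS => n /= hn.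
have d1 : `|Ex P (fun w => g (V n w)) - Ex P (fun w => h' (V n w))| <= e / 3.
  by apply: Ex_dist => // w; exact: hd.
have d2 : `|Ex P0 (fun w => g (W w)) - Ex P0 (fun w => h' (W w))| <= e / 3.
  by apply: Ex_dist => // w; exact: hd.
move: hn d1 d2; rewrite !ler_norml => /andP[? ?] /andP[? ?] /andP[? ?]; apply/andP; split; lra.
Qed.

Let cvgED g h : cvgE g -> cvgE h -> cvgE (fun p => g p + h p).
Proof.
move=> [bg bg' cg] [bh bh' ch]; split=> [n||]; try exact: bmfD.
rewrite ExD//; under eq_fun do rewrite ExD//.
exact: cvgD.
Qed.

Let cvgEZ c g : cvgE g -> cvgE (fun p => c * g p).
Proof.
move=> [bg bg' cg]; split=> [n||]; try exact: bmfZ.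
rewrite ExZ//; under eq_fun do rewrite ExZ//.
exact: cvgMr.
Qed.

Let cvgE_cst c : cvgE (fun=> c).
Proof.
split=> [n||]; try exact: bmf_cst.
by rewrite !Ex_cst; exact: cvg_cst.
Qed.

Let cvgE_sum (I : Type) (r : seq I) (g : I -> (X -> R) -> R) :
  (forall i, cvgE (g i)) -> cvgE (fun p => \sum_(i <- r) g i p).
Proof.
move=> ag; elim: r => [|i r ih].
  by under eq_fun do rewrite big_nil; exact: cvgE_cst.
by under eq_fun do rewrite big_cons; exact: cvgED.
Qed.

Let cvgE_power (L : seq X) k : cvgE (fun p => (\sum_(x <- L) p x) ^+ k).
Proof.
split=> [n||]; last exact: cvg_moments.
- by apply: bmfX; apply: bmf_sum => x; apply: bmf_coord.
- by apply: bmfX; apply: bmf_sum => x; apply: bmf_coord.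
Qed.

(** The coefficients are nonnegative, so the remainder grows with the argument and the truncation is
    uniform on [[0, B]]. *)
Let exp_tail (B x : R) m : 0 <= x <= B ->
  `|expR x - series (exp_coeff x) m| <= expR B - series (exp_coeff B) m.
Proof.
move=> /andP[x0 xB].
have cx := is_cvg_series_exp_coeff x; have cB := is_cvg_series_exp_coeff B.
have mono : forall n, (m <= n)%N ->
    `|series (exp_coeff x) n - series (exp_coeff x) m| <= series (exp_coeff B) n - series (exp_coeff B) m.
  move=> n mn; rewrite !sub_series_geq// ger0_norm.
    by apply: ler_sum => i _; rewrite /exp_coeff/= ler_wpM2r ?invr_ge0// lerXn2r ?nnegrE//; exact: le_trans xB.
  by apply: sumr_ge0 => i _; exact: exp_coeff_ge0.
have c1 : (fun n => `|series (exp_coeff x) n - series (exp_coeff x) m|) @ \oo --> `|expR x - series (exp_coeff x) m|.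
  by apply: cvg_norm; apply: cvgB; [exact: cx|exact: cvg_cst].
have c2 : (fun n => series (exp_coeff B) n - series (exp_coeff B) m) @ \oo --> expR B - series (exp_coeff B) m.
  by apply: cvgB; [exact: cB|exact: cvg_cst].
rewrite -(cvg_lim _ c1)// -(cvg_lim _ c2)//.
apply: ler_lim; [exact: cvgP c1|exact: cvgP c2|].
by exists m => // n /= mn; exact: mono.
Qed.

Let cvgE_exp (L : seq X) : cvgE (fun p => expR (\sum_(x <- L) p x)).
Proof.
apply: cvgE_lim => e e0.
have /cvgrPdist_le/(_ e e0)[m _ /(_ m (leqnn m)) hm] := is_cvg_series_exp_coeff ((size L)%:R : R).
exists (fun p => \sum_(0 <= i < m) (i`!%:R^-1 * (\sum_(x <- L) p x) ^+ i)); split.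
  by apply: cvgE_sum => i; apply: cvgEZ; exact: cvgE_power.
move=> p pp; apply: le_trans (le_trans (ler_norm _) hm).
rewrite (_ : \sum_(0 <= i < m) _ = series (exp_coeff (\sum_(x <- L) p x)) m).
  exact: exp_tail (prob_vector_sum_bound L pp).
by apply: eq_bigr => i _; rewrite mulrC.
Qed.

Let cvgE_approx g : approx g -> cvgE g.
Proof.
move=> ag; apply: cvgE_lim => e e0; have [s hs] := ag e e0.
exists (exp_poly s); split=> //.
by apply: cvgE_sum => a; apply: cvgEZ; exact: cvgE_exp.
Qed.

Section lower_semicontinuity.
Variable f : {ptws X -> R} -> R.
Hypotheses (bf : bc_test f) (f0 : forall p : {ptws X -> R}, prob_vector p -> 0 <= f p).

Let bmf_test d' (T : measurableType d') (Q : probability T R) (U : T -> {ptws X -> R}) :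
  (forall w, prob_vector (U w)) -> (forall n, bmf (fun w => max_bump f n (U w))) ->
  bmf (fun w => f (U w)) /\
  (fun n => Ex Q (fun w => max_bump f n (U w))) @ \oo --> Ex Q (fun w => f (U w)).
Proof.
move=> pU bU; have [_ [C hC]] := bf.
apply: (@bmf_cvg _ _ _ Q (fun n w => max_bump f n (U w)) _ C) => // [n w|w].
  have /andP[m0 m1] := max_bump_le f0 n (pU w).
  rewrite ger0_norm//; apply: le_trans m1 _; exact: le_trans (ler_norm _) (hC _ (pU w)).
exact: max_bump_cvg.
Qed.

Let bump_cvg n : cvgE (max_bump f n).
Proof. exact/cvgE_approx/approx_max_bump. Qed.

Lemma bmf_test_law : (forall n, bmf (fun w => f (V n w))) /\ bmf (fun w => f (W w)).
Proof.
split=> [n|].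
  by apply: (bmf_test P _ _).1 => // k; have [] := bump_cvg k.
by apply: (bmf_test P0 _ _).1 => // k; have [] := bump_cvg k.
Qed.

(** Half of a portmanteau theorem: some [max_bump f k] is within [e / 2] of [f] in expectation under
    the limit, and it lies below [f] along every [V n]. *)
Lemma Ex_test_liminf (e : R) : 0 < e ->
  \forall n \near \oo, Ex P0 (fun w => f (W w)) - e <= Ex P (fun w => f (V n w)).
Proof.
move=> e0; have e2 : 0 < e / 2 by rewrite divr_gt0.
have [bV bW] := bmf_test_law.
have [_ c] := bmf_test P0 pW (fun k => let: And3 _ h _ := bump_cvg k in h).
have /cvgrPdist_le/(_ _ e2)[k _ /(_ k (leqnn k)) hk] := c.
have [bkV bkW ck] := bump_cvg k.
have /cvgrPdist_le/(_ _ e2) := ck; apply: filterS => n /= hn.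
have : Ex P (fun w => max_bump f k (V n w)) <= Ex P (fun w => f (V n w)).
  by apply: le_Ex => // w; case/andP: (max_bump_le f0 k (pV n w)).
by move: hk hn; rewrite !ler_norml => /andP[? ?] /andP[? ?] ?; lra.
Qed.

End lower_semicontinuity.

Lemma cvg_in_law_moments (f : {ptws X -> R} -> R) : bc_test f ->
  (fun n => \int[P]_w (f (V n w))%:E)%E @ \oo --> (\int[P0]_w (f (W w))%:E)%E.
Proof.
move=> bf; have [cf [C hC]] := bf.
(* The lower bound will be applied to [C + f] and [C - f], both nonnegative on the simplex. *)
have sub (D : R) (s : bool) : bc_test (fun p => D + (-1) ^+ s * f p).
  split.
    move=> p; apply: cvgD; first exact: cvg_cst.
    by apply: cvgMr; exact: cf.
  exists (`|D| + C) => p pp; apply: le_trans (ler_normD _ _) _.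
  by rewrite lerD2l normrMsign hC.
have nn (s : bool) p : prob_vector p -> 0 <= C + (-1) ^+ s * f p.
  move=> pp; have := hC p pp; rewrite -(normrMsign s) ler_norml => /andP[h _].
  by rewrite -lerBlDl sub0r.
have [bV bW] := bmf_test_law (sub C false) (nn false).
have fE p : f p = C + (-1) ^+ false * f p - C by rewrite expr0 mul1r addrC addKr.
have bfV n : bmf (fun w => f (V n w)).
  by under eq_fun do rewrite fE; apply: bmfB => //; exact: bmf_cst.
have bfW : bmf (fun w => f (W w)).
  by under eq_fun do rewrite fE; apply: bmfB => //; exact: bmf_cst.
rewrite ExE//; under eq_fun do rewrite ExE//.
apply: cvg_EFin; first exact: nearW.
have ExS d' (T : measurableType d') (Q : probability T R) (g : T -> R) (s : bool) : bmf g ->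
    Ex Q (fun w => C + (-1) ^+ s * g w) = C + (-1) ^+ s * Ex Q g.
  by move=> bg; rewrite ExD ?Ex_cst ?ExZ//; [exact: bmf_cst|exact: bmfZ].
apply/cvgrPdist_le => e e0.
have := Ex_test_liminf (sub C false) (nn false) e0.
apply: filterS2 (Ex_test_liminf (sub C true) (nn true) e0) => n.
rewrite !(ExS _ _ _ _ true)// !(ExS _ _ _ _ false)// !expr0 !expr1 !mul1r !mulN1r => h1 h2.
by rewrite /= ler_norml; apply/andP; split; lra.
Qed.

End weak_convergence.

Lemma measurable_preimageT d d' (T : measurableType d) (T' : measurableType d') (A : set T') (f : T -> T') :
  measurable_fun [set: T] f -> measurable A -> measurable (f @^-1` A).
Proof. by move=> mf mA; rewrite -[X in measurable X]setTI; apply: mf. Qed.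

Lemma measurable_lt_set {R : realType} (r : R) : measurable ([set t : R | t < r] : set (measurableTypeR R)).
Proof.
rewrite (_ : [set t | _] = `]-oo, r[%classic); first exact: measurable_itv.
by apply/seteqP; split=> t /=; rewrite in_itv.
Qed.

(** * The uniform law on the unit interval *)

Section uniform_law.
Context {R : realType}.

Definition unif : probability (measurableTypeR R) R := uniform_prob (@ltr01 R).

Lemma unif_lt (s : R) : unif [set t | t < s] = (clip01 s)%:E.
Proof.
rewrite /unif/= /uniform_prob integral_uniform_pdf.
have e : [set t : R | t < s] `&` `[0, 1] = [set` Interval (BLeft 0) (if s <= 1 then BLeft s else BRight 1)].
  apply/seteqP; split=> t /=; rewrite !in_itv/=; case: ifPn => s1 /=.
  - by move=> [ts /andP[-> _]].
  - by move=> [ts /andP[-> ->]].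
  - by move=> /andP[t0 ts]; rewrite t0 ts (le_trans (ltW ts) s1).
  - by move=> /andP[t0 t1]; rewrite t0 t1; split=> //; apply: le_lt_trans t1 _; rewrite ltNge.
rewrite e (eq_integral (fun=> 1%E)); last first.
  move=> t; rewrite inE -e => -[_ /=]; rewrite in_itv/= /uniform_pdf => ->.
  by rewrite subr0 invr1.
rewrite integral_cst; last by case: ifP => _; exact: measurable_itv.
rewrite mul1e /clip01 /=; case: ifPn => s1; rewrite lebesgue_measure_itv/= lte_fin; case: ifPn => s0.
- by rewrite -EFinD subr0 (max_idPr (ltW s0)) (min_idPr s1).
- by move: s0; rewrite -leNgt => s0; rewrite (max_idPl s0) (min_idPr ler01).
- by move: s1; rewrite -ltNge => /ltW s1; rewrite -EFinD subr0 min_l// le_max s1 orbT.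
- by rewrite ltr01 in s0.
Qed.

(** Half-lines form a pi-system generating the Borel sets. The event [A] is carried along so that
    the lemma also yields independence. *)
Lemma unif_borel d (T : measurableType d) (P : probability T R) (A : set T) (f : T -> measurableTypeR R) (c : R) :
  0 <= c -> measurable A -> measurable_fun [set: T] f ->
  (forall s, P (A `&` f @^-1` [set t | t < s]) = (c * clip01 s)%:E) ->
  forall C, measurable C -> P (A `&` f @^-1` C) = (c%:E * unif C)%E.
Proof.
move=> c0 mA mf h C mC.
pose m1 : {measure set (measurableTypeR R) -> \bar R} := pushforward (mrestr P mA) f.
pose m2 : {measure set (measurableTypeR R) -> \bar R} := mscale (NngNum c0) unif.
have e : m1 mf C = m2 C.
  pose g k : set (measurableTypeR R) := [set t : R | t < k%:R].
  have := @measure_unique _ _ (measurableTypeR R) (@RGenInftyO.G R) g _ _ _ _ (m1 mf) m2 _ _ C mC.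
  apply.
  - exact: RGenInftyO.measurableE.
  - move=> _ _ [x ->] [y ->]; exists (Num.min x y).
    by apply/seteqP; split=> t /=; rewrite !in_itv/= lt_min => /andP.
  - by move=> k; exists k%:R; apply/seteqP; split=> t /=; rewrite in_itv.
  - by apply/seteqP; split=> // t _; exists (Num.truncn t).+1 => //=; exact: truncnS_gt.
  - move=> _ [x ->]; rewrite (_ : `]-oo, x[%classic = [set t | t < x]); last first.
      by apply/seteqP; split=> t /=; rewrite in_itv.
    by rewrite /m1/= /pushforward/= /mrestr setIC h EFinM -unif_lt.
  - by move=> k; rewrite /m1/= /pushforward/= /mrestr setIC h ltry.
by rewrite setIC.
Qed.

End uniform_law.

(** * Binary digits: the first digit and the doubling map *)

Section interleaving.
Context {R : realType}.
Local Notation U := (@unif R).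

Definition bit (t : measurableTypeR R) : R := (1 / 2 <= t)%R%:R.
Definition dbl (t : measurableTypeR R) : measurableTypeR R := 2 * t - bit t.

Lemma measurable_bit : measurable_fun [set: measurableTypeR R] bit.
Proof.
rewrite (_ : bit = \1_([set t | 1 / 2 <= t])); last first.
  apply/funext => t; rewrite indicE /bit; congr (nat_of_bool _)%:R.
  by apply/idP/idP => [h|/set_mem//]; exact/mem_set.
apply: measurable_indic; rewrite (_ : [set t | _] = `[1 / 2, +oo[%classic).
  exact: measurable_itv.
by apply/seteqP; split=> t /=; rewrite in_itv/= andbT.
Qed.

Lemma measurable_dbl : measurable_fun [set: measurableTypeR R] dbl.
Proof. by apply: measurable_funB; [exact: measurable_funM|exact: measurable_bit]. Qed.

Lemma bit_bool t : bit t = 0 \/ bit t = 1.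
Proof. by rewrite /bit; case: (_ <= _); [right|left]. Qed.

Let mbit i : measurable (bit @^-1` [set i]).
Proof. by rewrite -[X in measurable X]setTI; apply: measurable_bit. Qed.

Lemma clip01_le0 (s : R) : s <= 0 -> clip01 s = 0.
Proof. by move=> s0; rewrite /clip01 max_l ?min_r. Qed.

Lemma clip01_ge1 (s : R) : 1 <= s -> clip01 s = 1.
Proof. by move=> s1; rewrite /clip01 min_l// le_max s1 orbT. Qed.

Lemma clip01_half (s : R) : s <= 1 / 2 -> clip01 s = 1 / 2 * clip01 (2 * s).
Proof.
move=> s2; rewrite /clip01; have [s0|s0] := leP s 0.
  by rewrite !max_l ?min_r ?mulr0//; lra.
by rewrite !max_r ?min_r//; lra.
Qed.

Lemma clip01_half2 (s : R) : 1 / 2 <= s -> clip01 s = 1 / 2 + 1 / 2 * clip01 (2 * s - 1).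
Proof.
move=> s2; rewrite /clip01 !max_r; [|lra..].
have [s1|s1] := leP s 1; first by rewrite !min_r; [lra..].
by rewrite !min_l; [lra..].
Qed.

(** Each half of the unit interval is mapped affinely onto the whole, so given the first digit the
    doubled number is again uniform. *)
Lemma unif_bit_dbl (i : R) C : i = 0 \/ i = 1 -> measurable C ->
  U (bit @^-1` [set i] `&` dbl @^-1` C) = ((1 / 2)%:E * U C)%E.
Proof.
move=> hi mC; apply: unif_borel => // [|s]; first exact: measurable_dbl.
have ltE (t : R) : t < 1 / 2 = ~~ (1 / 2 <= t) by rewrite ltNge.
have [->|->] := hi.
  have -> : bit @^-1` [set 0] `&` dbl @^-1` [set t | t < s] = [set t : R | t < Num.min (1 / 2) (s / 2)].
    apply/seteqP; split=> t /=; rewrite /dbl lt_min ltE.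
      by move=> [b0 ht]; move: b0 ht; rewrite /bit; case: (_ <= _) => /= [/eqP|_]; rewrite ?oner_eq0//; lra.
    by rewrite /bit => /andP[/negbTE -> ht]; split=> //=; lra.
  rewrite unif_lt; congr (_%:E); have [s1|s1] := leP s 1.
    rewrite min_r; last lra.
    by rewrite clip01_half; [congr (_ * clip01 _); lra|lra].
  rewrite min_l; last lra.
  by rewrite [LHS]clip01_id ?[clip01 s]clip01_ge1; lra.
(* For negative [s] the event is empty, and the two half-lines subtracted below would be nested the
   wrong way. *)
have [s0|s0] := ltP s 0.
  have -> : bit @^-1` [set 1] `&` dbl @^-1` [set t | t < s] = set0.
    apply/seteqP; split=> t //=; rewrite /dbl => -[b1]; rewrite b1 => ht.
    by move: b1; rewrite /bit; case: (leP (1 / 2) t) => h /= /esym/eqP; rewrite ?oner_eq0//; lra.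
  by rewrite measure0 clip01_le0 ?mulr0 // ltW.
have -> : bit @^-1` [set 1] `&` dbl @^-1` [set t | t < s] =
    [set t : R | t < (s + 1) / 2] `\` [set t : R | t < 1 / 2].
  apply/seteqP; split=> t /=; rewrite /dbl.
    move=> [b1]; rewrite b1 => ht; split; first lra.
    by move: b1; rewrite /bit leNgt; case: (t < 1 / 2) => //= /esym/eqP; rewrite oner_eq0.
  by move=> [ht /negP]; rewrite -leNgt => h; rewrite /bit h; split=> //=; lra.
transitivity (U [set t : R | (t < (s + 1) / 2)%R] - U [set t : R | (t < 1 / 2)%R])%E.
  rewrite measureD; [|exact: measurable_lt_set|exact: measurable_lt_set|].
    by rewrite setIC setIidl// => t /= h; lra.
  by rewrite ltey_eq fin_num_measure//; exact: measurable_lt_set.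
rewrite !unif_lt -EFinB; congr (_%:E).
rewrite [in LHS]clip01_half2; last lra.
rewrite (_ : 2 * ((s + 1) / 2) - 1 = s); last lra.
by rewrite [clip01 (1 / 2)]clip01_id; lra.
Qed.

Lemma unif_dbl C : measurable C -> U (dbl @^-1` C) = U C.
Proof.
move=> mC.
have mD : measurable (dbl @^-1` C) by rewrite -[X in measurable X]setTI; apply: measurable_dbl.
rewrite -[X in U X]setTI (_ : setT = bit @^-1` [set 0] `|` bit @^-1` [set 1]).
  transitivity (U (bit @^-1` [set 0%R] `&` dbl @^-1` C) + U (bit @^-1` [set 1%R] `&` dbl @^-1` C))%E.
    rewrite setIUl measureU//; try exact: measurableI.
    by apply/seteqP; split=> t //= [[-> _] [/esym/eqP]]; rewrite oner_eq0.
  rewrite !unif_bit_dbl; [|by right|by []|by left|by []].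
  by rewrite -ge0_muleDl ?lee_fin -?EFinD -?splitr ?mul1e.
apply/seteqP; split=> // t _; exact: bit_bool.
Qed.

End interleaving.

(** * Independence of the even and the odd digits *)

Section even_digits.
Context {R : realType}.
Local Notation I := (measurableTypeR R).
Local Notation U := (@unif R).

Let dd (t : I) : I := dbl (dbl t).
Let dsum n (t : I) : R := \sum_(k < n) bit (iter k dd t) / 2 ^+ k.+1.

Let dsumS n t : dsum n.+1 t = (bit t + dsum n (dd t)) / 2.
Proof.
rewrite /dsum big_ord_recl/= expr1 mulrDl mulr_suml; congr (_ + _).
by apply: eq_bigr => k _; rewrite -iterS iterSr -mulrA -invfM -exprSr.
Qed.

Let bit01 (t : I) : 0 <= bit t <= 1.
Proof. by case: (bit_bool t) => ->; rewrite ?lexx ?ler01. Qed.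

Let dsum01 n t : 0 <= dsum n t <= 1.
Proof.
elim: n t => [|n ih] t; first by rewrite /dsum big_ord0 lexx ler01.
rewrite dsumS; have := ih (dd t); have := bit01 t; lra.
Qed.

(* The real number whose binary digits are the even-indexed digits of [t]. *)
Definition even_digits (t : I) : I := lim ((dsum ^~ t) @ \oo).

Let dsum_cvg t : (dsum ^~ t) @ \oo --> (even_digits t : R).
Proof.
apply: nondecreasing_is_cvgn.
  apply/nondecreasing_seqP => n; rewrite /dsum big_ord_recr/= lerDl divr_ge0//.
by exists 1 => _ [n _ <-]; case/andP: (dsum01 n t).
Qed.

Lemma even_digitsE t : even_digits t = (bit t + even_digits (dbl (dbl t))) / 2.
Proof.
have h : (fun n => dsum n.+1 t) @ \oo --> ((bit t + even_digits (dd t)) / 2 : R).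
  under eq_fun do rewrite dsumS.
  by apply: cvgMl; apply: cvgD; [exact: cvg_cst|exact: dsum_cvg].
have h' : (fun n => dsum n.+1 t) @ \oo --> (even_digits t : R).
  by rewrite (@cvg_shiftS _ (dsum ^~ t)); exact: dsum_cvg.
by rewrite -[LHS](cvg_lim _ h')// (cvg_lim _ h).
Qed.

Lemma even_digits01 t : 0 <= even_digits t <= 1.
Proof.
have c : cvg ((dsum ^~ t) @ \oo) by apply/cvg_ex; exists (even_digits t); exact: dsum_cvg.
apply/andP; split; [apply: limr_ge|apply: limr_le] => //; apply: nearW => n;
  by case/andP: (dsum01 n t).
Qed.

Lemma measurable_even_digits : measurable_fun [set: I] even_digits.
Proof.
have mdd k : measurable_fun [set: I] (iter k dd).
  elim: k => [|k ih]; first exact: measurable_id.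
  apply: (measurableT_comp _ ih); exact: (measurableT_comp measurable_dbl measurable_dbl).
have bd n : bmf (dsum n).
  apply: bmf_sum => k; split.
    by apply: measurable_funM => //; exact: (measurableT_comp measurable_bit (mdd k)).
  exists 1 => t; rewrite normrM ger0_norm//.
  rewrite normfV ger0_norm ?exprn_ge0// ler_pdivrMr ?exprn_gt0// mul1r.
  apply: le_trans (_ : 1 <= _); first by case/andP: (bit01 (iter k dd t)).
  by rewrite exprn_ege1// ler1n.
apply: (@bmf_cvg _ _ _ U dsum even_digits 1 bd _ _).1.1 => [n t|t]; last exact: dsum_cvg.
by have := dsum01 n t => /andP[? ?]; rewrite ger0_norm.
Qed.

Local Notation s := even_digits.

Let half (i : R) (x : I) : I := (i + x) / 2.

Let mhalf i : measurable_fun [set: I] (half i).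
Proof. by apply: measurable_funM => //; apply: measurable_funD. Qed.

(* Conditioning on the first digit turns an event about [even_digits t] into one about [dbl t]. *)
Let split_bit (A B : set I) : measurable A -> measurable B ->
  fine (U (s @^-1` A `&` (s \o dbl) @^-1` B)) =
  1 / 2 * (fine (U (s @^-1` B `&` (s \o dbl) @^-1` (half 0 @^-1` A))) +
           fine (U (s @^-1` B `&` (s \o dbl) @^-1` (half 1 @^-1` A)))).
Proof.
move=> mA mB.
have ms := measurable_even_digits; have mD := @measurable_dbl R.
have msd := measurableT_comp ms mD.
pose E i := s @^-1` B `&` (s \o dbl) @^-1` (half i @^-1` A).
have mE i : measurable (E i).
  by apply: measurableI; apply: measurable_preimageT => //; apply: measurable_preimageT.
have mbit i : measurable (bit @^-1` [set i] : set I).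
  by rewrite -[X in measurable X]setTI; apply: measurable_bit.
pose F i := bit @^-1` [set i] `&` dbl @^-1` (E i).
have mF i : measurable (F i) by apply: measurableI => //; apply: measurable_preimageT.
have -> : s @^-1` A `&` (s \o dbl) @^-1` B = F 0 `|` F 1.
  apply/seteqP; split=> t; rewrite /F /E /half /=.
    move=> [sA sB]; case: (bit_bool t) => b; [left|right]; split=> //; split=> //=;
      by rewrite even_digitsE b in sA.
  by case=> -[b [h1 h2]]; split=> //; rewrite even_digitsE b.
transitivity (fine (U (F 0%R) + U (F 1%R))%E).
  rewrite measureU//.
  by apply/seteqP; split=> t //; rewrite /F /= => -[[b0 _] [b1 _]]; move: b1; rewrite b0 => /esym/eqP; rewrite oner_eq0.
rewrite /F !unif_bit_dbl//; [|by right|by left].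
by rewrite fineD ?fin_numM ?fin_num_measure// !fineM ?fin_num_measure// -mulrDr.
Qed.

Let v (B : set I) : R := fine (U (s @^-1` B)).
Let p (A B : set I) : R := fine (U (s @^-1` A `&` (s \o dbl) @^-1` B)).

Let vdbl (B : set I) : measurable B -> fine (U ((s \o dbl) @^-1` B)) = v B.
Proof.
move=> mB; rewrite /v -[in RHS]unif_dbl//.
by apply: measurable_preimageT => //; exact: measurable_even_digits.
Qed.

Let below (r : R) : set I := [set t : R | t < r].

(** Two digits are read, one of each parity: the even one rescales the threshold, the odd one
    rescales [B]. *)
Let split2 r (B : set I) : measurable B -> p (below r) B =
  1 / 4 * (p (below (2 * r)) (half 0 @^-1` B) + p (below (2 * r)) (half 1 @^-1` B) +
     (p (below (2 * r - 1)) (half 0 @^-1` B) + p (below (2 * r - 1)) (half 1 @^-1` B))).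
Proof.
move=> mB; rewrite /p (split_bit (measurable_lt_set r) mB).
have h i : half i @^-1` (below r) = below (2 * r - i).
  by apply/seteqP; split=> t; rewrite /half /below /=; lra.
rewrite !h subr0 (split_bit mB (measurable_lt_set (2 * r))) (split_bit mB (measurable_lt_set (2 * r - 1))).
by lra.
Qed.

Let vsplit (B : set I) : measurable B -> v B = 1 / 2 * (v (half 0 @^-1` B) + v (half 1 @^-1` B)).
Proof.
move=> mB; have := split_bit mB measurableT.
rewrite !preimage_setT setIT !setTI => e; rewrite [LHS]e.
by rewrite !vdbl//; apply: measurable_preimageT.
Qed.

Let p_le0 r (B : set I) : r <= 0 -> p (below r) B = 0.
Proof.
move=> r0; rewrite /p (_ : s @^-1` below r = set0) ?set0I ?measure0//.
by apply/seteqP; split=> t //=; rewrite /below/=; have := even_digits01 t; lra.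
Qed.

(** Strictness matters, since [even_digits] may equal 1. *)
Let p_gt1 r (B : set I) : 1 < r -> measurable B -> p (below r) B = v B.
Proof.
move=> r1 mB; rewrite /p (_ : s @^-1` below r = setT) ?setTI ?vdbl//.
by apply/seteqP; split=> t //= _; rewrite /below/=; have := even_digits01 t; lra.
Qed.

Let v01 B : measurable B -> 0 <= v B <= 1.
Proof.
move=> mB; have mv : measurable (s @^-1` B) by apply: measurable_preimageT => //; exact: measurable_even_digits.
rewrite /v fine_ge0//= -lee_fin fineK ?fin_num_measure//; exact: probability_le1.
Qed.

(* The error satisfies a contraction with factor 1/2 under [split2]. *)
Let indep_approx n r (B : set I) : measurable B ->
  `|p (below r) B - clip01 r * v B| <= (1 / 2) ^+ n.
Proof.
elim: n r B => [|n ih] r B mB.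
  rewrite expr0; have /andP[v0 v1] := v01 mB; have /andP[c0 c1] := clip01_bound r.
  have p0 : 0 <= p (below r) B by apply: fine_ge0.
  have p1 : p (below r) B <= 1.
    rewrite /p -lee_fin fineK; first apply: probability_le1.
      by apply: measurableI; apply: measurable_preimageT => //; [exact: measurable_even_digits|exact: measurable_lt_set|apply: measurableT_comp; [exact: measurable_even_digits|exact: measurable_dbl]].
    apply: fin_num_measure; apply: measurableI; apply: measurable_preimageT => //; [exact: measurable_even_digits|exact: measurable_lt_set|apply: measurableT_comp; [exact: measurable_even_digits|exact: measurable_dbl]].
  have cv0 : 0 <= clip01 r * v B by rewrite mulr_ge0.
  have cv1 : clip01 r * v B <= 1 by rewrite -[leRHS]mulr1 ler_pM.
  by rewrite ler_norml; lra.
have mB0 : measurable (half 0 @^-1` B) by exact: measurable_preimageT.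
have mB1 : measurable (half 1 @^-1` B) by exact: measurable_preimageT.
have vB := vsplit mB.
rewrite split2// exprS.
(* Two of the four terms are now exact: for [r <= 1/2] those with threshold [2 r - 1] vanish,
   otherwise those with threshold [2 r] are full. The other two carry weight 1/4 each, whence the
   factor 1/2. *)
have [r2|r2] := leP r (1 / 2).
  rewrite !(@p_le0 (2 * r - 1)); [|lra..].
  rewrite clip01_half// vB.
  have := ih (2 * r) _ mB0; have := ih (2 * r) _ mB1; rewrite !ler_norml.
  by move=> /andP[a1 a2] /andP[a3 a4]; apply/andP; split; lra.
rewrite !(@p_gt1 (2 * r))//; [|lra..].
rewrite (clip01_half2 (ltW r2)) vB.
have := ih (2 * r - 1) _ mB0; have := ih (2 * r - 1) _ mB1; rewrite !ler_norml.
by move=> /andP[a1 a2] /andP[a3 a4]; apply/andP; split; lra.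
Qed.

Let indep_below r (B : set I) : measurable B -> p (below r) B = clip01 r * v B.
Proof.
move=> mB; apply/eqP; rewrite -subr_eq0 -normr_le0; apply/ler_addgt0Pr => e e0; rewrite add0r.
have : (fun n => (1 / 2 : R) ^+ n) @ \oo --> (0 : R) by apply: cvg_expr; rewrite ger0_norm; lra.
move=> /cvgrPdist_le/(_ e e0)[n _ /(_ n (leqnn n))] /=.
by rewrite sub0r normrN ger0_norm ?exprn_ge0// => h; apply: le_trans h; exact: indep_approx.
Qed.

Lemma unif_even_digits (A : set I) : measurable A -> U (s @^-1` A) = U A.
Proof.
move=> mA; rewrite -[X in U X]setTI (@unif_borel _ _ _ U setT s 1)// ?mul1e//.
- exact: measurable_even_digits.
- move=> r; have := @indep_below r setT measurableT.
  rewrite /p /v preimage_setT setIT probability_setT mulr1 mul1r setTI => <-.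
  by rewrite fineK// fin_num_measure//; apply: measurable_preimageT; [exact: measurable_even_digits|exact: measurable_lt_set].
Qed.

(** Extends [indep_below] from half-lines to Borel sets by [unif_borel], the odd-digit event being
    the fixed event. *)
Lemma indep_even_digits (A B : set I) : measurable A -> measurable B ->
  U (s @^-1` A `&` (s \o dbl) @^-1` B) = (U A * U B)%E.
Proof.
move=> mA mB.
have msd : measurable_fun [set: I] (s \o dbl).
  by apply: measurableT_comp; [exact: measurable_even_digits|exact: measurable_dbl].
rewrite setIC (@unif_borel _ _ _ U _ s (fine (U B)))//.
- by rewrite fineK ?fin_num_measure// muleC.
- exact: fine_ge0.
- exact: measurable_preimageT.
- exact: measurable_even_digits.
move=> r; rewrite setIC; have := @indep_below r B mB.
rewrite /v unif_even_digits// mulrC => <-.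
rewrite fineK// fin_num_measure//; apply: measurableI; apply: measurable_preimageT => //; [exact: measurable_even_digits|exact: measurable_lt_set].
Qed.

End even_digits.

(** * A sequence of independent pairs of uniform numbers *)

Section iid_uniforms.
Context {R : realType}.
Local Notation I := (measurableTypeR R).
Local Notation U := (@unif R).
Local Notation s := (@even_digits R).

Definition odd_digits (t : I) : I := s (dbl t).
(** The even digits give the first number; the odd digits are split again, their even part giving
    the second number and their odd part feeding the later pairs. *)
Definition unif_pair k (t : I) : I * I :=
  let t' := iter k (odd_digits \o odd_digits) t in (s t', s (odd_digits t')).

Lemma measurable_odd_digits : measurable_fun [set: I] odd_digits.
Proof. by apply: measurableT_comp; [exact: measurable_even_digits|exact: measurable_dbl]. Qed.

Lemma measurable_unif_pair k :
  measurable_fun [set: I] (fun t => (unif_pair k t).1) /\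
  measurable_fun [set: I] (fun t => (unif_pair k t).2).
Proof.
have ms := @measurable_even_digits R; have mo := measurable_odd_digits.
have mi : measurable_fun [set: I] (iter k (odd_digits \o odd_digits)).
  elim: k => [|k ih]; first exact: measurable_id.
  by apply: (measurableT_comp _ ih); exact: measurableT_comp.
split; first exact: (measurableT_comp ms mi).
by apply: (measurableT_comp ms); exact: (measurableT_comp mo mi).
Qed.

Lemma iid_unif_pair n (A B : nat -> set I) :
  (forall k, measurable (A k)) -> (forall k, measurable (B k)) ->
  U [set t | forall k, (k <= n)%N -> A k (unif_pair k t).1 /\ B k (unif_pair k t).2] =
  (\prod_(k < n.+1) (U (A k) * U (B k)))%E.
Proof.
have ms := @measurable_even_digits R; have mo := measurable_odd_digits.
elim: n A B => [|n ih] A B mA mB.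
  rewrite big_ord1 -[U (B 0%N)]unif_even_digits// -indep_even_digits//; last exact: measurable_preimageT.
  congr (U _); apply/seteqP; split=> t /= h; first by have [] := h 0%N isT.
  by case.
rewrite big_ord_recl/=.
pose E := [set t | forall k, (k <= n)%N -> A k.+1 (unif_pair k t).1 /\ B k.+1 (unif_pair k t).2].
have mE : measurable E.
  rewrite (_ : E = \bigcap_(k in [set k | (k <= n)%N])
     ((fun t => (unif_pair k t).1) @^-1` A k.+1 `&` (fun t => (unif_pair k t).2) @^-1` B k.+1)) //.
  apply: bigcap_measurable; first by exists 0%N.
  by move=> k _; have [m1 m2] := measurable_unif_pair k; apply: measurableI; exact: measurable_preimageT.
have -> : [set t | forall k, (k <= n.+1)%N -> A k (unif_pair k t).1 /\ B k (unif_pair k t).2] =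
    s @^-1` A 0%N `&` (s \o dbl) @^-1` (s @^-1` B 0%N `&` (s \o dbl) @^-1` E).
  apply/seteqP; split=> t /= h.
    split; first by have [] := h 0%N isT.
    split; first by have [] := h 0%N isT.
    move=> k kn; have := h k.+1 kn; rewrite /unif_pair iterSr; exact.
  case=> [_|k kn]; first by split; [case: h|case: h => _ []].
  have [_ [_ /(_ k kn)]] := h; rewrite /unif_pair iterSr; exact.
rewrite indep_even_digits//; last by apply: measurableI; apply: measurable_preimageT => //; exact: mo.
by rewrite indep_even_digits// (ih (fun k => A k.+1) (fun k => B k.+1))// muleA.
Qed.

End iid_uniforms.

(** * Sampling from a discrete law *)

Section quantile.
Context {R : realType} {X : countType}.
Local Notation I := (measurableTypeR R).
Local Notation U := (@unif R).
Variables (p : X -> R) (x0 : X).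
Hypothesis pp : prob_vector p.

Let a n : R := oapp p 0 (@pickle_inv X n).
Let c n : R := \sum_(i < n) a i.
Let p0 x : 0 <= p x. Proof. by case: pp. Qed.
Let a0 n : 0 <= a n. Proof. by rewrite /a; case: pickle_inv. Qed.

Let c_mono m n : (m <= n)%N -> c m <= c n.
Proof. by move=> /subnK <-; elim: (n - m)%N => //= k ih; rewrite addSn /c big_ord_recr/= (le_trans ih)// lerDl. Qed.

Let c01 n : 0 <= c n <= 1.
Proof.
rewrite sumr_ge0//= -lee_fin; have [_ <-] := pp.
rewrite esum_pickle; last by move=> x; rewrite lee_fin.
rewrite /c -sumEFin -(big_mkord xpredT (fun i => (a i)%:E)).
rewrite [leRHS](_ : _ = \sum_(0 <= i <oo) (a i)%:E)%E; last first.
  by apply: eq_eseriesr => i _; rewrite /a; case: pickle_inv.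
by apply: nneseries_lim_ge => i _; rewrite lee_fin.
Qed.

Let cell (x : X) : set I := [set t : R | c (choice.pickle x) <= t < c (choice.pickle x).+1].

Let cell_inj x y t : cell x t -> cell y t -> x = y.
Proof.
rewrite /cell/= => /andP[x1 x2] /andP[y1 y2].
apply: (pcan_inj (@choice.pickleK X)).
have [xy|yx|//] := ltngtP (choice.pickle x) (choice.pickle y).
  by have := lt_le_trans x2 (le_trans (c_mono xy) y1); rewrite ltxx.
by have := lt_le_trans y2 (le_trans (c_mono yx) x1); rewrite ltxx.
Qed.

Let cellE x : cell x = [set t : R | t < c (choice.pickle x).+1] `\` [set t : R | t < c (choice.pickle x)].
Proof.
apply/seteqP; split=> t; rewrite /cell/=.
  by move=> /andP[h1 h2]; split=> //; apply/negP; rewrite -leNgt.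
by move=> [h2 /negP]; rewrite -leNgt => ->.
Qed.

Let mcell x : measurable (cell x).
Proof. by rewrite cellE; apply: measurableD; exact: measurable_lt_set. Qed.

Let unif_cell x : U (cell x) = (p x)%:E.
Proof.
rewrite cellE.
transitivity (U [set t : R | (t < c (choice.pickle x).+1)%R] - U [set t : R | (t < c (choice.pickle x))%R])%E.
  rewrite measureD; [|exact: measurable_lt_set|exact: measurable_lt_set|].
    by rewrite setIC setIidl// => t /= h; apply: lt_le_trans h _; exact: c_mono.
  by rewrite ltey_eq fin_num_measure//; exact: measurable_lt_set.
rewrite !unif_lt !clip01_id// -EFinB /c big_ord_recr/= addrAC subrr add0r.
by rewrite /a choice.pickleK_inv.
Qed.

Definition quantile (t : I) : X := xget x0 [set x | cell x t].

Let quantileP x t : cell x t -> quantile t = x.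
Proof. by move=> ct; rewrite /quantile; case: xgetP => [y _ cy|/(_ x)//]; exact: cell_inj cy ct. Qed.

Let quantileE x : x != x0 -> quantile @^-1` [set x] = cell x.
Proof.
move=> xx0; apply/seteqP; split=> t /=; last exact: quantileP.
by rewrite /quantile; case: xgetP => [y -> cy <-//|_ e]; rewrite e eqxx in xx0.
Qed.

Lemma measurable_quantile x : measurable (quantile @^-1` [set x]).
Proof.
have [->|/quantileE ->//] := eqVneq x x0.
pose D n : set I := if @pickle_inv X n is Some y then if y == x0 then set0 else cell y else set0.
rewrite (_ : _ @^-1` _ = ~` \bigcup_n D n).
  apply/measurableC/bigcupT_measurable => n; rewrite /D; case: pickle_inv => // y.
  by case: ifP.
apply/seteqP; split=> t /=.
  move=> q0 [n _]; rewrite /D; case: pickle_inv => // y; case: eqVneq => // yx0 cy.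
  by move: yx0; rewrite -q0 (quantileP cy) eqxx.
move=> h; apply: contrapT => q0; apply: h; exists (choice.pickle (quantile t)) => //.
rewrite /D choice.pickleK_inv; case: eqVneq => // qx.
by have : (quantile @^-1` [set quantile t]) t by []; rewrite quantileE.
Qed.

(** Each fibre contains its cell, so its mass is at least [p x]; both families sum to 1, which
    forces equality even at [x0], whose fibre also takes the points outside all cells. *)
Lemma unif_quantile x : U (quantile @^-1` [set x]) = (p x)%:E.
Proof.
pose Q x := fine (U (quantile @^-1` [set x])).
suff QE : Q =1 p by rewrite -QE fineK// fin_num_measure//; exact: measurable_quantile.
have /prob_vectorP[sm p1] := pp.
have [sQ Q1] := @Ex_partition _ _ R U X quantile (fun=> 1) measurable_quantile (bmf_cst 1) (fun=> ler01).
have eQ z : Ex U (fun w => 1 * (quantile w == z)%:R) = Q z.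
  rewrite (@Ex_indic _ _ _ U (quantile @^-1` [set z])) ?mul1r//; first exact: measurable_quantile.
  move=> w; rewrite mul1r; congr (nat_of_bool _)%:R.
  by apply/eqP/idP => [h|/set_mem//]; exact/mem_set.
rewrite (eq_rsum eQ) Ex_cst in Q1; have {}sQ := nnsumm_ext eQ sQ.
have pQ z : 0 <= Q z - p z <= Q z.
  rewrite subr_ge0 gerBl p0 andbT -lee_fin fineK ?fin_num_measure//; last exact: measurable_quantile.
  rewrite -unif_cell; apply: le_measure; rewrite ?inE//; first exact: measurable_quantile.
  by move=> t ct; exact: quantileP.
have sd := nnsumm_le pQ sQ.
have := rsumD sd sm; rewrite p1 (@eq_rsum _ _ _ Q) ?Q1 => [e|z]; last by rewrite subrK.
have d0 : rsum (fun z => Q z - p z) = 0 by lra.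
by move=> z; apply/eqP; rewrite -subr_eq0 (rsum_eq0 sd d0).
Qed.

End quantile.

(** * A chain and its sticks built from uniform numbers *)

Section realization.
Context {R : realType} {X : countType}.
Local Notation I := (measurableTypeR R).
Local Notation U := (@unif R).
Variables (mu : X -> R) (K : X -> X -> R) (x0 : X) (g : I -> R).
Hypotheses (pmu : prob_vector mu) (pK : forall x, prob_vector (K x)).
Hypothesis mg : measurable_fun [set: I] g.

Definition real_stick k (t : I) : R := g (unif_pair k t).2.

Fixpoint real_chain k (t : I) : X :=
  quantile (if k is m.+1 then K (real_chain m t) else mu) x0 (unif_pair k t).1.

Lemma measurable_real_stick k : measurable_fun [set: I] (real_stick k).
Proof. by apply: (measurableT_comp mg); have [] := @measurable_unif_pair R k. Qed.

Lemma measurable_real_chain k x : measurable (real_chain k @^-1` [set x]).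
Proof.
elim: k x => [|k ih] x.
  rewrite (_ : _ @^-1` _ = (fun t => (unif_pair 0 t).1) @^-1` (quantile mu x0 @^-1` [set x]))//.
  by apply: measurable_preimageT; [exact: (measurable_unif_pair 0).1|exact: measurable_quantile].
pose D n : set I := if @pickle_inv X n is Some y then real_chain k @^-1` [set y] `&`
  (fun t => (unif_pair k.+1 t).1) @^-1` (quantile (K y) x0 @^-1` [set x]) else set0.
rewrite (_ : _ @^-1` _ = \bigcup_n D n).
  apply: bigcupT_measurable => n; rewrite /D; case: pickle_inv => // y.
  apply: measurableI => //; apply: measurable_preimageT; first exact: (measurable_unif_pair k.+1).1.
  exact: measurable_quantile.
apply/seteqP; split=> t /=.
  move=> h; exists (choice.pickle (real_chain k t)) => //.
  by rewrite /D choice.pickleK_inv.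
by move=> [n _]; rewrite /D; case: pickle_inv => // y /= [<-].
Qed.

Lemma real_cylinder n (y : nat -> X) (B : nat -> set R) : (forall k, measurable (B k)) ->
  U [set t | forall k, (k <= n)%N -> real_chain k t = y k /\ B k (real_stick k t)] =
  ((mu (y 0%N) * \prod_(k < n) K (y k) (y k.+1))%:E * \prod_(k < n.+1) U (g @^-1` B k))%E.
Proof.
move=> mB.
(* On the cylinder the row used at time [m.+1] is that of the prescribed state [y m], so the event
   becomes a product event for the independent pairs. *)
pose law k := if k is m.+1 then K (y m) else mu.
pose A k := quantile (law k) x0 @^-1` [set y k].
have plaw k : prob_vector (law k) by case: k => [|k]; [exact: pmu|exact: pK].
have mA k : measurable (A k) by exact: measurable_quantile.
have mgB k : measurable (g @^-1` B k) by rewrite -[X in measurable X]setTI; apply: mg.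
have -> : [set t | forall k, (k <= n)%N -> real_chain k t = y k /\ B k (real_stick k t)] =
    [set t | forall k, (k <= n)%N -> A k (unif_pair k t).1 /\ (g @^-1` B k) (unif_pair k t).2].
  apply/seteqP; split=> t /= h k kn; have [h1 h2] := h k kn; split=> //.
    move: h1; rewrite /A/=; case: k kn h2 => [|k] kn h2 /=; first by [].
    by have [-> _] := h k (ltnW kn).
  elim: k kn h1 h2 => [|k ih] kn h1 h2 //=.
  by have [k1 k2] := h k (ltnW kn); rewrite (ih (ltnW kn) k1 k2).
rewrite (iid_unif_pair n (B := fun k => g @^-1` B k) mA mgB) big_split/=; congr (_ * _)%E.
rewrite (eq_bigr (fun k : 'I_n.+1 => (law k (y k))%:E)); last first.
  by move=> k _; rewrite /A unif_quantile.
by rewrite prodEFin big_ord_recl.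
Qed.

End realization.

(** * The jump kernel and its uniformisation *)

Section jump_kernel.
Context {R : realType} {X : countType}.
Variables (H : X -> X -> R) (theta : R).
Hypotheses (theta0 : 0 < theta) (sQ : stochastic (Qmat H theta)).

Let Q0 x y : 0 <= Qmat H theta x y. Proof. exact: sQ.1. Qed.

Lemma rate_bound x : 0 <= - H x x <= theta.
Proof.
have [s1 e1] := sQ.2 x; have := Q0 x x; have := ler_term_rsum x s1.
rewrite e1 /Qmat eqxx gerDl -subr_ge0 sub0r.
rewrite -mulNr pmulr_lge0 ?invr_gt0// => -> /=.
by rewrite -[1](@divff _ theta) ?gt_eqF// -mulrDl pmulr_lge0 ?invr_gt0//; lra.
Qed.

(** The diagonal entry is already 1 and the row sums to 1. This matches the separate clause of [KG]
    for absorbing states. *)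
Let Q_absorbing x y : H x x = 0 -> Qmat H theta x y = (x == y)%:R.
Proof.
move=> hx; have [<-|xy] := eqVneq x y; first by rewrite /Qmat eqxx hx mul0r addr0.
have [sx ex] := sQ.2 x; have [si ei] := rsum_indic (R := R) x.
have d z : 0 <= Qmat H theta x z - (x == z)%:R <= Qmat H theta x z.
  rewrite gerBl ler0n andbT subr_ge0; have [<-|_] := eqVneq x z; last exact: Q0.
  by rewrite /Qmat eqxx hx mul0r addr0.
have sd := nnsumm_le d sx.
have e := rsumD sd si; rewrite (@eq_rsum _ _ _ (Qmat H theta x)) in e; last by move=> z; rewrite subrK.
rewrite ex ei in e; have d0 : rsum (fun z => Qmat H theta x z - (x == z)%:R) = 0 by lra.
by have := rsum_eq0 sd d0 y; rewrite (negbTE xy) subr0.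
Qed.

(** The chain of [Qmat H theta] follows the jump kernel with probability [- H x x / theta] and stays
    put otherwise. *)
Lemma KG_unif x y :
  - H x x * KG H x y + (theta - - H x x) * (x == y)%:R = theta * Qmat H theta x y.
Proof.
have [hx|hx] := eqVneq (H x x) 0.
  by rewrite Q_absorbing// hx oppr0 mul0r add0r subr0.
rewrite /KG (negbTE hx) /Qmat; have [->|xy] := eqVneq x y.
  by rewrite /=; field; rewrite gt_eqF.
by rewrite /=; field; rewrite hx gt_eqF.
Qed.

Lemma stochastic_KG : stochastic (KG H).
Proof.
have K0 x y : 0 <= KG H x y.
  rewrite /KG; have [//|xy] := eqVneq x y; first by case: ifP.
  case: eqP => // _; rewrite divr_ge0 //; last by case/andP: (rate_bound x).
  by have := Q0 x y; rewrite /Qmat (negbTE xy) add0r pmulr_lge0 ?invr_gt0.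
split=> // x; have [hx|hx] := eqVneq (H x x) 0.
  have e y : (x == y)%:R = KG H x y by rewrite /KG hx eqxx; case: eqVneq.
  by have [s1 e1] := rsum_indic (R := R) x; split; [exact: nnsumm_ext s1|rewrite -(eq_rsum e)].
have [sx ex] := sQ.2 x; have [si ei] := rsum_indic (R := R) x.
have /andP[c0 ct] := rate_bound x.
have cp : 0 < - H x x by rewrite lt_neqAle c0 andbT eq_sym oppr_eq0.
have sK : nnsumm (KG H x).
  apply: (@nnsumm_le _ _ _ (fun y => theta / (- H x x) * Qmat H theta x y)); last first.
    by apply: nnsummZ => //; rewrite divr_ge0// ltW.
  move=> y; rewrite K0/= mulrAC -KG_unif ler_pdivlMr// mulrC lerDl mulr_ge0//.
  by rewrite subr_ge0.
split=> //.
have tc : 0 <= theta - - H x x by rewrite subr_ge0.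
have := rsumD (nnsummZ c0 sK) (nnsummZ tc si).
rewrite !rsumZ// ei (eq_rsum (KG_unif x)) rsumZ ?ltW// ex !mulr1 => e.
by apply: (mulfI (lt0r_neq0 cp)); rewrite mulr1; lra.
Qed.

End jump_kernel.

(** * Empirical vectors as random points of the simplex *)

Section empirical_vectors.
Context {R : realType} {X : countType}.

Lemma empirical_prob (Ts : nat -> X) n : prob_vector (empirical Ts n.+1 : X -> R).
Proof.
have s k : nnsumm (fun l => (Ts k == l)%:R : R) by have [] := rsum_indic (R := R) (Ts k).
have ss : nnsumm (fun l => \sum_(k < n.+1) (Ts k == l)%:R : R) by apply: nnsumm_sum => k.
apply/prob_vectorP; split; first by apply: nnsummZ.
rewrite rsumZ// rsum_sum// (eq_bigr (fun=> 1)).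
  by rewrite sumr_const card_ord -[_ *+ _]/(n.+1%:R) mulVf.
by move=> k _; have [] := rsum_indic (R := R) (Ts k).
Qed.

Lemma measurable_empirical d (Omega : measurableType d) (T : nat -> Omega -> X) n l :
  (forall k x, measurable (T k @^-1` [set x])) ->
  measurable_fun [set: Omega] (fun w => empirical (T ^~ w) n l : R).
Proof.
move=> mT.
have : bmf (fun w => empirical (T ^~ w) n l : R).
  by apply: bmfZ; apply: bmf_sum => k; exact: bmf_indic.
by case.
Qed.

End empirical_vectors.

(** * The weighted vector as limit in law *)

Section limit_realization.
Context {R : realType} {X : countType}.
Variables (G : X -> X -> R) (theta : R) (M : nat) (pi mu : X -> R).
Context {d : measure_display} {Omega : measurableType d}.
Variables (P : probability Omega R) (T : nat -> Omega -> X).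
Hypotheses (gG : generator G) (theta0 : 0 < theta) (ut : unif_rate G < theta) (uM : unif_rate G < M%:R).
Hypotheses (ppi : prob_vector pi) (smu : stationary mu (Qmat G theta)).
Hypothesis cpi : forall j, (fun n => vecmatn pi (Qmat G theta) n j) @ \oo --> mu j.
Hypothesis mcT : markov_chain P T pi (fun k => Kinh G M k.+1).

Context {d0 d2 : measure_display} {Omega0 : measurableType d0} {O2 : measurableType d2}.
Variables (P0 : probability Omega0 R) (Y : nat -> Omega0 -> X) (S : nat -> Omega0 -> R).
Variables (K : X -> X -> R) (c : X -> R).
Variables (m2 : X -> {measure set O2 -> \bar R}) (F2 Z2 : X -> O2 -> R).
Hypotheses (mF2 : forall x, measurable_fun [set: O2] (F2 x)) (mZ2 : forall x, measurable_fun [set: O2] (Z2 x)).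
Hypotheses (F20 : forall x t, 0 <= F2 x t) (mass1 : forall x, lawint m2 F2 Z2 x (fun=> 1) = 1%E).
Hypotheses (mY : forall k x, measurable (Y k @^-1` [set x])) (mS : forall k, measurable_fun [set: Omega0] (S k)).
Hypothesis cyl : forall n (y : nat -> X) (B : nat -> set R), (forall k, measurable (B k)) ->
  P0 [set w | forall k, (k <= n)%N -> Y k w = y k /\ B k (S k w)] =
  ((mu (y 0%N) * \prod_(k < n) K (y k) (y k.+1))%:E * \prod_(k < n.+1) lawint m2 F2 Z2 (y k) \1_(B k))%E.
Hypothesis law_unit : forall x, lawint m2 F2 Z2 x \1_(~` `[0%R, 1%R]%classic) = 0%E.
Hypothesis law_beta : forall x r, (c x + r%:R) * lawmom m2 F2 Z2 x 0 r = c x.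
Hypotheses (sK : stochastic K) (c_bound : forall x, 0 <= c x <= theta).
Hypothesis K_unif : forall x y,
  c x * K x y + (theta - c x) * (x == y)%:R = theta * Qmat (Grev G mu) theta x y.

Local Notation b := (lawmom m2 F2 Z2).
Let Z k w := clip01 (S k w).

Let pmu : prob_vector mu. Proof. by case: smu. Qed.
Let mu0 x : 0 <= mu x. Proof. by case: pmu. Qed.

Let mp : moment_process P0 Y Z mu K b.
Proof. exact: (stick_moment_process mF2 mZ2 F20 mass1 mY mS cyl). Qed.

Let b01 x s r : 0 <= b x s r <= 1. Proof. exact: lawmom_bound. Qed.
Let b00 x : b x 0 0 = 1. Proof. exact: lawmom00. Qed.

(** A Beta(1, c) stick leaves the mean proportion [c / (c + 1)], which is at most this value for
    [c <= theta]. *)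
Let rho := theta / (theta + 1).

Let full : P0 (~` good_sticks S) = 0%E.
Proof.
have t1 : 0 < theta + 1 by rewrite addr_gt0.
apply: (good_sticks_full (rho := rho) mS mp sK pmu b01 b00).
- by rewrite /rho divr_ge0 ?ltW//= ltr_pdivrMr// mul1r ltrDl.
- move=> x; have := law_beta x 1; have /andP[c0 ct] := c_bound x.
  have [b0 _] := andP (b01 x 0 1) => e.
  rewrite /rho ler_pdivlMr//; nra.
- apply: (cyl_unit_sticks mY mS (law := fun x B => lawint m2 F2 Z2 x \1_B) cyl) => // x.
  by rewrite -[RHS](mass1 x); apply: eq_integral => t _; rewrite indicE in_setT.
Qed.

Let mgood : measurable (good_sticks S).
Proof. exact: measurable_good_sticks mS mp. Qed.

(** The value [mu] on the exceptional null event makes this a probability vector at every sample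
    point, as the convergence theorem requires. *)
Definition limit_vector w : {ptws X -> R} :=
  if w \in good_sticks S then weighted_vector (fun j => S j w) (fun j => Y j w) else mu.

Lemma limit_vector_prob w : prob_vector (limit_vector w).
Proof. by rewrite /limit_vector; case: ifPn => // /set_mem; exact: good_sticks_prob. Qed.

Lemma measurable_limit_vector l : measurable_fun [set: Omega0] (fun w => limit_vector w l).
Proof.
have [mo _] := bmf_occlimX mp (occ_bound [:: l]) 0 1.
have m1 : measurable_fun [set: Omega0] (\1_(good_sticks S) : Omega0 -> R) by exact: measurable_indic.
rewrite (_ : (fun w => _) = fun w => \1_(good_sticks S) w * occlim Y Z (occ [:: l]) 0 w ^+ 1 +
    (1 - \1_(good_sticks S) w) * mu l).
  apply: measurable_funD; first exact: measurable_funM.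
  by apply: measurable_funM => //; exact: measurable_funB.
apply/funext => w; rewrite /limit_vector indicE; case: ifPn => [/set_mem gw|_].
  by rewrite mul1r subrr mul0r addr0 expr1 -(good_sticks_occ Y [:: l] gw) big_seq1.
by rewrite mul0r add0r subr0 mul1r.
Qed.

Lemma limit_vector_integral (f : {ptws X -> R} -> R) :
  (\int[P0]_w (f (limit_vector w))%:E =
   \int[P0]_w (f (weighted_vector (fun j => S j w) (fun j => Y j w)))%:E)%E.
Proof.
apply: (integral_eq_on_full mgood full) => w gw.
by rewrite /limit_vector mem_set.
Qed.

Lemma limit_vector_moments (L : seq X) k :
  (fun n => Ex P (fun w => (\sum_(x <- L) empirical (T ^~ w) n.+1 x) ^+ k)) @ \oo -->
  Ex P0 (fun w => (\sum_(x <- L) limit_vector w x) ^+ k).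
Proof.
have oE : Ex P0 (fun w => (\sum_(x <- L) limit_vector w x) ^+ k) = rsum (occmom P0 Y Z (occ L) k).
  rewrite (occmom_sum mp (occ_bound L) k).2 /Ex; congr fine.
  apply: (integral_eq_on_full mgood full) => w gw.
  by rewrite /limit_vector mem_set// good_sticks_occ.
rewrite oE; apply: (occupation_cvg gG theta0 ut uM ppi smu cpi mcT).
- by move=> k'; exact: (occmom_sum mp (occ_bound L) k').1.
- exact: (occmom_init mp sK mu0 b01 b00).
- have c0 x : 0 <= c x by case/andP: (c_bound x).
  have ct x : c x <= theta by case/andP: (c_bound x).
  have bS x s r : b x s.+1 r = b x s r - b x s r.+1 by exact: lawmomS.
  have balance x z := Grev_balance gG smu x z ut.
  move=> k' y.
  exact: (occmom_rec mp sK mu0 b01 b00 (occ_bound L) c0 law_beta bS K_unif balance theta0 ct (stochastic_Qmat gG ut)).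
Qed.

Lemma limit_vector_cvg : cvg_in_law P (fun n w => empirical (fun k => T k w) n) P0 limit_vector.
Proof.
move=> f bf.
(* The empirical vector of length 0 is the zero vector, so the sequence is shifted by one. *)
rewrite -(@cvg_shiftS _ (fun n => \int[P]_w (f (empirical (T ^~ w) n))%:E)%E).
apply: (cvg_in_law_moments (V := fun n w => empirical (T ^~ w) n.+1)) => //.
- by move=> n w; exact: empirical_prob.
- exact: limit_vector_prob.
- by move=> n x; apply: measurable_empirical; exact: mcT.1.
- exact: measurable_limit_vector.
- exact: limit_vector_moments.
Qed.

End limit_realization.

(** * Sampling a Beta(1, theta) stick *)

Section stick_from_uniform.
Context {R : realType}.
Local Notation I := (measurableTypeR R).
Local Notation U := (@unif R).
Variable theta : R.
Hypothesis theta0 : 0 < theta.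

(* Inverse distribution function of Beta(1, theta). *)
Definition unif_stick (t : I) : R := 1 - powR (1 - clip01 t) theta^-1.

Lemma unif_stick_unit t : 0 <= unif_stick t <= 1.
Proof.
have /andP[c0 c1] := clip01_bound t.
have u0 : 0 <= 1 - clip01 t by lra.
have u1 : 1 - clip01 t <= 1 by lra.
rewrite /unif_stick subr_ge0 lerBlDr lerDl powR_ge0 andbT.
have i0 : 0 <= theta^-1 by rewrite invr_ge0 ltW.
have u0' : 1 - clip01 t \in Num.nneg by rewrite nnegrE.
have n1 : (1 : R) \in Num.nneg by rewrite nnegrE.
by have := ge0_ler_powR i0 u0' n1 u1; rewrite powR1.
Qed.

Lemma measurable_unif_stick : measurable_fun [set: I] unif_stick.
Proof.
apply: measurable_funB => //; apply: (measurableT_comp (measurable_powR _)).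
by apply: measurable_funB => //; exact: measurable_clip01.
Qed.

(** As [1 - Z = (1 - U)^(1 / theta)], the moment is the integral of [(1 - t)^(r / theta)], that is
    [theta / (theta + r)]. *)
Lemma unif_stick_residual r : (theta + r%:R) *
  fine (\int[U]_t (1 * stickmono 0 r (unif_stick t))%:E)%E = theta.
Proof.
pose a := r%:R / theta + 1.
have a0 : 0 < a by rewrite /a ltr_wpDl// divr_ge0// ltW.
have mpow : measurable_fun [set: I] (fun t => (a * powR (1 - t) (a - 1))%:E).
  apply/measurable_EFinP; apply: measurable_funM => //.
  by apply: (measurableT_comp (measurable_powR _)); exact: measurable_funB.
have -> : (\int[U]_t (1 * stickmono 0 r (unif_stick t))%:E = (a^-1)%:E)%E.
  rewrite integral_uniform.
  - rewrite subr0 invr1 mul1e.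
    transitivity ((a^-1)%:E * \int[lebesgue_measure]_(t in `[0%R, 1%R]) (a * powR (1 - t) (a - 1))%:E)%E.
      rewrite -ge0_integralZl_EFin//.
      + apply: eq_integral => t; rewrite inE/= in_itv/= => t01; have /andP[t0 t1] := t01.
        rewrite -EFinM mulKf ?gt_eqF// mul1r /stickmono expr0 mul1r clip01_id ?unif_stick_unit//.
        rewrite /unif_stick clip01_id// opprB addrC subrK -powR_mulrn ?powR_ge0// -powRrM.
        by rewrite /a addrK mulrC.
      + by move=> t _; rewrite lee_fin mulr_ge0 ?powR_ge0// ltW.
      + exact: measurable_funS mpow.
      + by rewrite invr_ge0 ltW.
    by rewrite integral_powR_onem1// mule1.
  - apply/measurable_EFinP; apply: measurable_funM => //.
    exact: (measurableT_comp (measurable_stickmono 0 r) measurable_unif_stick).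
  - by move=> t; rewrite lee_fin mul1r; case/andP: (stickmono_bound 0 r (unif_stick t)).
have tr : 0 < theta + r%:R by rewrite ltr_pwDl.
rewrite /= /a; field; rewrite !gt_eqF//= addrC//.
Qed.

End stick_from_uniform.

Lemma beta1_unit {R : realType} (c : R) : beta1 c (~` `[0%R, 1%R]%classic) = 0%E.
Proof.
rewrite /beta1; case: ifP => _; last by rewrite setICl integral_set0.
by rewrite diracE memNset//= in_itv/= lexx ler01; apply.
Qed.

Theorem mainTheorem4 (R : realType) (X : countType)
  (G : X -> X -> R) (theta : R) (M : nat) (pi mu : X -> R)
  (d : measure_display) (Omega : measurableType d) (P : probability Omega R)
  (T : nat -> Omega -> X) :
  generator G -> no_zero_rows G ->
  0 < theta -> unif_rate G < theta -> unif_rate G < M%:R ->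
  prob_vector pi ->
  stationary mu (Qmat G theta) ->
  (forall j, (fun n => vecmatn pi (Qmat G theta) n j) @ \oo --> mu j) ->
  (* T k = T_{k+1}: initial law pi, kernel K_{k+1} from time k+1 to k+2 *)
  markov_chain P T pi (fun k => Kinh G M k.+1) ->
  stationary mu (Qmat (Grev G mu) theta) /\
  exists (d0 : measure_display) (Omega0 : measurableType d0)
         (P0 : probability Omega0 R) (nu : Omega0 -> {ptws X -> R}),
    (forall w, prob_vector (nu w)) /\
    (forall l, measurable_fun [set: Omega0] (fun w => nu w l)) /\
    cvg_in_law P (fun n w => empirical (fun k => T k w) n) P0 nu /\
    (* nu =d < sum_j P'_j delta_{Y'_j} > for (P', Y') ~ MCcGEM(G') wrt mu *)
    (forall (d1 : measure_display) (Omega1 : measurableType d1)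
            (P1 : probability Omega1 R)
            (Y' : nat -> Omega1 -> X) (Xs : nat -> Omega1 -> R),
        mc_with_cond_beta P1 Y' Xs mu (KG (Grev G mu))
          (fun y => - Grev G mu y y) ->
        eq_in_law P0 nu P1 (fun w => weighted_vector (fun j => Xs j w)
                                                     (fun j => Y' j w))) /\
    (* nu =d < sum_j P+_j delta_{T'_j} > with P+ ~ GEM(theta) independent of
       the stationary chain T' with kernel Q' and initial law mu *)
    (forall (d2 : measure_display) (Omega2 : measurableType d2)
            (P2 : probability Omega2 R)
            (T' : nat -> Omega2 -> X) (Xs : nat -> Omega2 -> R),
        mc_with_cond_beta P2 T' Xs mu (Qmat (Grev G mu) theta)
          (fun _ => theta) ->
        eq_in_law P0 nu P2 (fun w => weighted_vector (fun j => Xs j w)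
                                                     (fun j => T' j w))).
Proof.
move=> gG _ theta0 ut uM ppi smu cpi mcT.
split; first exact: stationary_Grev.
have sQ' := stochastic_Grev gG smu ut.
have pmu : prob_vector mu by case: smu.
have pQ' x : prob_vector (Qmat (Grev G mu) theta x) by apply/prob_vectorP; exact: sQ'.2.
(* [quantile] needs a default state; over an empty type [mu] would sum to 0. *)
have [x0] : inhabited X.
  have [_ e] := pmu; apply: contrapT => noX.
  move: e; rewrite esum1 => [/eqP|x _]; first by rewrite eq_sym onee_eq0.
  by exfalso; apply: noX; exists.
(* Every realization with Beta sticks is a limit in law of the same empirical vectors, so both
   equalities in law reduce to uniqueness of limits. *)
have beta_law_cvg (d1 : measure_display) (Omega1 : measurableType d1) (P1 : probability Omega1 R)
    (Y : nat -> Omega1 -> X) (Xs : nat -> Omega1 -> R) (K : X -> X -> R) (c : X -> R) :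
    stochastic K -> (forall x, 0 <= c x <= theta) ->
    (forall x y, c x * K x y + (theta - c x) * (x == y)%:R = theta * Qmat (Grev G mu) theta x y) ->
    mc_with_cond_beta P1 Y Xs mu K c -> forall f, bc_test f ->
    (fun n => \int[P]_w (f (empirical (T ^~ w) n))%:E)%E @ \oo -->
    (\int[P1]_w (f (weighted_vector (fun j => Xs j w) (fun j => Y j w)))%:E)%E.
  move=> sK cb Ku [mY [mX cyl]] f bf.
  have c0 x : 0 <= c x by case/andP: (cb x).
  have mF x : measurable_fun [set: measurableTypeR R] (beta_density c x) by exact: measurable_beta_density.
  have mZ (x : X) : measurable_fun [set: measurableTypeR R] (fun t => t : R) by [].
  have F0 x t : 0 <= beta_density c x t by exact: beta_density_ge0.
  have cyl' n (y : nat -> X) (B : nat -> set R) : (forall k, measurable (B k)) ->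
    P1 [set w | forall k, (k <= n)%N -> Y k w = y k /\ B k (Xs k w)] =
    ((mu (y 0%N) * \prod_(k < n) K (y k) (y k.+1))%:E *
     \prod_(k < n.+1) lawint (beta_base c) (beta_density c) (fun _ t => t : R) (y k) \1_(B k))%E.
    move=> mB; rewrite cyl//; congr (_ * _)%E; apply: eq_bigr => k _.
    by rewrite lawint_beta1.
  have lu x : lawint (beta_base c) (beta_density c) (fun _ t => t : R) x \1_(~` `[0%R, 1%R]%classic) = 0%E.
    by rewrite lawint_beta1 ?beta1_unit//; apply: measurableC; exact: measurable_itv.
  rewrite -(limit_vector_integral theta0 smu mF mZ F0 (lawint_beta_mass c0) mY mX cyl' lu (lawmom_beta c0) sK cb).
  exact: (limit_vector_cvg gG theta0 ut uM ppi smu cpi mcT mF mZ F0 (lawint_beta_mass c0) mY mX cyl' lu (lawmom_beta c0) sK cb Ku).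
(* The explicit realization uses [Q'] with constant rate [theta]: all sticks then share one law, and
   a single inverse distribution function suffices. *)
pose g := unif_stick theta.
pose Y0 := real_chain mu (Qmat (Grev G mu) theta) x0.
pose S0 := real_stick g.
have mg : measurable_fun [set: measurableTypeR R] g by exact: measurable_unif_stick.
have mS0 k : measurable_fun [set: measurableTypeR R] (S0 k) by exact: measurable_real_stick.
have mY0 k x : measurable (Y0 k @^-1` [set x]) by exact: measurable_real_chain.
pose law := lawint (fun _ : X => unif : {measure set _ -> \bar R}) (fun _ _ => 1) (fun _ => g).
have mF (x : X) : measurable_fun [set: measurableTypeR R] (fun=> 1 : R) by exact: measurable_cst.
have F0 (x : X) (t : measurableTypeR R) : 0 <= (1 : R) by [].
have lawE x B : measurable B -> law x \1_B = unif (g @^-1` B).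
  move=> mB; have mgB : measurable (g @^-1` B) by rewrite -[X in measurable X]setTI; apply: mg.
  rewrite -[X in unif X]setIT -integral_indic//; apply: eq_integral => t _.
  by rewrite mul1r.
have mass x : law x (fun=> 1) = 1%E.
  by rewrite /law /lawint integral_cst//= mulr1 mul1e probability_setT.
have cyl n (y : nat -> X) (B : nat -> set R) : (forall k, measurable (B k)) ->
    unif [set w | forall k, (k <= n)%N -> Y0 k w = y k /\ B k (S0 k w)] =
    ((mu (y 0%N) * \prod_(k < n) Qmat (Grev G mu) theta (y k) (y k.+1))%:E *
     \prod_(k < n.+1) law (y k) \1_(B k))%E.
  move=> mB; rewrite real_cylinder//; congr (_ * _)%E; apply: eq_bigr => k _.
  by rewrite lawE.
have lu x : law x \1_(~` `[0%R, 1%R]%classic) = 0%E.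
  rewrite lawE; last by apply: measurableC; exact: measurable_itv.
  rewrite (_ : _ @^-1` _ = set0) ?measure0//; apply/seteqP; split=> // t /=.
  by rewrite in_itv/= unif_stick_unit.
have lb (x : X) r : (theta + r%:R) * fine (law x (stickmono 0 r)) = theta by exact: unif_stick_residual.
have cb (x : X) : 0 <= theta <= theta by rewrite lexx ltW.
have Ku x y : theta * Qmat (Grev G mu) theta x y + (theta - theta) * (x == y)%:R = theta * Qmat (Grev G mu) theta x y.
  by rewrite subrr mul0r addr0.
exists _, (measurableTypeR R), unif, (limit_vector mu Y0 S0).
have cvg0 := limit_vector_cvg gG theta0 ut uM ppi smu cpi mcT mF (fun=> mg) F0 mass mY0 mS0 cyl lu lb sQ' cb Ku.
split; [by move=> w; exact: (limit_vector_prob smu)|split; [|split; [exact: cvg0|split]]].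
- move=> l; exact: (measurable_limit_vector mF (fun=> mg) F0 mass mY0 mS0 cyl l).
- move=> d1 Omega1 P1 Y' Xs mc f bf.
  have rb := rate_bound theta0 sQ'.
  have h := beta_law_cvg _ _ _ _ _ _ _ (stochastic_KG theta0 sQ') rb (KG_unif theta0 sQ') mc f bf.
  by rewrite -(cvg_lim _ (cvg0 f bf))// (cvg_lim _ h).
- move=> d1 Omega1 P1 Y' Xs mc f bf.
  have h := beta_law_cvg _ _ _ _ _ _ _ sQ' cb Ku mc f bf.
  by rewrite -(cvg_lim _ (cvg0 f bf))// (cvg_lim _ h).
Qed.
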